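(* Let $d=d_0+d_1$ with $d_0,d_1\ge 1$, and let $(X_n)_{n\ge 0}$ be a random walk in a random cookie environment $\omega=(\omega_{x,m}(\cdot))_{x\in\mathbb{Z}^d,\,m\in\mathbb{N}}$, where $(\omega_{x,\cdot}(\cdot))_{x\in\mathbb{Z}^d}$ are i.i.d. with common law $\mu\in\mathcal{M}_1(\mathcal{M}_1(\mathbb{Z}^d)^{\mathbb{N}})$. Assume: (a') There exists $K>0$ such that $\omega_{x,m}(\cdot)$ is a.s. supported on $[-K,K]^d$ for all $m\in\mathbb{N}$. (b') There exist $\delta>0$ and $q\in\mathcal{M}_1(\mathbb{Z}^{d_1})$ with $q(0)=0$ such that, for all $m\in\mathbb{N}$, a.s. $$(\omega_{x,m}\circ\Pi_{d_1}^{-1})(\cdot)=\alpha_{\omega_{x,m}}\,q(\cdot)+(1-\alpha_{\omega_{x,m}})\,\delta_0(\cdot)\qquad\text{for some }\alpha_{\omega_{x,m}}\ge\delta .$$ (c') For the two-sided random walk $(Y_n)_{n\in\mathbb{Z}}$ on $\mathbb{Z}^{d_1}$ with $Y_0=0$ and i.i.d. increments of law $q$, the set of cut times $$\mathcal{D}:=\{n\in\mathbb{Z}:\ \{Y_k:k\le n-1\}\cap\{Y_k:k\ge n\}=\emptyset\}$$ is a.s. non-empty. Then there exists a (deterministic) $v\in\mathbb{R}^d$ such that $$\lim_{n\to\infty}\frac{X_n}{n}=v\qquad P_o\text{-almost surely}.$$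
   Context: $\mathbb{N}=\{1,2,\dots\}$, and $o$ is the origin. $\mathcal{M}_1(\mathbb{Z}^d)$ is the space of probability kernels (probability mass functions) on $\mathbb{Z}^d$; $\mathcal{M}_1(E)$ denotes the probability measures on $E$. $\delta_0$ is the unit mass at $0$. $\Pi_{d_1}:\mathbb{Z}^d\to\mathbb{Z}^{d_1}$ is the projection onto the last $d_1$ coordinates, and $\omega_{x,m}\circ\Pi_{d_1}^{-1}$ is the image of $\omega_{x,m}$ under it. A cookie environment is a family $\omega=(\omega_{x,m}(\cdot))_{x\in\mathbb{Z}^d,m\in\mathbb{N}}\in\mathcal{M}_1(\mathbb{Z}^d)^{\mathbb{Z}^d\times\mathbb{N}}$. Given $\omega$, the quenched law $P_{x,\omega}$ of the walk $(X_n)_{n\ge0}$ is defined by $X_0=x$ and $$P_{x,\omega}(X_n=X_{n-1}+u\mid (X_i)_{0\le i\le n-1})=\omega_{X_{n-1},\,\ell_{n-1}(X_{n-1})}(u),\qquad n\in\mathbb{N},$$ where $\ell_n(y)=\sum_{k=0}^n 1_{\{X_k=y\}}$; i.e. on the $m$-th visit to $x$ the walk jumps according to $\omega_{x,m}$. No independence is assumed between $\omega_{x,m}$ for different $m$ at the same $x$. The environment has law $\mathbb{P}=\mu^{\otimes\mathbb{Z}^d}$ and the annealed (averaged) law is $P_x:=\mathbb{P}\times P_{x,\omega}$. *)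

(* Defs.v *)
From HB Require Import structures.
From mathcomp Require Import all_boot all_order all_algebra finmap.
From mathcomp Require Import all_classical all_reals all_analysis.

Set Implicit Arguments.
Unset Strict Implicit.
Unset Printing Implicit Defensive.

Import Order.TTheory GRing.Theory Num.Theory.
Import numFieldNormedType.Exports.

Local Open Scope classical_set_scope.
Local Open Scope ring_scope.

(* Z^d with the discrete sigma-algebra. *)
Definition lattice (d : nat) := 'rV[int]_d.

HB.instance Definition _ (d : nat) := GRing.Zmodule.on (lattice d).
HB.instance Definition _ (d : nat) := isPointed.Build (lattice d) 0.
HB.instance Definition _ (d : nat) :=
  @isMeasurable.Build default_measure_display (lattice d)
    discrete_measurable (@discrete_measurable0 _)
    (@discrete_measurableC _) (@discrete_measurableU _).

(* T^I with the product sigma-algebra, generated by the coordinate maps. *)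
Definition coord_preimages (I : Type) (dT : measure_display)
    (T : measurableType dT) : set (set (I -> T)) :=
  \bigcup_(i in [set: I])
    preimage_set_system setT (fun f : I -> T => f i) measurable.

Definition product_space (I : Type) (dT : measure_display)
    (T : measurableType dT)
  : measurableType (sigma_display (@coord_preimages I dT T)) :=
  g_sigma_algebraType (@coord_preimages I dT T).

(* P agrees on finite-dimensional boxes with the product of copies of mu;
   this determines a probability P on the product sigma-algebra. *)
Definition is_product_measure (R : realType) (I : choiceType)
    (dT : measure_display) (T : measurableType dT) (mu : probability T R)
    (P : set (product_space I T) -> \bar R) : Prop :=
  forall (S : {fset I}) (A : I -> set T), (forall i, measurable (A i)) ->
    P [set f : product_space I T | forall i, i \in S -> A i (f i)]
    = (\prod_(i <- S) fine (mu (A i)))%:E.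

(* A probability mass function is a probability measure for the discrete
   sigma-algebra.  The cookies are m = 1, 2, ...; the m-th one is stored at
   index m.-1. *)
Definition cookies (R : realType) (d : nat) :=
  product_space nat (pprobability (lattice d) R).

Definition environment (R : realType) (d : nat) :=
  product_space (lattice d) (cookies R d).

Definition trajectory (d : nat) := product_space nat (lattice d).

Definition local_time (d : nat) (X : nat -> lattice d) (n : nat)
    (y : lattice d) : nat :=
  (\sum_(0 <= k < n.+1) (X k == y))%N.

Definition agree_upto (d : nat) (n : nat) (y : nat -> lattice d)
    : set (trajectory d) :=
  [set X : trajectory d | forall k, (k <= n)%N -> X k = y k].

(* The past is discrete, so conditioning on X_0, ..., X_n is conditioning on
   the events {X_0 = y_0, ..., X_n = y_n}; the defining identity is multiplied
   by the probability of that event, which may vanish. *)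
Definition is_quenched_law (R : realType) (d : nat) (x : lattice d)
    (w : environment R d) (Q : set (trajectory d) -> \bar R) : Prop :=
  Q [set X : trajectory d | X 0%N = x] = 1%E /\
  forall (n : nat) (y : nat -> lattice d) (u : lattice d),
    Q (agree_upto n y `&` [set X : trajectory d | X n.+1 = X n + u])
    = (Q (agree_upto n y) *
       w (y n) (local_time y n (y n)).-1 [set u])%E.

(* The semidirect product of the law of the environment and the quenched
   kernel; kproduct_snd carries a parameter, here trivial. *)
Definition annealed_law (R : realType) (d : nat)
    (PP : probability (environment R d) R)
    (Q : R.-pker environment R d ~> trajectory d)
  : set (environment R d * trajectory d) -> \bar R :=
  kproduct_snd (fun _ : unit => PP) Q tt.

Definition last_coords (d0 d1 : nat) (z : lattice (d0 + d1)) : lattice d1 :=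
  rsubmx z.

Definition supported_in_box (R : realType) (d : nat) (K : R)
    (p : set (lattice d) -> \bar R) : Prop :=
  p [set z : lattice d | forall i, `|z 0 i|%:~R <= K] = 1%E.

Definition increments (d : nat) (Y : product_space int (lattice d))
  : product_space int (lattice d) := fun n => Y n - Y (n - 1).

Definition is_two_sided_walk (R : realType) (d : nat)
    (q : probability (lattice d) R)
    (PY : probability (product_space int (lattice d)) R) : Prop :=
  PY [set Y : product_space int (lattice d) | Y 0 = 0] = 1%E /\
  is_product_measure q (pushforward PY (@increments d)).

Definition cut_times (d : nat) (Y : int -> lattice d) : set int :=
  [set n : int | [set Y k | k in [set k | k <= n - 1]] `&`
                 [set Y k | k in [set k | n <= k]] = set0].

Definition scaled_position (R : realType) (d : nat) (X : nat -> lattice d)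
    (n : nat) : 'rV[R]_d :=
  n%:R^-1 *: map_mx intr (X n).

(* Main.v *)
Require Import Defs.
From HB Require Import structures.
From mathcomp Require Import all_boot all_order all_algebra finmap.
From mathcomp Require Import all_classical all_reals all_analysis.
From mathcomp Require Import measurable_realfun zify lra ring.

Set Implicit Arguments.
Unset Strict Implicit.
Unset Printing Implicit Defensive.

Import Order.TTheory GRing.Theory Num.Theory.
Import numFieldNormedType.Exports.

Local Open Scope classical_set_scope.
Local Open Scope ring_scope.

(** The projection of the walk to the last coordinates is, once its holding steps
are removed, a random walk with independent increments of law [q], whatever the
environment does: by hypothesis the direction of a jump has law [q] given the
whole past, and a holding step has conditional probability at most [rho < 1]. So
the path is decomposed into excursions, each made of holding steps followed by
one jump ([excursion_mass]), and their lengths have a finite exponential moment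
([excursion_exp_moment]).

Call a time a cut time of the jumps if the positions before it and the positions
from it on are disjoint. Before and after a cut time the walk reads the cookies
of disjoint sets of sites. Since the cookies at different sites are independent
and identically distributed, the two pieces of the path are independent given
the jumps ([path_weight_cat], [excursions_cut]). Only finite words of jumps are
conditioned on, so all expectations are sums over countable sets of paths.

Fix a bounded nonnegative function of the steps, and consider its total over each
excursion. Call an index good if there are cut times within distance [L] on both
sides of it. The conditional mean of the total at a good index, given all jumps,
depends on a window of the jumps of radius [L] only ([good_mean]), and totals at
good indices more than [L] apart are conditionally uncorrelated. The sum over the
good indices is therefore close to the sum of these means, up to a variance
linear in the number of excursions ([good_chebyshev]), and the means, being
functions of windows of independent letters, obey a law of large numbers
([words_lln]).

Bad indices are rare. As cut times exist almost surely, stationarity makes the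
density of the bad indices small when [L] is large ([no_cut_small]), and a maximal
inequality makes it small at all large times simultaneously ([maximal_ineq],
[bad_words_small]). Few excursions have small total length, by Markov's
inequality for an exponential moment ([bad_markov]). Together this gives error
probabilities of order [1 / n] for [n] excursions, outside an event of small
probability that does not depend on [n] ([excursions_concentration]).

These errors are summable along the squares [n = j ^ 2], so almost surely the
averages per excursion are eventually as close as desired to a deterministic
centre; two centres that are both approached with positive probability are close
to each other, and the averages converge to a constant
([excursion_averages_cvg]). Applied to the function and to the constant [1],
whose total is the number of steps, this yields convergence of the averages per
step at the ends of these excursions, and monotonicity fills the gaps
([additive_functional_lln]). The theorem is the case of the coordinates of the
steps, made nonnegative by adding the bound [K]. *)

Ltac nat_lia :=
  repeat match goal with
  | H : is_true (leq _ _) |- _ => revert H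
  | H : is_true (andb _ _) |- _ => revert H
  | H : is_true (negb _) |- _ => revert H
  | H : @eq nat _ _ |- _ => revert H
  end; clear; intros; lia.

(** * Sums over countable sets *)

Section esum_extra.
Context {R : realType}.
Implicit Types T : choiceType.

Lemma esumZl T (I : set T) (c : R) (a : T -> \bar R) : 0 <= c ->
  (forall i, I i -> 0 <= a i)%E ->
  (\esum_(i in I) (c%:E * a i) = c%:E * \esum_(i in I) a i)%E.
Proof.
have le_scale (b : R) (f : T -> \bar R) : 0 <= b ->
    (forall i, I i -> 0 <= f i)%E ->
    (\esum_(i in I) (b%:E * f i) <= b%:E * \esum_(i in I) f i)%E.
  move=> b0 f0; apply: ge_ereal_sup => _ [A [finA AI] <-].
  have -> : (\sum_(i \in A) b%:E * f i = b%:E * \sum_(i \in A) f i)%E.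
    rewrite !fsbig_finite//= !big_seq ge0_sume_distrr// => i.
    by rewrite in_fset_set// => /set_mem/AI/f0.
  rewrite lee_wpmul2l ?lee_fin//; apply: ereal_sup_ubound.
  by exists A.
move=> c0 a0; apply/eqP; rewrite eq_le le_scale//=.
have [->|cN0] := eqVneq c 0; last have {}c0 : 0 < c by rewrite lt_def cN0.
  by rewrite mul0e esum_ge0// => i Ii; rewrite mul0e.
have ca0 i : I i -> (0 <= c%:E * a i)%E.
  by move=> /a0; apply: mule_ge0; rewrite lee_fin ltW.
have := le_scale c^-1 (fun i => c%:E * a i)%E _ ca0.
rewrite invr_ge0 (ltW c0) => /(_ isT).
under eq_esum do rewrite muleA -EFinM mulVf ?gt_eqF// mul1e.
move=> /(lee_wpmul2l (ltW (_ : 0 < c%:E)%E)).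
by rewrite lte_fin => /(_ c0); rewrite muleA -EFinM divff ?gt_eqF// mul1e.
Qed.

Lemma esumZr T (I : set T) (c : R) (a : T -> \bar R) : 0 <= c ->
  (forall i, I i -> 0 <= a i)%E ->
  (\esum_(i in I) (a i * c%:E) = (\esum_(i in I) a i) * c%:E)%E.
Proof.
by move=> c0 a0; rewrite muleC -esumZl//; apply: eq_esum => i _; rewrite muleC.
Qed.

Lemma esum_subset T (I J : set T) (a : T -> \bar R) : I `<=` J ->
  (forall i, J i -> 0 <= a i)%E ->
  (\esum_(i in I) a i <= \esum_(i in J) a i)%E.
Proof.
move=> IJ a0.
rewrite [leLHS]esum_mkcond [leRHS]esum_mkcond; apply: le_esum => i _.
case: ifPn => [/set_mem/IJ iJ|_]; first by rewrite mem_set.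
by case: ifPn => // /set_mem/a0.
Qed.

Lemma esum_setU_le T (I J : set T) (a : T -> \bar R) :
  (forall i, I i -> 0 <= a i)%E -> (forall i, J i -> 0 <= a i)%E ->
  (\esum_(i in I `|` J) a i <= \esum_(i in I) a i + \esum_(i in J) a i)%E.
Proof.
move=> aI aJ; rewrite (esumID J); last by move=> i [/aI|/aJ].
rewrite addeC; apply: leeD.
  by apply: esum_subset aI => i -[[]].
by apply: esum_subset aJ => i [].
Qed.

Lemma measure_esum d (S : measurableType d) (mu : {measure set S -> \bar R})
    (T : countType) (I : set T) (F : T -> set S) :
  (forall i, I i -> measurable (F i)) -> trivIset I F ->
  mu (\bigcup_(i in I) F i) = (\esum_(i in I) mu (F i))%E.
Proof.
move=> mF tF.
have [->|/set0P[t0 It0]] := eqVneq I set0.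
  by rewrite bigcup_set0 measure0 esum_set0.
pose u n : T := odflt t0 (choice.unpickle n).
have uK i : u (choice.pickle i) = i by rewrite /u choice.pickleK.
have -> : \bigcup_(i in I) F i = \bigcup_(n in choice.pickle @` I) F (u n).
  by rewrite bigcup_image; apply: eq_bigcupr => i _; rewrite uK.
rewrite measure_bigcup.
- rewrite nneseries_esum//.
  rewrite [X in esum X](_ : _ = choice.pickle @` I); last first.
    by apply/seteqP; split => n /=; rewrite inE.
  rewrite esum_image; last by move=> i j _ _; exact: (pcan_inj choice.pickleK).
  by apply: eq_esum => i _; rewrite uK.
- by move=> _ [i Ii <-]; rewrite uK; exact: mF.
- move=> _ _ [i Ii <-] [j Ij <-]; rewrite !uK => Fij.
  by congr (choice.pickle _); exact: tF.
Qed.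

Lemma countable_bigcup_measurable d (S : measurableType d) (T : countType)
    (I : set T) (F : T -> set S) :
  (forall i, I i -> measurable (F i)) -> measurable (\bigcup_(i in I) F i).
Proof.
move=> mF; rewrite bigcup_mkcond; apply: countable_bigcupT_measurable.
  exact: countableP.
by move=> i; case: ifPn => // /set_mem; exact: mF.
Qed.

(** Expanding the square, the second moment of the centred sum is at most the
total of the amounts [c k j] by which the mixed moments exceed those of
uncorrelated variables; the bound is then Chebyshev's inequality. Only
nonnegative functions are summed, so no summability has to be checked. *)
Lemma esum_chebyshev T (D : set T) (w : T -> R) (mass : R) (I : seq nat)
    (a : nat -> T -> R) (m : nat -> R) (c : nat -> nat -> R) (x : R) :
    (forall t, D t -> 0 <= w t) -> 0 <= mass ->
    (forall k t, D t -> 0 <= a k t) -> (forall k, 0 <= m k) -> 0 < x ->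
    \esum_(t in D) (w t)%:E = mass%:E ->
    (forall k, k \in I -> \esum_(t in D) (w t * a k t)%:E = (mass * m k)%:E) ->
    (forall k j, k \in I -> j \in I ->
       \esum_(t in D) (w t * (a k t * a j t))%:E
       <= (mass * (m k * m j + c k j))%:E)%E ->
  (\esum_(t in D `&` [set t | (x <= `|\sum_(k <- I) a k t - \sum_(k <- I) m k|)%R])
     (w t)%:E
   <= (mass * (\sum_(k <- I) \sum_(j <- I) c k j) / x ^+ 2)%:E)%E.
Proof.
move=> w0 mass0 a0 m0 x0 Ew Ewa Ewaa.
set A := fun t => \sum_(k <- I) a k t; set B := \sum_(k <- I) m k.
set V := \sum_(k <- I) _.
have A0 t : D t -> 0 <= A t by move=> Dt; apply: sumr_ge0 => k _; exact: a0.
have B0 : 0 <= B by exact: sumr_ge0.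
have EA : \esum_(t in D) (w t * A t)%:E = (mass * B)%:E.
  under eq_esum do rewrite mulr_sumr big_seq -sumEFin.
  rewrite esum_sum; last first.
    by move=> t k Dt _; rewrite lee_fin mulr_ge0 ?w0 ?a0.
  by under eq_bigr do rewrite Ewa//; rewrite sumEFin -big_seq -mulr_sumr.
have EAA : (\esum_(t in D) (w t * A t ^+ 2)%:E <= (mass * (B ^+ 2 + V))%:E)%E.
  have -> : \esum_(t in D) (w t * A t ^+ 2)%:E =
      (\sum_(k <- I | k \in I) \sum_(j <- I | j \in I)
         \esum_(t in D) (w t * (a k t * a j t))%:E)%E.
    transitivity (\esum_(t in D) \sum_(k <- I | k \in I) \sum_(j <- I | j \in I)
         (w t * (a k t * a j t))%:E)%E.
      apply: eq_esum => t Dt; rewrite -big_seq.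
      under [in RHS]eq_bigr do rewrite -big_seq sumEFin.
      rewrite sumEFin; congr EFin.
      rewrite expr2 /A mulr_suml mulr_sumr; apply: eq_bigr => k _.
      by rewrite !mulr_sumr.
    rewrite esum_sum; last first.
      move=> t k Dt _; apply: sume_ge0 => j _.
      by rewrite lee_fin !mulr_ge0 ?w0 ?a0.
    apply: eq_bigr => k _; rewrite esum_sum// => t j Dt _.
    by rewrite lee_fin !mulr_ge0 ?w0 ?a0.
  apply: (@le_trans _ _ (\sum_(k <- I | k \in I) \sum_(j <- I | j \in I)
     (mass * (m k * m j + c k j))%:E)%E).
    by apply: lee_sum => k kI; apply: lee_sum => j jI; exact: Ewaa.
  rewrite -big_seq; under eq_bigr do rewrite -big_seq sumEFin.
  rewrite sumEFin lee_fin le_eqVlt; apply/orP; left; apply/eqP.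
  under eq_bigr do rewrite -mulr_sumr big_split/=.
  rewrite -mulr_sumr big_split/=; congr (_ * (_ + _)).
  by rewrite expr2 /B mulr_suml; apply: eq_bigr => k _; rewrite mulr_sumr.
pose d t := (A t - B) ^+ 2.
have d0 t : 0 <= d t by rewrite sqr_ge0.
have x20 : 0 <= (x ^+ 2)^-1 by rewrite invr_ge0 sqr_ge0.
have Ed : (\esum_(t in D) (w t * d t)%:E <= (mass * V)%:E)%E.
  have split_sq : (\esum_(t in D) (w t * d t)%:E + (2 * B * (mass * B))%:E =
      \esum_(t in D) (w t * A t ^+ 2)%:E + (B ^+ 2 * mass)%:E)%E.
    rewrite (EFinM (2 * B)) -EA -esumZl; last 2 first.
      by rewrite mulr_ge0.
      by move=> t Dt; rewrite lee_fin mulr_ge0 ?w0 ?A0.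
    rewrite (EFinM (B ^+ 2)) -Ew -esumZl; last 2 first.
      by rewrite sqr_ge0.
      by move=> t Dt; rewrite lee_fin w0.
    rewrite -!esumD.
    - apply: eq_esum => t Dt; rewrite -!EFinM -!EFinD; congr EFin.
      by rewrite /d; ring.
    - by move=> t Dt; rewrite lee_fin mulr_ge0 ?w0 ?sqr_ge0.
    - by move=> t Dt; rewrite -EFinM lee_fin mulr_ge0 ?w0 ?sqr_ge0.
    - by move=> t Dt; rewrite lee_fin mulr_ge0 ?w0 ?sqr_ge0.
    - by move=> t Dt; rewrite -EFinM lee_fin !mulr_ge0 ?w0 ?A0.
  have : (\esum_(t in D) (w t * d t)%:E + (2 * B * (mass * B))%:E
     <= (mass * (B ^+ 2 + V) + B ^+ 2 * mass)%:E)%E.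
    by rewrite split_sq EFinD leeD2r.
  rewrite -leeBrDr// -EFinB => /le_trans; apply.
  by rewrite lee_fin le_eqVlt; apply/orP; left; apply/eqP; ring.
apply: (@le_trans _ _ (\esum_(t in D) (((x ^+ 2)^-1)%:E * (w t * d t)%:E))%E).
  rewrite esum_mkcondr; apply: le_esum => t Dt.
  case: ifPn => [/set_mem/= xt|_]; last first.
    by rewrite -EFinM lee_fin; apply: mulr_ge0 => //; exact: mulr_ge0 (w0 _ Dt) _.
  rewrite -EFinM lee_fin mulrCA ler_peMr ?w0// mulrC ler_pdivlMr ?exprn_gt0//.
  by rewrite mul1r /d -[leRHS]real_normK ?num_real// lerXn2r// ?nnegrE ?(ltW x0).
rewrite esumZl//; last by move=> t Dt; rewrite lee_fin mulr_ge0 ?w0 ?d0.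
by rewrite [in leRHS]mulrC EFinM lee_wpmul2l// lee_fin.
Qed.

Lemma near_pairs_sum (n rho : nat) (P : pred nat) (C : R) : 0 <= C ->
  \sum_(k <- iota 0 n | P k) \sum_(j <- iota 0 n | P j)
     (if (k <= j + rho)%N && (j <= k + rho)%N then C else 0)
  <= C * (rho.*2.+1)%:R * n%:R.
Proof.
move=> C0; rewrite big_mkcond.
apply: (@le_trans _ _ (\sum_(k <- iota 0 n) C * (rho.*2.+1)%:R)); last first.
  by rewrite big_const_seq count_predT size_iota iter_addr_0 !mulr_natr.
apply: ler_sum => k _; case: ifP => [_|_]; last by rewrite mulr_ge0.
rewrite -big_mkcondr.
apply: (@le_trans _ _ (\sum_(j <- iota 0 n | (k <= j + rho)%N && (j <= k + rho)%N) C)).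
  rewrite [leLHS]big_mkcond [leRHS]big_mkcond; apply: ler_sum => j _.
  by case: (P j) => //=; case: ifP.
rewrite big_const_seq iter_addr_0 mulr_natr ler_wpMn2l//.
rewrite -size_filter -(size_iota (k - rho) rho.*2.+1).
apply: uniq_leq_size; first by rewrite filter_uniq// iota_uniq.
move=> j; rewrite mem_filter !mem_iota; lia.
Qed.

End esum_extra.

(** * Words of independent letters *)

Section words.
Context {R : realType}.

Lemma esum_cat (T : choiceType) (n : nat) (A B C : set (seq T))
    (a : seq T -> \bar R) :
  (forall s, A s -> size s = n) ->
  (forall s1 s2, A s1 -> B s2 -> C (s1 ++ s2)) ->
  (forall s, C s -> A (take n s) /\ B (drop n s)) ->
  (forall s, C s -> 0 <= a s)%E ->
  (\esum_(s in C) a s = \esum_(s1 in A) \esum_(s2 in B) a (s1 ++ s2))%E.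
Proof.
move=> Asz ABC CAB a0; rewrite esum_esum; last first.
  by move=> s1 s2 A1 B2; apply: a0; exact: ABC.
rewrite (@reindex_esum _ _ _ (A `*`` fun=> B) C (fun k => k.1 ++ k.2))//.
split.
- by move=> [s1 s2] [/= A1 B2]; exact: ABC.
- move=> [s1 s2] [t1 t2]; rewrite !inE => -[/= As1 _] [/= At1 _].
  by move=> /eqP; rewrite eqseq_cat ?Asz// => /andP[/eqP-> /eqP->].
- move=> s /CAB[A1 B2]; exists (take n s, drop n s) => //=.
  by rewrite cat_take_drop.
Qed.

Lemma esum_seq1 (T : choiceType) (D : set T) (a : seq T -> \bar R) :
  (\esum_(s in [set [:: x] | x in D]) a s = \esum_(x in D) a [:: x])%E.
Proof. by rewrite esum_image// => x y _ _ []. Qed.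

Definition words (T : Type) (n : nat) : set (seq T) := [set y | size y = n].

Arguments words : clear implicits.

Definition word_weight (T : Type) (q : T -> R) (y : seq T) : R :=
  \prod_(v <- y) q v.

Section weight.
Variables (T : choiceType) (q : T -> R).
Hypothesis q_ge0 : forall v, 0 <= q v.
Hypothesis q_sum1 : \esum_(v in [set: T]) (q v)%:E = 1%E.
Local Notation wq := (word_weight q).

Lemma word_weight_ge0 y : 0 <= wq y.
Proof. by apply: prodr_ge0. Qed.

Lemma word_weight_cat y1 y2 : wq (y1 ++ y2) = wq y1 * wq y2.
Proof. by rewrite /word_weight big_cat. Qed.

Lemma word_weight1 v : wq [:: v] = q v.
Proof. by rewrite /word_weight big_seq1. Qed.

Lemma esum_words_cat n m (a : seq T -> \bar R) : (forall s, 0 <= a s)%E ->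
  (\esum_(y in words T (n + m)) a y =
   \esum_(y1 in words T n) \esum_(y2 in words T m) a (y1 ++ y2))%E.
Proof.
move=> a0; apply: (@esum_cat _ n) => //.
- by move=> s1 s2 /= s1n s2m; rewrite /words/= size_cat s1n s2m.
- move=> s /= sz; rewrite /words /= size_drop sz addKn size_takel//.
  by rewrite sz leq_addr.
Qed.

Lemma words_weight1 n : \esum_(y in words T n) (wq y)%:E = 1%E.
Proof.
elim: n => [|n IHn].
  rewrite [X in esum X](_ : _ = [set [::]]); last first.
    by apply/seteqP; split => [[]|_ ->].
  by rewrite esum_set1 /word_weight big_nil// lee_fin.
rewrite -addn1 esum_words_cat; last first.
  by move=> y; rewrite lee_fin word_weight_ge0.
rewrite -[RHS]IHn; apply: eq_esum => y _.
have -> : words T 1 = [set [:: x] | x in [set: T]].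
  apply/seteqP; split => [[|v []]//= _|_ [v _ <-]//]; by exists v.
rewrite esum_seq1.
under eq_esum do rewrite word_weight_cat word_weight1 EFinM.
by rewrite esumZl ?word_weight_ge0// ?q_sum1 ?mule1// => v _; rewrite lee_fin.
Qed.

(** The weight of a concatenation is the product of the weights, so functions of
complementary blocks are uncorrelated. *)
Lemma esum_words_block n m (F1 F2 : seq T -> R) (a1 a2 : R) :
  (forall y, 0 <= F1 y) -> (forall y, 0 <= F2 y) ->
  \esum_(y in words T n) (wq y * F1 y)%:E = a1%:E ->
  \esum_(y in words T m) (wq y * F2 y)%:E = a2%:E ->
  \esum_(y in words T (n + m)) (wq y * (F1 (take n y) * F2 (drop n y)))%:E
  = (a1 * a2)%:E.
Proof.
move=> F10 F20 E1 E2.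
rewrite esum_words_cat; last first.
  by move=> y; rewrite lee_fin !mulr_ge0// word_weight_ge0.
have a20 : 0 <= a2.
  by rewrite -lee_fin -E2 esum_ge0// => y _; rewrite lee_fin mulr_ge0 ?word_weight_ge0.
rewrite (EFinM a1) -E1 -esumZr//; last first.
  by move=> y _; rewrite lee_fin mulr_ge0// word_weight_ge0.
apply: eq_esum => y1 /= y1n.
rewrite -E2 -esumZl ?mulr_ge0 ?word_weight_ge0//; last first.
  by move=> y _; rewrite lee_fin mulr_ge0// word_weight_ge0.
apply: eq_esum => y2 _; rewrite -EFinM word_weight_cat; congr EFin.
by rewrite take_size_cat// drop_size_cat//; ring.
Qed.

Lemma esum_words_slice n m p (F : seq T -> R) (a : R) :
  (forall y, 0 <= F y) ->
  \esum_(y in words T m) (wq y * F y)%:E = a%:E ->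
  \esum_(y in words T (n + (m + p))) (wq y * F (take m (drop n y)))%:E = a%:E.
Proof.
move=> F0 EF.
have one k : \esum_(y in words T k) (wq y * 1)%:E = 1%:E.
  by under eq_esum do rewrite mulr1; rewrite words_weight1.
have tail : \esum_(y in words T (m + p)) (wq y * F (take m y))%:E = a%:E.
  have := esum_words_block F0 (fun=> ler01) EF (one p).
  by under eq_esum do rewrite mulr1; rewrite mulr1.
have := esum_words_block (fun=> ler01) (fun y => F0 (take m y)) (one n) tail.
by under eq_esum do rewrite mul1r; rewrite mul1r.
Qed.

Definition window (L k : nat) (y : seq T) : seq T :=
  take (L.*2.+1) (drop (k - L) y).

(** Weak law of large numbers: windows of radius [L] whose centres are more than
[2 * L] apart do not overlap, so the variance of the sum is linear in [n]. *)
Lemma words_lln (L : nat) (g : seq T -> R) (b : R) :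
  (forall y, 0 <= g y <= b) ->
  exists2 gbar : R, 0 <= gbar <= b & forall n x, 0 < x ->
  (\esum_(y in words T n `&` [set y | (x <=
      `|\sum_(k <- iota 0 n | (L <= k < n - L)%N) g (window L k y)
        - \sum_(k <- iota 0 n | (L <= k < n - L)%N) gbar|)%R]) (wq y)%:E
   <= (b ^+ 2 * (L.*2.*2.+1)%:R * n%:R / x ^+ 2)%:E)%E.
Proof.
move=> gb; have g0 y : 0 <= g y by case/andP: (gb y).
have gle y : g y <= b by case/andP: (gb y).
have b0 : 0 <= b by exact: le_trans (g0 [::]) (gle _).
pose e := \esum_(y in words T L.*2.+1) (wq y * g y)%:E.
have e0 : (0 <= e)%E.
  by apply: esum_ge0 => y _; rewrite lee_fin mulr_ge0 ?word_weight_ge0.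
have eb : (e <= b%:E)%E.
  rewrite -[leRHS]mule1 -(words_weight1 L.*2.+1) -esumZl//; last first.
    by move=> y _; rewrite lee_fin word_weight_ge0.
  apply: le_esum => y _; rewrite -EFinM lee_fin mulrC.
  by rewrite ler_wpM2r ?word_weight_ge0.
have efin : e \is a fin_num by rewrite ge0_fin_numE// (le_lt_trans eb) ?ltry.
have Ee : e = (fine e)%:E by rewrite fineK.
exists (fine e); first by rewrite -!lee_fin -Ee e0 eb.
move=> n x x0.
pose I := [seq k <- iota 0 n | (L <= k < n - L)%N].
have winE k y : size y = n -> k \in I ->
    window L k y = take L.*2.+1 (drop (k - L) y) by [].
have mean k : k \in I ->
    \esum_(y in words T n) (wq y * g (window L k y))%:E = (fine e)%:E.
  rewrite mem_filter mem_iota => /andP[/andP[Lk kn] _].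
  have -> : n = (k - L + (L.*2.+1 + (n - L - k.+1)))%N by nat_lia.
  exact: esum_words_slice.
have corr k j : k \in I -> j \in I -> (k + L.*2 < j)%N ->
    \esum_(y in words T n) (wq y * (g (window L k y) * g (window L j y)))%:E
    = (fine e * fine e)%:E.
  rewrite !mem_filter !mem_iota => /andP[/andP[Lk kn] _] /andP[/andP[Lj jn] _] kj.
  have -> : n = (j - L + (n - (j - L)))%N by nat_lia.
  rewrite -(@esum_words_block (j - L) (n - (j - L)) (fun y => g (window L k y))
    (fun y => g (take L.*2.+1 y)) (fine e) (fine e))//; last 2 first.
  - have -> : (j - L = k - L + (L.*2.+1 + (j - L - (k + L.+1))))%N by nat_lia.
    exact: esum_words_slice.
  - have -> : (n - (j - L) = 0 + (L.*2.+1 + (n - L - j.+1)))%N by nat_lia.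
    rewrite -(@esum_words_slice 0 L.*2.+1 (n - L - j.+1) g (fine e))//.
    by apply: eq_esum => y _; rewrite drop0.
  apply: eq_esum => y /= sy; congr (_ * (g _ * _))%:E.
  rewrite /window take_drop [in RHS]take_drop take_takel//; nat_lia.
have fe0 : 0 <= fine e by rewrite fine_ge0.
rewrite [X in esum (_ `&` X)](_ : _ = [set y | (x <=
    `|\sum_(k <- I) g (window L k y) - \sum_(k <- I) fine e|)%R]); last first.
  by apply/seteqP; split => y /=; rewrite /I !big_filter.
apply: le_trans (@esum_chebyshev R _ (words T n) wq 1 I
  (fun k y => g (window L k y)) (fun=> fine e)
  (fun k j => if (k <= j + L.*2)%N && (j <= k + L.*2)%N then b ^+ 2 else 0) x
  _ _ _ _ _ _ _ _) _ => //.
- by move=> y _; exact: word_weight_ge0.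
- exact: words_weight1.
- by move=> k kI; rewrite mean// mul1r.
- move=> k j kI jI; rewrite mul1r.
  have comm : \esum_(y in words T n) (wq y * (g (window L k y) * g (window L j y)))%:E
      = \esum_(y in words T n) (wq y * (g (window L j y) * g (window L k y)))%:E.
    by apply: eq_esum => y _; rewrite [X in _ * X]mulrC.
  case: ifPn => [_|]; last first.
    rewrite negb_and -!ltnNge addr0 => /orP[jk|kj]; last by rewrite corr.
    by rewrite comm corr.
  apply: (@le_trans _ _ (b ^+ 2)%:E); last by rewrite lee_fin lerDr mulr_ge0.
  rewrite -[leRHS]mule1 -(words_weight1 n) -esumZl ?sqr_ge0//; last first.
    by move=> y _; rewrite lee_fin word_weight_ge0.
  apply: le_esum => y _; rewrite -EFinM lee_fin mulrC.
  by rewrite ler_wpM2r ?word_weight_ge0// expr2 ler_pM.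
- rewrite lee_fin mul1r ler_wpM2r ?invr_ge0 ?sqr_ge0//.
  rewrite big_filter; under eq_bigr do rewrite big_filter.
  by rewrite near_pairs_sum// sqr_ge0.
Qed.

End weight.
End words.
Arguments words : clear implicits.

(** * Cut times and excursions *)

Section cuts.
Variable G : zmodType.
Implicit Types y : seq G.

Definition pos y (i : nat) : G := \sum_(v <- take i y) v.

(** The final position counts among those after the cut, so that a cut time of a
word is one of each of its factors containing it. *)
Definition cut y (c : nat) : Prop :=
  forall i j, (i < c)%N -> (c <= j <= size y)%N -> pos y i <> pos y j.

Lemma pos_take y m i : (i <= m)%N -> pos (take m y) i = pos y i.
Proof. by move=> im; rewrite /pos take_takel. Qed.

Lemma pos_drop y m i : pos (drop m y) i = pos y (m + i) - pos y m.
Proof.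
by rewrite /pos takeD big_cat/= addrC addrK.
Qed.

Lemma cut_take y m c : cut y c -> cut (take m y) c.
Proof.
move=> yc i j ic /andP[cj]; rewrite size_take_min leq_min => /andP[jm jy].
by rewrite !pos_take; [apply: yc => //; rewrite cj | lia..].
Qed.

Lemma cut_drop y m c : (m <= c)%N -> cut y c -> cut (drop m y) (c - m).
Proof.
move=> mc yc i j ic; rewrite size_drop => /andP[cj jy].
rewrite !pos_drop => /addIr; apply: yc; lia.
Qed.

End cuts.

Section excursions.
Context {R : realType} {V : choiceType} {G : zmodType}.
Variable p : V -> G.

(** An excursion [(h, u)] consists of steps [h] that keep the projection of the
walk fixed, followed by one step [u] that moves it. *)
Definition excursion := (seq V * V)%type.
Implicit Types (e : excursion) (g : seq excursion).

Definition excursion_steps e : seq V := rcons e.1 e.2.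
Definition excursion_length e : nat := (size e.1).+1.
Definition is_hold (h : seq V) : bool := all (fun u => p u == 0) h.
Definition is_excursion e : bool := is_hold e.1 && (p e.2 != 0).
Definition steps g : seq V := flatten (map excursion_steps g).
Definition jumps g : seq G := map (fun e => p e.2) g.

Definition excursions_over (y : seq G) : set (seq excursion) :=
  [set g | all is_excursion g /\ jumps g = y].

(** All that is used of the walk: [W s] is the probability that its first steps
are [s], and [Wh s] that they are [s] followed by a holding step. A jump has
direction of law [q] whatever the past, a holding step has conditional
probability at most [rho], and since the two sides of a cut time involve disjoint
sets of sites they are independent. *)
Record excursion_weights (W Wh : seq V -> R) (q : G -> R) (rho : R) : Prop :=
  ExcursionWeights {
    weight_ge0 : forall s, 0 <= W s;
    weight_nil : W [::] = 1;
    hold_rate_bounds : 0 <= rho < 1;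
    hold_sum : forall s,
      \esum_(u in [set u | p u = 0]) (W (rcons s u))%:E = (Wh s)%:E;
    hold_le : forall s, Wh s <= rho * W s;
    jump_sum : forall s v, v != 0 ->
      \esum_(u in [set u | p u = v]) (W (rcons s u))%:E
      = (q v * (W s - Wh s))%:E;
    jump_ge0 : forall v, 0 <= q v;
    jump0 : q 0 = 0;
    jump_sum1 : \esum_(v in [set: G]) (q v)%:E = 1%E;
    cut_weight : forall g1 g2, all is_excursion g1 -> all is_excursion g2 ->
      cut (jumps (g1 ++ g2)) (size g1) ->
      W (steps (g1 ++ g2)) = W (steps g1) * W (steps g2) }.

Lemma size_excursions_over y g : excursions_over y g -> size g = size y.
Proof. by move=> [_ <-]; rewrite size_map. Qed.

Lemma steps_cat g1 g2 : steps (g1 ++ g2) = steps g1 ++ steps g2.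
Proof. by rewrite /steps map_cat flatten_cat. Qed.

Lemma steps_rcons g e : steps (rcons g e) = steps g ++ excursion_steps e.
Proof. by rewrite -cats1 steps_cat /steps/= cats0. Qed.

Lemma esum_excursions_cat y1 y2 (a : seq excursion -> \bar R) :
  (forall g, 0 <= a g)%E ->
  (\esum_(g in excursions_over (y1 ++ y2)) a g =
   \esum_(g1 in excursions_over y1) \esum_(g2 in excursions_over y2)
     a (g1 ++ g2))%E.
Proof.
move=> a0; apply: (@esum_cat _ _ (size y1)) => //.
- by move=> g; exact: size_excursions_over.
- move=> g1 g2 [v1 <-] [v2 <-]; split; last by rewrite /jumps map_cat.
  by rewrite all_cat v1.
- move=> g [vg jg].
  have := vg; rewrite -{1}(cat_take_drop (size y1) g) all_cat => /andP[v1 v2].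
  split; split=> //; rewrite /jumps ?map_take ?map_drop -/(jumps g) jg.
    by rewrite take_size_cat.
  by rewrite drop_size_cat.
Qed.

Definition excursions_of (v : G) : set excursion :=
  [set e | is_excursion e /\ p e.2 = v].

Lemma esum_excursions_rcons y v (a : seq excursion -> \bar R) :
  (forall g, 0 <= a g)%E ->
  (\esum_(g in excursions_over (rcons y v)) a g =
   \esum_(g in excursions_over y) \esum_(e in excursions_of v) a (rcons g e))%E.
Proof.
move=> a0; rewrite -cats1 esum_excursions_cat//; apply: eq_esum => g _.
have -> : excursions_over [:: v] = [set [:: e] | e in excursions_of v].
  apply/seteqP; split => [[|e [|e' g']] [ve //= [ev]]|_ [e [ve ev] <-]].
    by exists e => //; split=> //; move: ve; rewrite /= andbT.
  by split; rewrite /= ?andbT// ev.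
by rewrite esum_seq1; apply: eq_esum => e _; rewrite cats1.
Qed.

Lemma excursions_over0 : excursions_over [::] = [set [::]].
Proof.
apply/seteqP; split => [|_ ->//].
by case=> [//|e g []].
Qed.

Section weights.
Variables (W Wh : seq V -> R) (q : G -> R) (rho : R).
Hypothesis HW : excursion_weights W Wh q rho.
Local Notation wq := (word_weight q).

Let W0 := weight_ge0 HW.
Let q0 := jump_ge0 HW.
Let rho0 : 0 <= rho. Proof. by case/andP: (hold_rate_bounds HW). Qed.
Let rho1 : rho < 1. Proof. by case/andP: (hold_rate_bounds HW). Qed.
Let wq0 y : 0 <= wq y. Proof. exact: word_weight_ge0. Qed.

Lemma hold_ge0 s : 0 <= Wh s.
Proof. by rewrite -lee_fin -(hold_sum HW) esum_ge0// => u _; rewrite lee_fin. Qed.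

Definition hold_weight (s : seq V) (n : nat) : \bar R :=
  \esum_(h in [set h | is_hold h /\ size h = n]) (W (s ++ h))%:E.

Lemma hold_weight0 s : hold_weight s 0 = (W s)%:E.
Proof.
rewrite /hold_weight [X in esum X](_ : _ = [set [::]]); last first.
  by apply/seteqP; split => [h [_ /size0nil]|_ ->].
by rewrite esum_set1 ?cats0// lee_fin.
Qed.

Lemma hold_weightS s n : hold_weight s n.+1 =
  \esum_(h in [set h | is_hold h /\ size h = n]) (Wh (s ++ h))%:E.
Proof.
rewrite /hold_weight (@esum_cat _ _ n [set h | is_hold h /\ size h = n]
  [set [:: u] | u in [set u | p u = 0]])//.
- apply: eq_esum => h _; rewrite esum_seq1 -(hold_sum HW).
  by apply: eq_esum => u _; rewrite catA cats1.
- by move=> h [].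
- move=> h _ [hh hn] [u /= pu <-]; split; last by rewrite size_cat hn addn1.
  by rewrite /is_hold all_cat -/(is_hold h) hh/= pu eqxx.
- move=> h [hh hn].
  have := hh; rewrite /is_hold -{1}(cat_take_drop n h) all_cat => /andP[h1 h2].
  split; first by split=> //; rewrite size_takel// hn.
  have : size (drop n h) = 1%N by rewrite size_drop hn subSnn.
  by case: (drop n h) h2 => [//|u [|//]] /=; rewrite andbT => /eqP pu _; exists u.
- by move=> h _; rewrite lee_fin.
Qed.

Lemma hold_weight_le s n : (hold_weight s n <= (rho ^+ n * W s)%:E)%E.
Proof.
elim: n => [|n IHn]; first by rewrite hold_weight0 expr0 mul1r.
rewrite hold_weightS exprS -mulrA EFinM.
apply: (@le_trans _ _ (rho%:E * hold_weight s n)%E); last first.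
  by rewrite lee_wpmul2l// lee_fin.
rewrite /hold_weight -esumZl//; last by move=> h _; rewrite lee_fin.
by apply: le_esum => h _; rewrite -EFinM lee_fin (hold_le HW).
Qed.

Lemma hold_weight_ge0 s n : (0 <= hold_weight s n)%E.
Proof. by apply: esum_ge0 => h _; rewrite lee_fin. Qed.

Lemma hold_weight_fin s n : hold_weight s n \is a fin_num.
Proof.
by rewrite ge0_fin_numE ?hold_weight_ge0// (le_lt_trans (hold_weight_le _ _))// ltry.
Qed.

(** An excursion with [n] holding steps takes a jump just when the mass with [n]
holding steps does not survive to [n + 1] of them. *)
Lemma excursion_weight_series s v (b : nat -> R) : (forall n, 0 <= b n) ->
  (\esum_(e in excursions_of v) (b (size e.1) * W (s ++ excursion_steps e))%:E
  = \sum_(n <oo) (q v * (b n * (fine (hold_weight s n)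
                             - fine (hold_weight s n.+1))))%:E)%E.
Proof.
move=> b0.
have [->|v0] := eqVneq v 0.
  rewrite (jump0 HW) eseries0; last by move=> n _ _; rewrite mul0r.
  by rewrite esum1// => e [/andP[_ /eqP]].
have hdiff s' : 0 <= W s' - Wh s'.
  by rewrite subr_ge0 (le_trans (hold_le HW s'))// ler_piMl// ltW.
have step n : \esum_(h in [set h | is_hold h /\ size h = n])
    (W (s ++ h) - Wh (s ++ h))%:E
    = (fine (hold_weight s n) - fine (hold_weight s n.+1))%:E.
  rewrite EFinB !fineK ?hold_weight_fin//.
  apply/eqP; rewrite eq_sym sube_eq ?hold_weight_fin//; last first.
    by rewrite fin_num_adde_defl// hold_weight_fin.
  apply/eqP; rewrite hold_weightS -esumD; last 2 first.
    by move=> h _; rewrite lee_fin.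
    by move=> h _; rewrite lee_fin hold_ge0.
  by apply: eq_esum => h _; rewrite -EFinD subrK.
rewrite nneseries_esumT; last first.
  move=> n; rewrite lee_fin !mulr_ge0// -lee_fin -step esum_ge0// => h _.
  by rewrite lee_fin.
transitivity (\esum_(n in [set: nat])
    \esum_(h in [set h | is_hold h /\ size h = n])
      (q v * (b n * (W (s ++ h) - Wh (s ++ h))))%:E)%E; last first.
  apply: eq_esum => n _; rewrite mulrA EFinM -step -esumZl ?mulr_ge0//.
    by apply: eq_esum => h _; rewrite -EFinM mulrA.
  by move=> h _; rewrite lee_fin.
rewrite esum_esum; last by move=> n h _ _; rewrite lee_fin !mulr_ge0.
transitivity (\esum_(h in is_hold) \esum_(u in [set u | p u = v])
    (b (size h) * W (rcons (s ++ h) u))%:E)%E.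
  rewrite esum_esum; last by move=> h u _ _; rewrite lee_fin mulr_ge0.
  rewrite [X in esum X](_ : _ = is_hold `*`` (fun=> [set u | p u = v])); last first.
    apply/seteqP; split=> [[h u] [/andP[/= hh _] pu]//|[h u] [/= hh pu]].
    by split=> //; rewrite /is_excursion/= hh pu.
  by apply: eq_esum => -[h u] _; rewrite /excursion_steps/= rcons_cat.
rewrite (@reindex_esum _ _ _ is_hold _ (fun h => (size h, h))); last first.
  split; [by []|by move=> h h' _ _ []|].
  by move=> [n h] [/= _ [hh <-]]; exists h.
apply: eq_esum => h _ /=.
rewrite mulrCA EFinM -(jump_sum HW)// -esumZl// => u _.
by rewrite lee_fin.
Qed.

(** Since holding has conditional probability at most [rho < 1], a jump occurs
almost surely, and its direction has law [q] whatever the past. *)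
Lemma excursion_mass s v :
  \esum_(e in excursions_of v) (W (s ++ excursion_steps e))%:E
  = (q v * W s)%:E.
Proof.
have -> : \esum_(e in excursions_of v) (W (s ++ excursion_steps e))%:E =
    \esum_(e in excursions_of v) (1 * W (s ++ excursion_steps e))%:E.
  by apply: eq_esum => e _; rewrite mul1r.
rewrite (excursion_weight_series _ _ (fun=> ler01)).
pose H n := fine (hold_weight s n).
apply/cvg_lim => //; apply: cvg_EFin; first by apply: nearW => n; rewrite sumEFin.
have -> : fine \o (fun n => \sum_(0 <= i < n) (q v * (1 * (H i - H i.+1)))%:E)%E
    = (fun n => q v * (W s - H n)).
  apply/funext => n /=; rewrite sumEFin/= -mulr_sumr; congr (_ * _).
  under eq_bigr do rewrite mul1r -opprB.
  by rewrite sumrN telescope_sumr// opprB /H hold_weight0.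
suff : (fun n => q v * (W s - H n)) @ \oo --> q v * (W s - 0) by rewrite subr0.
apply: cvgMr; apply: cvgB; first exact: cvg_cst.
apply: (@squeeze_cvgr _ _ _ _ (fun=> 0) (fun n => rho ^+ n * W s)).
- apply: nearW => n; rewrite fine_ge0 ?hold_weight_ge0//=.
  by rewrite -lee_fin fineK ?hold_weight_fin// hold_weight_le.
- exact: cvg_cst.
- suff : (fun n => rho ^+ n * W s) @ \oo --> 0 * W s by rewrite mul0r.
  apply: cvgMl.
  by apply: cvg_expr; rewrite ger0_norm.
Qed.

End weights.
End excursions.

(** * Lengths of excursions *)

Lemma bernoulli_ineq {R : realFieldType} (h : R) (n : nat) : 0 <= h ->
  1 + n%:R * h <= (1 + h) ^+ n.
Proof.
move=> h0; elim: n => [|n IHn]; first by rewrite expr0 mul0r addr0.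
rewrite exprS; apply: (@le_trans _ _ ((1 + h) * (1 + n%:R * h))); last first.
  by rewrite ler_wpM2l// addr_ge0.
have : 0 <= n%:R * h * h by rewrite !mulr_ge0.
rewrite -natr1; lra.
Qed.

Lemma geometric_sum_le {R : realFieldType} (x : R) (n : nat) : 0 <= x < 1 ->
  \sum_(0 <= i < n) x ^+ i <= (1 - x)^-1.
Proof.
case/andP=> x0 x1; rewrite -[leRHS]mul1r ler_pdivlMr ?subr_gt0//.
rewrite -[X in _ * X]opprB mulrN mulrC big_mkord -subrX1 opprB.
by rewrite gerBl exprn_ge0.
Qed.

Section excursion_estimates.
Context {R : realType} {V : choiceType} {G : zmodType}.
Variables (p : V -> G) (W Wh : seq V -> R) (q : G -> R) (rho : R).
Hypothesis HW : excursion_weights p W Wh q rho.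
Local Notation wq := (word_weight q).
Local Notation over := (excursions_over p).
Local Notation len := excursion_length.
Variable e0 : excursion (V := V).

Let W0 := weight_ge0 HW.
Let q0 := jump_ge0 HW.
Let rho0 : 0 <= rho. Proof. by case/andP: (hold_rate_bounds HW). Qed.
Let rho1 : rho < 1. Proof. by case/andP: (hold_rate_bounds HW). Qed.
Let wq0 y : 0 <= wq y. Proof. exact: word_weight_ge0. Qed.

Lemma excursions_mass y : \esum_(g in over y) (W (steps g))%:E = (wq y)%:E.
Proof.
elim/last_ind: y => [|y v IHy].
  rewrite excursions_over0 esum_set1 ?lee_fin//.
  by rewrite /steps/= (weight_nil HW) /word_weight big_nil.
rewrite esum_excursions_rcons; last by move=> g; rewrite lee_fin.
under eq_esum do (under eq_esum do rewrite steps_rcons).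
under eq_esum do rewrite (excursion_mass HW) EFinM.
rewrite esumZl// ?IHy; last by move=> g _; rewrite lee_fin.
by rewrite -cats1 word_weight_cat word_weight1 mulrC.
Qed.

(** The rate [(1 + h) ^ 2] is small enough for the excursion lengths to have a
finite exponential moment, whatever the past; being a square, it dominates
second moments through Bernoulli's inequality. *)
Variable h : R.
Hypothesis h0 : 0 < h.
Let r := (1 + h) ^+ 2.
Hypothesis r_rho : r * rho < 1.
Definition exp_bound : R := r / (1 - r * rho).
Local Notation M := exp_bound.

Let r1 : 1 <= r.
Proof. by rewrite exprn_ege1// lerDl; exact: ltW. Qed.

Let r0 : 0 <= r. Proof. exact: le_trans r1. Qed.

Let rn n : 0 <= r ^+ n. Proof. exact: exprn_ge0. Qed.

Lemma exp_bound_ge1 : 1 <= M.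
Proof.
rewrite ler_pdivlMr ?subr_gt0// mul1r (le_trans _ r1)// gerBl.
by rewrite mulr_ge0.
Qed.

Let M0 : 0 <= M. Proof. exact: le_trans exp_bound_ge1. Qed.

(** [n] holding steps in a row have conditional probability at most [rho ^ n], so
the exponential moment is bounded by a geometric series. *)
Lemma excursion_exp_moment s v :
  (\esum_(e in excursions_of p v)
     (r ^+ len e * W (s ++ excursion_steps e))%:E
   <= (M * (q v * W s))%:E)%E.
Proof.
rewrite (excursion_weight_series HW s v (b := fun n => r ^+ n.+1)); last first.
  by move=> n; rewrite rn.
have dle n : 0 <= fine (hold_weight p W s n) - fine (hold_weight p W s n.+1)
    <= rho ^+ n * W s.
  rewrite subr_ge0 -lee_fin !fineK ?(hold_weight_fin HW)//.
  apply/andP; split.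
    rewrite (hold_weightS HW); apply: le_esum => k _; rewrite lee_fin.
    by rewrite (le_trans (hold_le HW _))// ler_piMl// ltW.
  rewrite lerBlDr -lee_fin EFinD !fineK ?(hold_weight_fin HW)//.
  by rewrite (le_trans (hold_weight_le HW s n))// leeDl// (hold_weight_ge0 HW).
apply: lime_le.
  apply: is_cvg_nneseries => n _ _; rewrite lee_fin mulr_ge0//.
  by rewrite mulr_ge0 ?rn//; case/andP: (dle n).
apply: nearW => n; rewrite sumEFin lee_fin.
apply: (@le_trans _ _ (\sum_(0 <= i < n) q v * W s * r * (r * rho) ^+ i)).
  apply: ler_sum => i _.
  have -> : q v * W s * r * (r * rho) ^+ i = q v * (r ^+ i.+1 * (rho ^+ i * W s)).
    by rewrite exprMn exprS; ring.
  rewrite ler_wpM2l// ler_wpM2l ?rn//.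
  by case/andP: (dle i).
rewrite -mulr_sumr.
have -> : M * (q v * W s) = q v * W s * r * (1 - r * rho)^-1 by rewrite /M; ring.
apply: ler_wpM2l; first exact: mulr_ge0 (mulr_ge0 (q0 v) (W0 s)) r0.
by apply: geometric_sum_le; rewrite r_rho (mulr_ge0 r0).
Qed.

(** Induction on the last excursion: whatever the past, it contributes a factor
[exp_bound] if its index lies in [B], and none otherwise. *)
Lemma excursions_exp_moment (B : pred nat) y :
  (\esum_(g in over y)
     (W (steps g) * r ^+ (\sum_(k <- iota 0 (size y) | B k) len (nth e0 g k)))%:E
   <= (wq y * M ^+ count B (iota 0 (size y)))%:E)%E.
Proof.
elim/last_ind: y => [|y v IHy].
  rewrite excursions_over0 esum_set1 ?lee_fin ?mulr_ge0 ?rn//.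
  rewrite big_nil !expr0 !mulr1 /steps/= (weight_nil HW).
  by rewrite /word_weight big_nil.
rewrite esum_excursions_rcons; last by move=> g; rewrite lee_fin mulr_ge0 ?rn.
rewrite size_rcons -addn1 iotaD add0n count_cat/= addn0.
set n := size y in IHy *.
pose T g := \sum_(k <- iota 0 n | B k) len (nth e0 g k).
pose b : R := if B n then M else 1.
apply: (@le_trans _ _ (\esum_(g in over y)
    ((b * q v)%:E * (W (steps g) * r ^+ T g)%:E))%E).
  apply: le_esum => g gy.
  have gn : size g = n by exact: size_excursions_over gy.
  have -> : \esum_(e in excursions_of p v) (W (steps (rcons g e)) *
      r ^+ (\sum_(k <- iota 0 n ++ [:: n] | B k) len (nth e0 (rcons g e) k)))%:E
    = ((r ^+ T g)%:E * \esum_(e in excursions_of p v)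
        ((if B n then r ^+ len e else 1) * W (steps g ++ excursion_steps e))%:E)%E.
    rewrite -esumZl ?rn//; last first.
      by move=> e _; rewrite lee_fin mulr_ge0//; case: ifP; rewrite ?rn.
    apply: eq_esum => e _; rewrite -EFinM; congr EFin.
    rewrite big_cat/= exprD big_cons big_nil nth_rcons gn ltnn eqxx steps_rcons.
    have -> : (\sum_(k <- iota 0 n | B k) len (nth e0 (rcons g e) k) = T g)%N.
      rewrite big_seq_cond [RHS]big_seq_cond; apply: eq_bigr => k.
      by rewrite mem_iota/= => /andP[kn _]; rewrite nth_rcons gn kn.
    by case: ifP => _; rewrite ?addn0 ?expr0; ring.
  have -> : ((b * q v)%:E * (W (steps g) * r ^+ T g)%:E
    = (r ^+ T g)%:E * (b * (q v * W (steps g)))%:E)%E.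
    by rewrite -!EFinM; congr EFin; ring.
  rewrite lee_wpmul2l ?lee_fin ?rn// /b.
  case: ifP => _; first exact: excursion_exp_moment.
  rewrite mul1r -(excursion_mass HW); apply: le_esum => e _.
  by rewrite mul1r.
rewrite esumZl; last 2 first.
  by rewrite mulr_ge0// /b; case: ifP.
  by move=> g _; rewrite lee_fin mulr_ge0 ?rn.
apply: le_trans (lee_wpmul2l _ IHy) _; first by rewrite lee_fin mulr_ge0// /b; case: ifP.
rewrite -EFinM lee_fin -cats1 word_weight_cat word_weight1 exprD /b.
rewrite le_eqVlt; apply/orP; left; apply/eqP.
by case: (B n); rewrite ?expr1 ?expr0; ring.
Qed.

End excursion_estimates.

(** * Independence across cut times *)

Section excursion_lln.
Context {R : realType} {V : choiceType} {G : zmodType}.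
Variables (p : V -> G) (W Wh : seq V -> R) (q : G -> R) (rho : R).
Hypothesis HW : excursion_weights p W Wh q rho.
Local Notation wq := (word_weight q).
Local Notation over := (excursions_over p).
Local Notation len := excursion_length.
Variable e0 : excursion (V := V).
Variable h : R.
Hypothesis h0 : 0 < h.
Hypothesis r_rho : (1 + h) ^+ 2 * rho < 1.
Local Notation M := (exp_bound rho h).
Let r := (1 + h) ^+ 2.

Let W0 := weight_ge0 HW.
Let q0 := jump_ge0 HW.
Let wq0 y : 0 <= wq y. Proof. exact: word_weight_ge0. Qed.
Let M1 : 1 <= M. Proof. exact: exp_bound_ge1 HW _ h0 r_rho. Qed.
Let M0 : 0 <= M. Proof. exact: le_trans M1. Qed.

Implicit Types (e : excursion (V := V)) (g : seq (excursion (V := V))) (y : seq G).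

(** Between the two sides of a cut time of the jumps, the walk visits disjoint
sets of sites: given the jumps, the two parts of the path are independent. *)
Lemma excursions_cut y c (F1 F2 : seq (excursion (V := V)) -> R) (a1 a2 : R) :
  (forall g, 0 <= F1 g) -> (forall g, 0 <= F2 g) -> (c <= size y)%N -> cut y c ->
  \esum_(g in over (take c y)) (W (steps g) * F1 g)%:E = a1%:E ->
  \esum_(g in over (drop c y)) (W (steps g) * F2 g)%:E = a2%:E ->
  \esum_(g in over y) (W (steps g) * (F1 (take c g) * F2 (drop c g)))%:E
  = (a1 * a2)%:E.
Proof.
move=> F10 F20 cy yc E1 E2.
rewrite -{1}(cat_take_drop c y) esum_excursions_cat; last first.
  by move=> g; rewrite lee_fin !mulr_ge0.
have a20 : 0 <= a2.
  by rewrite -lee_fin -E2 esum_ge0// => g _; rewrite lee_fin mulr_ge0.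
rewrite (EFinM a1) -E1 -esumZr//; last by move=> g _; rewrite lee_fin mulr_ge0.
apply: eq_esum => g1 g1y.
have g1c : size g1 = c by rewrite (size_excursions_over g1y) size_takel.
rewrite -E2 -esumZl ?mulr_ge0//; last by move=> g _; rewrite lee_fin mulr_ge0.
apply: eq_esum => g2 g2y; rewrite -EFinM; congr EFin.
rewrite take_size_cat// drop_size_cat// (cut_weight HW).
- by ring.
- by case: g1y.
- by case: g2y.
- rewrite /jumps map_cat -/(jumps p g1) -/(jumps p g2).
  by case: g1y => _ ->; case: g2y => _ ->; rewrite cat_take_drop g1c.
Qed.

Variables (f : excursion (V := V) -> R) (D : R).
Hypothesis f_ge0 : forall e, 0 <= f e.
Hypothesis f_le : forall e, f e <= D * (len e)%:R.

Let D0 : 0 <= D.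
Proof. by have := le_trans (f_ge0 e0) (f_le e0); rewrite pmulr_lge0 ?ltr0n. Qed.

Let D' := D / h.
Let D'0 : 0 <= D'. Proof. by rewrite divr_ge0// ltW. Qed.

Let len_exp e : (len e)%:R * h <= (1 + h) ^+ len e.
Proof.
by apply: le_trans (bernoulli_ineq (len e) (ltW h0)); rewrite lerDr.
Qed.

Let h1 : 1 <= 1 + h. Proof. by rewrite lerDl; exact: ltW. Qed.

Let r_ge0 n : 0 <= r ^+ n.
Proof. by rewrite exprn_ge0// exprn_ge0// (le_trans _ h1). Qed.

Let f2_le e : f e ^+ 2 <= D' ^+ 2 * r ^+ len e.
Proof.
rewrite /r -exprM mulnC exprM -exprMn lerXn2r ?nnegrE//.
  by rewrite mulr_ge0// exprn_ge0// (le_trans _ h1).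
apply: le_trans (f_le e) _; rewrite /D' -mulrA ler_wpM2l//.
by rewrite ler_pdivlMl// mulrC len_exp.
Qed.

Let f1_le e : f e <= D' * r ^+ len e.
Proof.
have : f e <= D' * (1 + h) ^+ len e.
  apply: le_trans (f_le e) _; rewrite /D' -mulrA ler_wpM2l//.
  by rewrite ler_pdivlMl// mulrC len_exp.
move=> /le_trans; apply; rewrite ler_wpM2l//.
by rewrite /r -exprM mulnC exprM expr2 ler_peMl ?exprn_ge0 ?exprn_ege1// (le_trans _ h1).
Qed.

Let exp1 y k : (k < size y)%N ->
  (\esum_(g in over y) (W (steps g) * r ^+ len (nth e0 g k))%:E
   <= (wq y * M)%:E)%E.
Proof.
move=> ky; have := excursions_exp_moment HW e0 h0 r_rho (pred1 k) y.
rewrite count_uniq_mem ?iota_uniq// mem_iota/= add0n ky expr1.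
apply: le_trans; apply: le_esum => g _; rewrite lee_fin ler_wpM2l//.
rewrite -big_filter filter_pred1_uniq ?iota_uniq ?mem_iota//.
by rewrite big_seq1.
Qed.

Lemma f_moment1 y k : (k < size y)%N ->
  (\esum_(g in over y) (W (steps g) * f (nth e0 g k))%:E
   <= (wq y * (D' * M))%:E)%E.
Proof.
move=> ky.
rewrite mulrCA EFinM; apply: le_trans (lee_wpmul2l _ (exp1 ky)); last by rewrite lee_fin.
rewrite -esumZl//; last by move=> g _; rewrite lee_fin mulr_ge0.
apply: le_esum => g _; rewrite -EFinM lee_fin mulrCA ler_wpM2l//.
Qed.

Lemma f_moment2 y k j : (k < size y)%N -> (j < size y)%N ->
  (\esum_(g in over y) (W (steps g) * (f (nth e0 g k) * f (nth e0 g j)))%:E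
   <= (wq y * (D' ^+ 2 * M))%:E)%E.
Proof.
move=> ky jy.
pose u i g := (W (steps g) * r ^+ len (nth e0 g i))%:E.
have u0 i g : (0 <= u i g)%E by rewrite lee_fin mulr_ge0.
have c0 : 0 <= D' ^+ 2 / 2 by rewrite divr_ge0// sqr_ge0.
apply: (@le_trans _ _ ((D' ^+ 2 / 2)%:E *
   (\esum_(g in over y) u k g + \esum_(g in over y) u j g))%E).
  rewrite -esumD// -esumZl//; last by move=> g _; rewrite adde_ge0.
  apply: le_esum => g _; rewrite /u -EFinD -EFinM lee_fin -mulrDr [leRHS]mulrCA ler_wpM2l//.
  have := f2_le (nth e0 g k); have := f2_le (nth e0 g j).
  have := sqr_ge0 (f (nth e0 g k) - f (nth e0 g j)).
  lra.
apply: le_trans (lee_wpmul2l _ (leeD (exp1 ky) (exp1 jy))) _; first by rewrite lee_fin.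
by rewrite -EFinD -EFinM lee_fin; lra.
Qed.

(** The word [w] stands for a window of radius [L], whose centre has index [L];
around a good jump this is also the conditional mean given all the jumps. *)
Definition mean_at (L : nat) (w : seq G) : R :=
  if (L < size w)%N then
    fine (\esum_(g in over w) (W (steps g) * f (nth e0 g L))%:E) / wq w
  else 0.

Lemma mean_at_bounds L w : 0 <= mean_at L w <= D' * M.
Proof.
rewrite /mean_at; case: ifPn => [Lw|_]; last by rewrite lexx mulr_ge0.
have ge0 : (0 <= \esum_(g in over w) (W (steps g) * f (nth e0 g L))%:E)%E.
  by rewrite esum_ge0// => g _; rewrite lee_fin mulr_ge0.
have le := f_moment1 Lw.
have fin : \esum_(g in over w) (W (steps g) * f (nth e0 g L))%:E \is a fin_num.
  by rewrite ge0_fin_numE// (le_lt_trans le)// ltry.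
rewrite divr_ge0 ?fine_ge0//=.
have [->|wN0] := eqVneq (wq w) 0; first by rewrite invr0 mulr0 mulr_ge0.
have w_gt0 : 0 < wq w by rewrite lt_def wN0 wq0.
by rewrite ler_pdivrMr// -lee_fin fineK// [X in (_ <= X%:E)%E]mulrC.
Qed.

Definition restricted_mean y k := fine (\esum_(g in over y) (W (steps g) * f (nth e0 g k))%:E).

Lemma restricted_meanE y k : (k < size y)%N ->
  \esum_(g in over y) (W (steps g) * f (nth e0 g k))%:E = (restricted_mean y k)%:E.
Proof.
move=> ky; rewrite fineK// ge0_fin_numE.
  by rewrite (le_lt_trans (f_moment1 ky))// ltry.
by rewrite esum_ge0// => g _; rewrite lee_fin mulr_ge0.
Qed.

Let mass1 y : \esum_(g in over y) (W (steps g) * 1)%:E = (wq y)%:E.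
Proof. by rewrite -(excursions_mass HW); apply: eq_esum => g _; rewrite mulr1. Qed.

Lemma restricted_mean_take y c k : (k < c <= size y)%N -> cut y c ->
  restricted_mean y k = restricted_mean (take c y) k * wq (drop c y).
Proof.
move=> /andP[kc cy] yc; apply: EFin_inj.
rewrite -(restricted_meanE (leq_trans kc cy)).
have kt : (k < size (take c y))%N by rewrite size_takel.
rewrite -(excursions_cut _ _ cy yc (restricted_meanE kt) (mass1 _))//.
by apply: eq_esum => g _; rewrite mulr1 nth_take.
Qed.

Lemma restricted_mean_drop y c k : (c <= k < size y)%N -> cut y c ->
  restricted_mean y k = wq (take c y) * restricted_mean (drop c y) (k - c).
Proof.
move=> /andP[ck ky] yc; apply: EFin_inj.
have cy : (c <= size y)%N by rewrite (leq_trans ck)// ltnW.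
rewrite -(restricted_meanE ky).
have kt : (k - c < size (drop c y))%N by rewrite size_drop ltn_sub2r// (leq_ltn_trans ck).
rewrite -(excursions_cut _ _ cy yc (mass1 _) (restricted_meanE kt))//.
by apply: eq_esum => g _; rewrite mul1r nth_drop subnKC.
Qed.

Lemma restricted_mean0 y k : (k < size y)%N -> wq y = 0 -> restricted_mean y k = 0.
Proof.
move=> ky y0; apply/eqP; rewrite eq_le -!lee_fin -(restricted_meanE ky).
rewrite (le_trans (f_moment1 ky)) ?y0 ?mul0r//=.
by rewrite esum_ge0// => g _; rewrite lee_fin mulr_ge0.
Qed.

Definition has_cut y a b := exists2 c, (a <= c <= b)%N & cut y c.

(** The surrounding cut times lie inside the window of radius [L], so that the
conditional mean over the excursion [k] depends on that window only. *)
Definition good (L : nat) y k : bool :=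
  [&& (L <= k)%N, (k < size y - L)%N &
   `[< has_cut y (k - L) k /\ has_cut y k.+1 (k + L.+1) >]].

(** Cut at the two cut times that surround [k], both the word and its window
split into a common middle factor, which contains the excursion [k], and outer
factors, which cancel in the conditional mean. *)
Lemma good_mean L y k : good L y k ->
  restricted_mean y k = wq y * mean_at L (window L k y).
Proof.
move=> /and3P[Lk ky /asboolP[[c /andP[Lc ck] yc] [c' /andP[kc' c'L] yc']]].
have ksz : (k < size y)%N by nat_lia.
have szw : size (window L k y) = L.*2.+1.
  have Ly : (L.*2.+1 <= size y - (k - L))%N by nat_lia.
  by rewrite /window size_takel ?size_drop.
have Lw : (L < size (window L k y))%N by rewrite szw; nat_lia.
rewrite /mean_at Lw -/(restricted_mean _ _).
set w := window L k y in szw *.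
have yw : y = take (k - L) y ++ w ++ drop (k + L.+1) y.
  rewrite /w /window -[in drop (k + _) _](_ : L.*2.+1 + (k - L) = k + L.+1)%N; last nat_lia.
  by rewrite -drop_drop cat_take_drop cat_take_drop.
have [y0|yN0] := eqVneq (wq y) 0.
  by rewrite restricted_mean0// y0 mul0r.
have wN0 : wq w != 0.
  apply: contraNneq yN0 => w0.
  by rewrite yw !word_weight_cat w0 mul0r mulr0.
rewrite mulrA; apply/(canRL (mulfK wN0)).
have cutw a : (k - L <= a <= k + L.+1)%N -> cut y a -> cut w (a - (k - L)).
  by move=> /andP[La aL] ya; apply: cut_take; exact: cut_drop.
have E1 : restricted_mean y k = wq (take c y) * (restricted_mean (drop c (take c' y)) (k - c) * wq (drop c' y)).
  rewrite (restricted_mean_take _ yc')//; last nat_lia.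
  rewrite (@restricted_mean_drop (take c' y) c)//; last 2 first.
  - by rewrite size_takel; nat_lia.
  - exact: cut_take.
  by rewrite take_takel ?mulrA//; nat_lia.
have E2 : restricted_mean w L = wq (take (c - (k - L)) w) *
   (restricted_mean (drop c (take c' y)) (k - c) * wq (drop (c' - (k - L)) w)).
  rewrite (@restricted_mean_take w (c' - (k - L)))//; last 2 first.
  - by rewrite szw; nat_lia.
  - by apply: cutw => //; nat_lia.
  rewrite (@restricted_mean_drop (take (c' - (k - L)) w) (c - (k - L)))//; last 2 first.
  - by rewrite size_takel ?szw; nat_lia.
  - by apply/cut_take/cutw => //; nat_lia.
  rewrite take_takel; last nat_lia.
  rewrite mulrA; congr (_ * restricted_mean _ _ * _); last nat_lia.
  rewrite /w /window take_takel; last nat_lia.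
  rewrite take_drop drop_drop; congr (drop _ (take _ _)); nat_lia.
have take_w : take c y = take (k - L) y ++ take (c - (k - L)) w.
  rewrite {1}yw take_cat size_takel; last nat_lia.
  rewrite ltnNge Lc/= takel_cat// szw; nat_lia.
have drop_w : drop c' y = drop (c' - (k - L)) w ++ drop (k + L.+1) y.
  rewrite {1}yw drop_cat size_takel; last nat_lia.
  case: ltnP => [|_]; first nat_lia.
  rewrite drop_cat szw; case: ltnP => // ge.
  have -> : (c' - (k - L) = L.*2.+1)%N by nat_lia.
  by rewrite subnn drop0 (@drop_oversize _ _ w)// szw.
have wqy : wq y = wq (take (k - L) y) * (wq w * wq (drop (k + L.+1) y)).
  by rewrite -!word_weight_cat -yw.
rewrite E1 E2 take_w drop_w wqy !word_weight_cat; ring.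
Qed.

(** The cut time that follows [k] separates the excursions [k] and [j]. *)
Lemma good_correlation L y k j : good L y k -> (k + L.+1 <= j < size y)%N ->
  \esum_(g in over y) (W (steps g) * (f (nth e0 g k) * f (nth e0 g j)))%:E
  = (mean_at L (window L k y) * restricted_mean y j)%:E.
Proof.
move=> gk /andP[kj jy]; have := gk => /and3P[Lk ky /asboolP[_ [c /andP[kc cL] yc]]].
have cy : (c <= size y)%N by nat_lia.
have kt : (k < size (take c y))%N by rewrite size_takel.
have jd : (j - c < size (drop c y))%N by rewrite size_drop; nat_lia.
have -> : \esum_(g in over y) (W (steps g) * (f (nth e0 g k) * f (nth e0 g j)))%:E
   = (restricted_mean (take c y) k * restricted_mean (drop c y) (j - c))%:E.
  rewrite -(excursions_cut _ _ cy yc (restricted_meanE kt) (restricted_meanE jd))//.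
  apply: eq_esum => g _; rewrite nth_take// nth_drop subnKC//; nat_lia.
congr EFin.
have [y0|yN0] := eqVneq (wq y) 0.
  have -> : restricted_mean y j = 0 by rewrite restricted_mean0.
  rewrite mulr0; apply/eqP; rewrite mulf_eq0; apply/orP.
  have := y0; rewrite -{1}(cat_take_drop c y) word_weight_cat => /eqP.
  by rewrite mulf_eq0 => /orP[]/eqP z0; [left|right]; rewrite restricted_mean0.
rewrite (@restricted_mean_drop y c j) ?yc//; last by nat_lia.
apply: (mulfI yN0); rewrite [RHS]mulrA -(good_mean gk).
rewrite (restricted_mean_take _ yc) ?kc//.
by rewrite -{1}(cat_take_drop c y) word_weight_cat; ring.
Qed.

End excursion_lln.

(** * Concentration given the jumps *)

Section excursion_concentration.
Context {R : realType} {V : choiceType} {G : zmodType}.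
Variables (p : V -> G) (W Wh : seq V -> R) (q : G -> R) (rho : R).
Hypothesis HW : excursion_weights p W Wh q rho.
Local Notation wq := (word_weight q).
Local Notation over := (excursions_over p).
Local Notation len := excursion_length.
Variable e0 : excursion (V := V).
Variables (f : excursion (V := V) -> R) (D : R).
Hypothesis f_ge0 : forall e, 0 <= f e.
Hypothesis f_le : forall e, f e <= D * (len e)%:R.

Let W0 := weight_ge0 HW.
Let q0 := jump_ge0 HW.
Let wq0 y : 0 <= wq y. Proof. exact: word_weight_ge0. Qed.

Implicit Types (e : excursion (V := V)) (g : seq (excursion (V := V))) (y : seq G).

Let D0 : 0 <= D.
Proof. by have := le_trans (f_ge0 e0) (f_le e0); rewrite pmulr_lge0 ?ltr0n. Qed.

Definition bad_count (L : nat) y : nat :=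
  count (predC (good L y)) (iota 0 (size y)).

Section fixed_rate.
Variable h : R.
Hypothesis h0 : 0 < h.
Hypothesis r_rho : (1 + h) ^+ 2 * rho < 1.
Local Notation M := (exp_bound rho h).
Let r := (1 + h) ^+ 2.
Local Notation m L y k := (mean_at p W q e0 f L (window L k y)).

Let M1 : 1 <= M. Proof. exact: exp_bound_ge1 HW _ h0 r_rho. Qed.
Let M0 : 0 <= M. Proof. exact: le_trans M1. Qed.

(** Given the jumps, excursions at good indices more than [L] apart are
uncorrelated, so the variance of their total is linear in the length. *)
Lemma good_chebyshev L y (x : R) : 0 < x ->
  (\esum_(g in over y `&` [set g | (x <=
      `|\sum_(k <- iota 0 (size y) | good L y k) f (nth e0 g k)
        - \sum_(k <- iota 0 (size y) | good L y k) m L y k|)%R]) (W (steps g))%:E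
   <= (wq y * ((D / h) ^+ 2 * M * (L.*2.+1)%:R * (size y)%:R / x ^+ 2))%:E)%E.
Proof.
move=> x0; set n := size y.
pose I := [seq k <- iota 0 n | good L y k].
rewrite [X in esum (_ `&` X)](_ : _ = [set g | (x <=
    `|\sum_(k <- I) f (nth e0 g k) - \sum_(k <- I) m L y k|)%R]); last first.
  by apply/seteqP; split => g /=; rewrite /I !big_filter.
have DM0 : 0 <= (D / h) ^+ 2 * M by rewrite mulr_ge0// sqr_ge0.
apply: le_trans (@esum_chebyshev R _ (over y) (fun g => W (steps g)) (wq y) I
  (fun k g => f (nth e0 g k)) (fun k => m L y k)
  (fun k j => if (k <= j + L)%N && (j <= k + L)%N then (D / h) ^+ 2 * M else 0) x
  _ _ _ _ _ _ _ _) _ => //.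
- by move=> k; case/andP: (mean_at_bounds HW e0 h0 r_rho f_ge0 f_le L (window L k y)).
- exact: excursions_mass HW y.
- move=> k; rewrite mem_filter mem_iota => /andP[gk kn].
  by rewrite (restricted_meanE HW e0 h0 r_rho f_ge0 f_le)// (good_mean HW e0 h0 r_rho f_ge0 f_le gk).
- have far k j : k \in I -> j \in I -> (k + L < j)%N ->
    \esum_(g in over y) (W (steps g) * (f (nth e0 g k) * f (nth e0 g j)))%:E
    = (wq y * (m L y k * m L y j))%:E.
    rewrite !mem_filter !mem_iota => /andP[gk _] /andP[gj /= jn] kj.
    rewrite (good_correlation HW e0 h0 r_rho f_ge0 f_le gk); last first.
      by rewrite addnS kj jn.
    by rewrite (good_mean HW e0 h0 r_rho f_ge0 f_le gj); congr EFin; ring.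
  move=> k j kI jI.
  case: ifPn => [_|]; last first.
    rewrite negb_and -!ltnNge addr0 => /orP[jk|kj]; last by rewrite far.
    rewrite (_ : esum _ _ = \esum_(g in over y)
      (W (steps g) * (f (nth e0 g j) * f (nth e0 g k)))%:E).
      by rewrite far// [X in _ * X]mulrC.
    by apply: eq_esum => g _; rewrite [X in _ * X]mulrC.
  move: kI jI; rewrite !mem_filter !mem_iota => /andP[_ /= kn] /andP[_ /= jn].
  apply: le_trans (f_moment2 HW e0 h0 r_rho f_ge0 f_le kn jn) _.
  rewrite lee_fin ler_wpM2l// lerDr mulr_ge0//.
    by case/andP: (mean_at_bounds HW e0 h0 r_rho f_ge0 f_le L (window L k y)).
  by case/andP: (mean_at_bounds HW e0 h0 r_rho f_ge0 f_le L (window L j y)).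
- rewrite -mulrA lee_fin ler_wpM2l// ler_wpM2r ?invr_ge0 ?sqr_ge0//.
  rewrite big_filter; under eq_bigr do rewrite big_filter.
  by rewrite near_pairs_sum.
Qed.

(** Markov's inequality for the exponential moment of the length. Counting [J]
steps for each index in [B] pays for the factor [exp_bound] of that index; what
exceeds this is turned into a power-law bound by Bernoulli's inequality. *)
Lemma bad_markov (B : pred nat) y (J : nat) (x : R) : 0 < x -> M <= r ^+ J ->
  (\esum_(g in over y `&` [set g | (J%:R * (count B (iota 0 (size y)))%:R + x <=
      (\sum_(k <- iota 0 (size y) | B k) len (nth e0 g k))%:R)%R])
     (W (steps g))%:E <= (wq y * (x * h)^-1)%:E)%E.
Proof.
move=> x0 MJ; set nB := count _ _.
pose S g := \sum_(k <- iota 0 (size y) | B k) len (nth e0 g k).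
have xh : 0 < x * h by rewrite mulr_gt0.
have MB : 0 < M ^+ nB by rewrite exprn_gt0// (lt_le_trans ltr01).
have r0 k : 0 <= r ^+ k by rewrite exprn_ge0// sqr_ge0.
have c0 : 0 <= (M ^+ nB * (x * h))^-1 by rewrite invr_ge0 mulr_ge0 ?ltW.
apply: (@le_trans _ _ (\esum_(g in over y)
   ((M ^+ nB * (x * h))^-1%:E * (W (steps g) * r ^+ S g)%:E))%E).
  rewrite esum_mkcondr; apply: le_esum => g _.
  case: ifPn => [/set_mem/= xS|_]; last first.
    by rewrite -EFinM lee_fin; apply: mulr_ge0 => //; exact: mulr_ge0.
  rewrite -EFinM lee_fin mulrCA ler_peMr// mulrC ler_pdivlMr ?mulr_gt0// mul1r.
  have JS : (J * nB <= S g)%N.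
    by rewrite -(ler_nat R) natrM (le_trans _ xS)// lerDl ltW.
  have -> : S g = (J * nB + (S g - J * nB))%N by rewrite subnKC.
  rewrite exprD exprM ler_pM//; first exact: ltW.
  - exact: ltW.
  - by rewrite lerXn2r// nnegrE.
  have h1 : 1 <= 1 + h by rewrite lerDl ltW.
  apply: (@le_trans _ _ ((1 + h) ^+ (S g - J * nB))); last first.
    rewrite /r -exprM [(2 * _)%N]mulnC exprM expr2 ler_peMl ?exprn_ege1//.
    by rewrite exprn_ge0// (le_trans _ h1).
  apply: le_trans (bernoulli_ineq _ (ltW h0)).
  rewrite natrB// natrM ler_wpDl// ler_wpM2r ?(ltW h0)//.
  by rewrite lerBrDl.
rewrite esumZl//; last by move=> g _; rewrite lee_fin mulr_ge0.
apply: le_trans (lee_wpmul2l _ (excursions_exp_moment HW e0 h0 r_rho B y)) _.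
  by rewrite lee_fin.
rewrite -EFinM lee_fin -/nB le_eqVlt; apply/orP; left; apply/eqP.
by rewrite invfM; field; rewrite !gt_eqF.
Qed.

End fixed_rate.

Definition excursions_size (n : nat) : set (seq (excursion (V := V))) :=
  [set g | all (is_excursion p) g /\ size g = n].

Lemma esum_excursions_size n (a : seq (excursion (V := V)) -> \bar R) :
  (forall g, 0 <= a g)%E ->
  (\esum_(g in excursions_size n) a g =
   \esum_(y in words G n) \esum_(g in over y) a g)%E.
Proof.
move=> a0; rewrite esum_esum//.
rewrite (@reindex_esum _ _ _ (words G n `*`` over) (excursions_size n) (fun k => k.2))//.
split.
- by move=> [y g] [/= yn gy]; split; [case: gy | rewrite (size_excursions_over gy)].
- move=> [y g] [y' g']; rewrite !inE => -[/= _ [_ gy]] [/= _ [_ gy']] gg'.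
  by rewrite -gy -gy' gg'.
- move=> g [vg gn]; exists (jumps p g, g) => //=; split=> //=.
  by rewrite /words/= size_map.
Qed.

Let hold_rate_gap : exists2 h : R, 0 < h & (1 + h) ^+ 2 * rho < 1.
Proof.
case/andP: (hold_rate_bounds HW) => rho0 rho1.
have key (t : R) : 0 < t -> (1 + t) ^+ 2 * (1 - 4 * t) < 1.
  move=> t0; have : 0 < t * t by rewrite mulr_gt0.
  have : 0 < t * t * t by rewrite !mulr_gt0.
  rewrite expr2; lra.
have t0 : 0 < (1 - rho) / 4 by rewrite divr_gt0// subr_gt0.
exists ((1 - rho) / 4) => //.
have := key _ t0; rewrite mulrCA divff ?pnatr_eq0// mulr1.
have -> : 1 - (1 - rho) = rho by ring.
by [].
Qed.

(** The excursions at good indices follow their conditional means, which are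
functions of windows of the jumps and obey the law of large numbers for words;
the few excursions at bad indices are short in total. The fraction [lam] of bad
indices that can be tolerated does not depend on [L], which may therefore be
chosen afterwards, large enough to make bad indices as rare as that. *)
Theorem excursions_concentration (eps : R) : 0 < eps ->
  exists2 lam : R, 0 < lam & forall L : nat,
  exists gbar C : R, exists n0 : nat, forall n, (n0 <= n)%N ->
  (\esum_(g in excursions_size n `&`
      [set g | ((bad_count L (jumps p g))%:R <= lam * n%:R)%R /\
               (eps * n%:R < `|\sum_(e <- g) f e - gbar * n%:R|)%R])
     (W (steps g))%:E <= (C / n%:R)%:E)%E.
Proof.
move=> eps0; have [h h0 r_rho] := hold_rate_gap.
set M := exp_bound rho h.
have M1 : 1 <= M by exact: exp_bound_ge1 HW _ h0 r_rho.
have M0 : 0 <= M by exact: le_trans M1.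
(* [J] steps per bad index outweigh the exponential moment of an excursion. *)
have [J MJ] : exists J : nat, M <= ((1 + h) ^+ 2) ^+ J.
  exists (Num.truncn (M / h)).+1.
  have := truncnS_gt (M / h); set J := _.+1 => MJ.
  have h1 : 1 <= 1 + h by rewrite lerDl ltW.
  apply: (@le_trans _ _ ((1 + h) ^+ J)).
    apply: le_trans (bernoulli_ineq _ (ltW h0)).
    by rewrite ler_wpDl// -ler_pdivrMr// ltW.
  rewrite -exprM [(2 * _)%N]mulnC exprM expr2 ler_peMl ?exprn_ege1//.
  by rewrite exprn_ge0// (le_trans _ h1).
pose b := D / h * M.
have b0 : 0 <= b by rewrite mulr_ge0// divr_ge0// ltW.
pose d := eps / 6.
have d0 : 0 < d by rewrite divr_gt0.
pose D1 := D + 1; have D10 : 0 < D1 by rewrite ltr_wpDl.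
pose K := D1 * J%:R + b + 1.
have K0 : 0 < K by rewrite ltr_wpDl// addr_ge0// mulr_ge0// ltW.
exists (d / K); first by rewrite divr_gt0.
move=> L.
have [gbar /andP[gbar0 gbarb] LLN] :=
  words_lln (jump_ge0 HW) (jump_sum1 HW) L
    (mean_at_bounds HW e0 h0 r_rho f_ge0 f_le L).
pose Ca := (D / h) ^+ 2 * M * (L.*2.+1)%:R / d ^+ 2.
pose Cb := (d / D1 * h)^-1.
pose Cc := b ^+ 2 * (L.*2.*2.+1)%:R / d ^+ 2.
exists gbar, (Ca + Cb + Cc), (Num.truncn ((L.*2)%:R * b / d)).+1 => n n_large.
have n0 : 0 < n%:R :> R by rewrite ltr0n; case: n n_large.
have nN0 : n%:R != 0 :> R by rewrite gt_eqF.
have Ln : (L.*2)%:R * b <= d * n%:R.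
  rewrite [leRHS]mulrC -ler_pdivrMr// (le_trans (ltW (truncnS_gt _)))//.
  by rewrite ler_nat.
set A := [set g | _ /\ _].
have dn0 : 0 < d * n%:R by rewrite mulr_gt0.
pose I := iota 0 n.
pose m y k := mean_at p W q e0 f L (window L k y).
have m0 y k : 0 <= m y k.
  by case/andP: (mean_at_bounds HW e0 h0 r_rho f_ge0 f_le L (window L k y)).
have mb y k : m y k <= b.
  by case/andP: (mean_at_bounds HW e0 h0 r_rho f_ge0 f_le L (window L k y)).
pose Y1 := [set y | d * n%:R <= `|\sum_(k <- I | (L <= k < n - L)%N) m y k
    - \sum_(k <- I | (L <= k < n - L)%N) gbar|].
pose G1 y := [set g | d * n%:R <= `|\sum_(k <- I | good L y k) f (nth e0 g k)
    - \sum_(k <- I | good L y k) m y k|].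
pose G2 y := [set g | J%:R * (bad_count L y)%:R + d * n%:R / D1
    <= (\sum_(k <- I | ~~ good L y k) len (nth e0 g k))%:R :> R].
have cover y g : size y = n -> over y g -> A g -> ~ Y1 y -> G1 y g \/ G2 y g.
  move=> yn gy [bad dev] nY1; apply: contrapT => /not_orP[nG1 nG2].
  have gn : size g = n by rewrite (size_excursions_over gy).
  have jg : jumps p g = y by case: gy.
  rewrite jg in bad.
  have {}nY1 : `|\sum_(k <- I | (L <= k < n - L)%N) m y k
    - \sum_(k <- I | (L <= k < n - L)%N) gbar| < d * n%:R.
    by rewrite ltNge; apply/negP.
  have {}nG1 : `|\sum_(k <- I | good L y k) f (nth e0 g k)
    - \sum_(k <- I | good L y k) m y k| < d * n%:R.
    by rewrite ltNge; apply/negP.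
  have {}nG2 : (\sum_(k <- I | ~~ good L y k) len (nth e0 g k))%:R <
      J%:R * (bad_count L y)%:R + d * n%:R / D1.
    by rewrite ltNge; apply/negP.
  set N := (bad_count L y)%:R : R in bad nG2.
  have N0 : 0 <= N by [].
  have KN : K * N <= d * n%:R.
    by rewrite mulrC -ler_pdivlMr// mulrAC.
  have F_split : \sum_(e <- g) f e = \sum_(k <- I | good L y k) f (nth e0 g k)
      + \sum_(k <- I | ~~ good L y k) f (nth e0 g k).
    by rewrite (big_nth e0) /index_iota subn0 gn (bigID (good L y)).
  have F_bad : \sum_(k <- I | ~~ good L y k) f (nth e0 g k) <= D1 * J%:R * N + d * n%:R.
    apply: (@le_trans _ _ (D1 * (\sum_(k <- I | ~~ good L y k) len (nth e0 g k))%:R)).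
      rewrite natr_sum mulr_sumr; apply: ler_sum => k _.
      by apply: le_trans (f_le _) _; rewrite ler_wpM2r// lerDl.
    apply: le_trans (ler_wpM2l (ltW D10) (ltW nG2)) _.
    by rewrite mulrDr mulrA [D1 * (_ / _)]mulrC divfK ?gt_eqF.
  have F_bad0 : 0 <= \sum_(k <- I | ~~ good L y k) f (nth e0 g k) by apply: sumr_ge0.
  have m_split : \sum_(k <- I | (L <= k < n - L)%N) m y k =
      \sum_(k <- I | good L y k) m y k +
      \sum_(k <- I | (L <= k < n - L)%N && ~~ good L y k) m y k.
    rewrite (bigID (good L y))/=; congr (_ + _); apply: eq_bigl => k.
    by rewrite /good yn; case: (L <= k)%N => //=; case: (k < n - L)%N.
  have m_bad0 : 0 <= \sum_(k <- I | (L <= k < n - L)%N && ~~ good L y k) m y k.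
    by apply: sumr_ge0.
  have m_bad : \sum_(k <- I | (L <= k < n - L)%N && ~~ good L y k) m y k <= b * N.
    apply: (@le_trans _ _ (\sum_(k <- I | ~~ good L y k) b)).
      rewrite big_mkcond [leRHS]big_mkcond; apply: ler_sum => k _.
      by case: (good L y k); rewrite ?andbF// andbT; case: ifP.
    by rewrite big_const_seq iter_addr_0 -mulr_natr /N /bad_count yn.
  have gbar_sum : \sum_(k <- I | (L <= k < n - L)%N) gbar
      = gbar * (count (fun k => L <= k < n - L)%N I)%:R.
    by rewrite big_const_seq iter_addr_0 mulr_natr.
  set c := count _ _ in gbar_sum.
  have cn : (c <= n)%N by rewrite -[leqRHS](size_iota 0); exact: count_size.
  have nc : (n <= c + L.*2)%N.
    rewrite /c -size_filter.
    have [nL|nL] := leqP n L.*2; first nat_lia.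
    rewrite addnC -leq_subLR -(size_iota L (n - L.*2)) uniq_leq_size ?iota_uniq//.
    by move=> k; rewrite mem_filter !mem_iota; nat_lia.
  have gc1 : gbar * c%:R <= gbar * n%:R by rewrite ler_wpM2l// ler_nat.
  have gc2 : gbar * n%:R <= gbar * c%:R + d * n%:R.
    have : gbar * n%:R <= gbar * (c + L.*2)%:R by rewrite ler_wpM2l// ler_nat.
    move=> /le_trans; apply; rewrite natrD mulrDr lerD2l (le_trans _ Ln)//.
    by rewrite mulrC ler_wpM2l.
  have KE : K * N = D1 * J%:R * N + b * N + N by rewrite /K; ring.
  have DJN0 : 0 <= D1 * J%:R * N by rewrite !mulr_ge0// ltW.
  have bN0 : 0 <= b * N by rewrite mulr_ge0.
  have epsE : eps * n%:R = 6 * (d * n%:R) by rewrite /d; field.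
  move: dev nY1 nG1; rewrite epsE F_split m_split gbar_sum !ltr_norml => dev.
  move=> /andP[nY1a nY1b] /andP[nG1a nG1b].
  move: dev; rewrite ltNge => /negP; apply; rewrite ler_norml; apply/andP; split; lra.
have Ca0 : 0 <= Ca / n%:R.
  by rewrite divr_ge0// divr_ge0 ?sqr_ge0// mulr_ge0// mulr_ge0// sqr_ge0.
have Cb0 : 0 <= Cb / n%:R.
  by rewrite divr_ge0// invr_ge0 mulr_ge0 ?(ltW h0)// divr_ge0// ltW.
rewrite esum_mkcondr esum_excursions_size; last by move=> g; case: ifP; rewrite ?lee_fin.
apply: (@le_trans _ _ (\esum_(y in words G n)
    ((if y \in Y1 then (wq y)%:E else 0) + (wq y * (Ca / n%:R))%:E
       + (wq y * (Cb / n%:R))%:E)))%E.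
  apply: le_esum => y yn; rewrite -esum_mkcondr.
  case: ifPn => [_|/negP nY1].
    apply: (@le_trans _ _ (wq y)%:E); last first.
      rewrite -addeA -!EFinD lee_fin lerDl.
      exact: addr_ge0 (mulr_ge0 (wq0 y) Ca0) (mulr_ge0 (wq0 y) Cb0).
    rewrite -(excursions_mass HW); apply: esum_subset => [g [] //|g _].
    by rewrite lee_fin.
  rewrite add0e.
  apply: (@le_trans _ _ (\esum_(g in (over y `&` G1 y) `|` (over y `&` G2 y)) (W (steps g))%:E)).
    apply: esum_subset => [g [gy Ag]|g _]; last by rewrite lee_fin.
    have [|G1g|G2g] := cover y g yn gy Ag; [|by left|by right].
    by move=> Y1y; apply: nY1; rewrite inE.
  apply: le_trans (esum_setU_le _ _) _; [by move=> g _; rewrite lee_fin..|].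
  apply: leeD.
    have := good_chebyshev h0 r_rho L y dn0.
    rewrite yn => /le_trans; apply; rewrite lee_fin ler_wpM2l//.
    rewrite le_eqVlt; apply/orP; left; apply/eqP; rewrite /Ca -/M; field.
    by rewrite !gt_eqF.
  have x0 : 0 < d * n%:R / D1 by rewrite divr_gt0.
  have := @bad_markov h h0 r_rho (predC (good L y)) y J _ x0 MJ.
  rewrite yn (_ : count _ (iota 0 n) = bad_count L y); last by rewrite /bad_count yn.
  move=> H; apply: le_trans H _; rewrite lee_fin ler_wpM2l//.
  rewrite le_eqVlt; apply/orP; left; apply/eqP; rewrite /Cb; field.
  by rewrite !gt_eqF.
have wsum c : 0 <= c -> \esum_(y in words G n) (wq y * c)%:E = c%:E.
  move=> c0; under eq_esum do rewrite mulrC EFinM.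
  rewrite esumZl//; last by move=> y _; rewrite lee_fin.
  by rewrite (words_weight1 (jump_ge0 HW) (jump_sum1 HW)) mule1.
rewrite !esumD; last 4 first.
- by move=> y _; case: ifP; rewrite ?lee_fin.
- by move=> y _; rewrite lee_fin mulr_ge0.
- move=> y _; apply: adde_ge0; last by rewrite lee_fin mulr_ge0.
  by case: ifP; rewrite ?lee_fin.
- by move=> y _; rewrite lee_fin mulr_ge0.
rewrite !wsum// -esum_mkcondr.
have -> : (Ca + Cb + Cc) / n%:R = Cc / n%:R + Ca / n%:R + Cb / n%:R.
  by field.
rewrite 2!EFinD; apply: leeD => //; apply: leeD => //.
apply: le_trans (LLN n (d * n%:R) dn0) _; rewrite lee_fin le_eqVlt; apply/orP; left; apply/eqP.
by rewrite /Cc /b -/M; field; rewrite !gt_eqF.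
Qed.

End excursion_concentration.

(** * Product measures *)

Section image_measure.
Context d d' (T1 : measurableType d) (T2 : measurableType d') (R : realType).
Variables (m : {measure set T1 -> \bar R}) (f : T1 -> T2).
Hypothesis mf : measurable_fun [set: T1] f.

Definition image_measure : {measure set T2 -> \bar R} :=
  measure_function_pushforward__canonical__measure_function_Measure m mf.

Lemma image_measureE A : image_measure A = m (f @^-1` A).
Proof. by []. Qed.

Lemma integral_image_measure (g : T2 -> \bar R) :
  measurable_fun [set: T2] g -> (forall x, 0 <= g x)%E ->
  (\int[image_measure]_x g x = \int[m]_x g (f x))%E.
Proof.
by move=> mg g0; rewrite (ge0_integral_pushforward mf)// preimage_setT.
Qed.

End image_measure.

Section product_spaces.
Context {R : realType} {I : choiceType} {dT : measure_display}
  {T : measurableType dT}.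
Implicit Types (S : {fset I}) (A : I -> set T).
Local Notation prod_sp := (product_space I T).

Definition box S A : set prod_sp := [set f | forall i, i \in S -> A i (f i)].

Lemma measurable_coord i : measurable_fun [set: prod_sp] (fun f : prod_sp => f i).
Proof.
move=> _ B mB; apply: sub_sigma_algebra; exists i => //.
by exists B.
Qed.

Lemma measurable_to_product d (S : measurableType d) (g : S -> prod_sp) :
  (forall i, measurable_fun [set: S] (fun x => g x i)) ->
  measurable_fun [set: S] g.
Proof.
move=> mg; apply: (@measurability _ _ S prod_sp setT g (@coord_preimages I dT T)) => //.
move=> _ [_ [i _ [B mB <-]] <-].
by rewrite !setTI; have := mg i measurableT B mB; rewrite setTI.
Qed.

Lemma boxE S A : box S A = \big[setI/setT]_(i <- S) ((fun f : prod_sp => f i) @^-1` (A i)).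
Proof.
rewrite -bigcap_seq; apply/seteqP; split => f /=; first by move=> fA i; exact: fA.
by move=> fA i iS; exact: fA.
Qed.

Lemma measurable_box S A : (forall i, measurable (A i)) -> measurable (box S A).
Proof.
move=> mA; rewrite boxE big_seq; apply: bigsetI_measurable => i _.
by rewrite -[X in measurable X]setTI; exact: measurable_coord.
Qed.

(** The boxes are stable under intersection and generate the product
sigma-algebra. *)
Lemma product_measure_determined (mu : probability T R)
    (P1 P2 : {measure set prod_sp -> \bar R}) :
  is_product_measure mu P1 -> is_product_measure mu P2 ->
  forall B, measurable B -> P1 B = P2 B.
Proof.
move=> P1mu P2mu.
pose G := [set box SA.1 SA.2 | SA in
  [set SA : {fset I} * (I -> set T) | forall i, measurable (SA.2 i)]].
have Gsetm : box fset0 (fun=> setT) = setT.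
  by apply/seteqP; split => f.
apply: (measure_unique G (fun=> setT)) => //.
- apply/seteqP; split.
    apply: sub_sigma_algebra2 => _ [i _ [B mB <-]]; exists ([fset i]%fset, fun=> B) => //=.
    apply/seteqP; split => [f /= fB|f [_ fB] j /=]; last by rewrite inE => /eqP->.
    by split => //; apply: fB; rewrite inE.
  apply: smallest_sub; first exact: sigma_algebra_measurable.
  by move=> _ [[S A] /= mA <-]; exact: measurable_box.
- move=> _ _ [[S A] /= mA <-] [[S' A'] /= mA' <-].
  exists ((S `|` S')%fset, fun i => (if i \in S then A i else setT) `&`
                             (if i \in S' then A' i else setT)) => /=.
    by move=> i; apply: measurableI; case: ifP.
  apply/seteqP; split => [f /= fA|f [/= fA fA'] i _]; last first.
    by split; case: ifPn => //; [exact: fA|exact: fA'].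
  split => i iS; have := fA i; rewrite inE iS ?orbT => /(_ isT)[]//.
- by move=> _; exists (fset0, fun=> setT); [move=> i /=|exact: Gsetm].
- by rewrite bigcup_const.
- by move=> _ [[S A] /= mA <-]; rewrite P1mu// P2mu.
- by move=> _; rewrite -Gsetm P1mu// ltry.
Qed.

Lemma product_measure_setT (mu : probability T R) (P : {measure set prod_sp -> \bar R}) :
  is_product_measure mu P -> P setT = 1%E.
Proof.
move=> /(_ fset0 (fun=> setT) (fun=> measurableT)).
rewrite big_seq_fset0 => <-; congr (P _).
by apply/seteqP; split => f.
Qed.

Lemma measurable_reindex (s : I -> I) :
  measurable_fun [set: prod_sp] (fun f : prod_sp => (f \o s) : prod_sp).
Proof. by apply: measurable_to_product => i; exact: measurable_coord. Qed.

Lemma product_measure_reindex (mu : probability T R) (P : {measure set prod_sp -> \bar R})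
    (s t : I -> I) : cancel s t -> is_product_measure mu P ->
  forall B, measurable B -> P ((fun f : prod_sp => (f \o s) : prod_sp) @^-1` B) = P B.
Proof.
move=> st Pmu B mB.
rewrite -(image_measureE P (measurable_reindex s)).
apply: (@product_measure_determined mu) => // S A mA.
rewrite image_measureE.
have -> : (fun f : prod_sp => (f \o s) : prod_sp) @^-1`
    [set f | forall i, i \in S -> A i (f i)] = box (s @` S)%fset (A \o t).
  apply/seteqP; split => [f /= fA _ /imfsetP[i /= iS ->]|f /= fA i iS].
    by rewrite /= st; exact: fA.
  by have := fA (s i); rewrite /= st; apply; exact: in_imfset.
rewrite /box (Pmu _ (A \o t) (fun i => mA (t i))); congr EFin.
rewrite big_imfset/=; last by move=> i j _ _; exact: (can_inj st).
by apply: eq_bigr => i _; rewrite st.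
Qed.

(** Two independent copies of a product measure, used on complementary sets of
coordinates, make up one copy. *)
Definition mix (D : pred I) (w : prod_sp * prod_sp) : prod_sp :=
  fun i => if D i then w.1 i else w.2 i.

Lemma measurable_mix D : measurable_fun [set: prod_sp * prod_sp] (mix D).
Proof.
apply: measurable_to_product => i; rewrite /mix; case: (D i).
  exact: measurableT_comp (measurable_coord i) measurable_fst.
exact: measurableT_comp (measurable_coord i) measurable_snd.
Qed.

Lemma product_measure_mix (mu : probability T R) (P : {sigma_finite_measure set prod_sp -> \bar R})
    (D : pred I) : is_product_measure mu P ->
  forall B, measurable B -> (P \x P)%E (mix D @^-1` B) = P B.
Proof.
move=> Pmu B mB.
rewrite -(image_measureE (P \x P)%E (measurable_mix D)).
apply: (@product_measure_determined mu) => // S A mA.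
rewrite image_measureE.
have -> : mix D @^-1` [set f : prod_sp | forall i, i \in S -> A i (f i)] =
    box [fset i in S | D i]%fset A `*` box [fset i in S | ~~ D i]%fset A.
  apply/seteqP; split => [[w w'] /= fA|[w w'] [/= fA fA'] i iS].
    split => i; rewrite !inE => /andP[iS Di]; have := fA i iS; rewrite /mix/=.
      by rewrite Di.
    by rewrite (negbTE Di).
  by rewrite /mix/=; case: ifPn => Di; [apply: fA|apply: fA']; rewrite !inE iS.
transitivity (P (box [fset i in S | D i]%fset A) * P (box [fset i in S | ~~ D i]%fset A))%E.
  apply: product_measure1E; exact: measurable_box.
rewrite /box !(Pmu _ _ mA) -EFinM; congr EFin.
by rewrite [RHS](big_fsetID _ D).
Qed.

End product_spaces.

(** * The quenched walk *)

Section walk.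
Context {R : realType} {d : nat}.
Implicit Types (s t : seq (lattice d)) (w : environment R d).

Definition follow s : set (trajectory d) := agree_upto (size s) (pos s).

Definition next_in s (U : set (lattice d)) : set (trajectory d) :=
  follow s `&` [set X | U (X (size s).+1 - X (size s))].

Lemma measurable_event (k : nat) (A : set (lattice d)) :
  measurable [set X : trajectory d | A (X k)].
Proof.
rewrite -[X in measurable X]setTI.
exact: (@measurable_coord nat _ (lattice d) k measurableT A).
Qed.

Lemma measurable_follow s : measurable (follow s).
Proof.
rewrite (_ : follow s = \bigcap_(k in [set k | (k <= size s)%N])
    [set X : trajectory d | [set pos s k] (X k)]).
  apply: bigcap_measurable; first by exists 0%N.
  by move=> k _; exact: measurable_event.
by apply/seteqP; split => X /= XF k; exact: XF.
Qed.

Lemma pos_end s : pos s (size s) = \sum_(u <- s) u.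
Proof. by rewrite /pos take_size. Qed.

Lemma pos_rcons s u k : (k <= size s)%N -> pos (rcons s u) k = pos s k.
Proof. by move=> ks; rewrite /pos -cats1 takel_cat. Qed.

Lemma pos_rcons_end s u : pos (rcons s u) (size s).+1 = pos s (size s) + u.
Proof.
by rewrite -(size_rcons s u) !pos_end -cats1 big_cat/= big_seq1.
Qed.

Lemma follow_rconsE s u : follow (rcons s u) = next_in s [set u].
Proof.
apply/seteqP; split => [X XF|X [XF /= Xu] k].
  have Xk k : (k <= size s)%N -> X k = pos s k.
    by move=> ks; rewrite XF ?size_rcons ?(leqW ks)// pos_rcons.
  split => [k /Xk//|/=].
  rewrite (Xk (size s))// (XF (size s).+1) ?size_rcons//.
  by rewrite pos_rcons_end addrAC subrr add0r.
rewrite size_rcons leq_eqVlt => /predU1P[->|ks]; last by rewrite pos_rcons//; exact: XF.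
by rewrite pos_rcons_end -Xu -(XF (size s) (leqnn _)) addrC subrK.
Qed.

Lemma next_inE s U : next_in s U = \bigcup_(u in U) follow (rcons s u).
Proof.
apply/seteqP; split => [X [XF XU]|X [u Uu]].
  by exists (X (size s).+1 - X (size s)) => //; rewrite follow_rconsE; split.
by rewrite follow_rconsE => -[XF /= Xu]; split => //=; rewrite Xu.
Qed.

Lemma measurable_next_in s U : measurable (next_in s U).
Proof.
rewrite next_inE; apply: (@countable_bigcup_measurable _ _ 'rV[int]_d) => u _.
exact: measurable_follow.
Qed.

Lemma esum_follow_rcons (m : {measure set (trajectory d) -> \bar R}) s U :
  \esum_(u in U) m (follow (rcons s u)) = m (next_in s U).
Proof.
rewrite next_inE (@measure_esum R _ _ m 'rV[int]_d)//.
  by move=> u _; exact: measurable_follow.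
move=> u v _ _ [X []]; rewrite !follow_rconsE => -[_ /= Xu] [_ /= Xv].
by rewrite -Xu -Xv.
Qed.

(** The local time includes the present visit, which uses the cookie stored one
index lower. *)
Definition visits s : nat := (local_time (pos s) (size s) (pos s (size s))).-1.

Lemma visitsE s : visits s = count (fun k => pos s k == pos s (size s)) (iota 0 (size s)).
Proof.
rewrite /visits /local_time big_nat_recr//= eqxx addn1/=.
rewrite /index_iota subn0 -sum1_count [RHS]big_mkcond.
by apply: eq_bigr => k _; case: (_ == _).
Qed.

Section quenched.
Variables (Q : R.-pker environment R d ~> trajectory d).
Hypothesis Q_quenched : forall w, is_quenched_law (0 : lattice d) w (Q w).

Definition quenched_weight w s := Q w (follow s).

Lemma quenched_nil w : quenched_weight w [::] = 1%E.
Proof.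
case: (Q_quenched w) => Q0 _; rewrite -Q0; congr (Q w _).
apply/seteqP; split => X /=; first by move=> /(_ 0%N (leqnn _)) ->; rewrite /pos big_nil.
by move=> X0 k; rewrite leqn0 => /eqP->; rewrite X0 /pos big_nil.
Qed.

Lemma quenched_rcons w s u :
  quenched_weight w (rcons s u) = (quenched_weight w s * w (pos s (size s)) (visits s) [set u])%E.
Proof.
case: (Q_quenched w) => _ /(_ (size s) (pos s) u) <-; rewrite /quenched_weight follow_rconsE.
congr (Q w _); apply/seteqP; split => X [XF /= Xu]; split => //=.
  by rewrite -Xu addrC subrK.
by rewrite Xu addrAC subrr add0r.
Qed.

Lemma quenched_le1 w A : measurable A -> (Q w A <= 1)%E.
Proof.
move=> mA; apply: le_trans (sprob_kernel_le1 Q w).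
by apply: le_measure; rewrite ?inE.
Qed.

Lemma quenched_fin w s : quenched_weight w s \is a fin_num.
Proof.
rewrite ge0_fin_numE ?measure_ge0//.
by rewrite (le_lt_trans (quenched_le1 _ (measurable_follow s)))// ltry.
Qed.

Lemma quenched_next w s U :
  Q w (next_in s U) = (quenched_weight w s * w (pos s (size s)) (visits s) U)%E.
Proof.
rewrite -esum_follow_rcons.
pose p : {measure set (lattice d) -> \bar R} := w (pos s (size s)) (visits s).
have pE : p U = \esum_(u in U) p [set u].
  rewrite -(@measure_esum R _ _ p 'rV[int]_d U (fun u => [set u]))//.
    by rewrite bigcup_imset1 image_id.
  by move=> u v _ _ [x [/= -> ->]].
have qfin := quenched_fin w s.
rewrite -/(p U) pE -(fineK qfin) -esumZl//; last by rewrite fine_ge0// measure_ge0.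
by apply: eq_esum => u _; rewrite -/(quenched_weight w _) quenched_rcons fineK.
Qed.

(** Each transition reads a cookie at its departure site only. *)
Lemma quenched_local w w' s :
  (forall k, (k < size s)%N -> w (pos s k) = w' (pos s k)) -> quenched_weight w s = quenched_weight w' s.
Proof.
elim/last_ind: s => [|s u IHs] ww'; first by rewrite !quenched_nil.
rewrite !quenched_rcons IHs; last first.
  move=> k ks; rewrite -(pos_rcons u (ltnW ks)) ww'// size_rcons.
  exact: leqW.
have := ww' (size s); rewrite size_rcons pos_rcons// => ->//.
Qed.

Definition shift_env (z : lattice d) w : environment R d := fun x => w (z + x).

(** Sites from which [s] does not depart have local time zero at the end of [s], so
a continuation that departs from such sites only has the law of a fresh walk. *)
Lemma quenched_cat w s t :
  (forall i j, (i < size s)%N -> (j < size t)%N ->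
     pos s i <> pos s (size s) + pos t j) ->
  quenched_weight w (s ++ t) = (quenched_weight w s * quenched_weight (shift_env (pos s (size s)) w) t)%E.
Proof.
elim/last_ind: t => [|t u IHt] disj; first by rewrite cats0 quenched_nil mule1.
rewrite -rcons_cat !quenched_rcons IHt; last first.
  move=> i j si tj; rewrite -(pos_rcons u (ltnW tj)); apply: disj => //.
  by rewrite size_rcons; exact: leqW.
rewrite -muleA; congr (_ * (_ * _))%E.
have endE : pos (s ++ t) (size (s ++ t)) = pos s (size s) + pos t (size t).
  by rewrite !pos_end big_cat.
have posl k : (k <= size s)%N -> pos (s ++ t) k = pos s k.
  by move=> ks; rewrite /pos takel_cat.
have posr k : pos (s ++ t) (size s + k) = pos s (size s) + pos t k.
  rewrite /pos take_cat ltnNge leq_addr/= addKn big_cat/=.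
  by rewrite take_size.
have vE : visits (s ++ t) = visits t.
  rewrite !visitsE endE size_cat iotaD count_cat add0n.
  rewrite (_ : count _ (iota 0 (size s)) = 0%N); last first.
    apply/eqP; rewrite -leqn0 leqNgt -has_count; apply/hasPn => k.
    rewrite mem_iota/= => ks; rewrite posl ?(ltnW ks)//.
    apply/eqP; rewrite -(pos_rcons u (leqnn (size t))).
    by apply: disj => //; rewrite size_rcons.
  rewrite (_ : iota (size s) _ = map (addn (size s)) (iota 0 (size t))); last first.
    by rewrite -iotaDl addn0.
  rewrite count_map add0n.
  by apply: eq_count => k /=; rewrite posr (inj_eq (addrI _)).
by rewrite vE endE.
Qed.

End quenched.

End walk.

(** * The annealed walk and its projection *)

Section annealed.
Context {R : realType} {d : nat}.
Implicit Types (s t : seq (lattice d)) (w : environment R d).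
Variables (mu : probability (cookies R d) R) (PP : probability (environment R d) R).
Hypothesis PP_iid : is_product_measure mu PP.
Variable Q : R.-pker environment R d ~> trajectory d.
Hypothesis Q_quenched : forall w, is_quenched_law (0 : lattice d) w (Q w).

Definition walk_law : {measure set (trajectory d) -> \bar R} :=
  mkcomp_noparam (kprobability (measurable_cst (PP : pprobability _ R))) Q (tt : unit).

Lemma walk_lawE A : walk_law A = (\int[PP]_w Q w A)%E.
Proof. by []. Qed.

Lemma annealed_law_snd (A : set (trajectory d)) : measurable A ->
  annealed_law PP Q (snd @^-1` A) = walk_law A.
Proof.
move=> mA; rewrite /annealed_law -[RHS]/(kcomp_noparam _ _ _ _).
by rewrite kcomp_noparamE.
Qed.

Lemma walk_law_setT : walk_law setT = 1%E.
Proof.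
rewrite walk_lawE (eq_integral (cst 1%E)); last first.
  by move=> w _; rewrite prob_kernel.
by rewrite integral_cst// mul1e; exact: probability_setT.
Qed.

Lemma measurable_quenched A : measurable A ->
  measurable_fun [set: environment R d] (fun w => Q w A).
Proof. exact: measurable_kernel. Qed.

Lemma walk_law_le1 A : measurable A -> (walk_law A <= 1)%E.
Proof. by move=> mA; rewrite -walk_law_setT le_measure ?inE. Qed.

Lemma walk_law_fin A : measurable A -> walk_law A \is a fin_num.
Proof.
move=> mA; rewrite ge0_fin_numE ?measure_ge0//.
by rewrite (le_lt_trans (walk_law_le1 mA))// ltry.
Qed.

Lemma measurable_cookie z m (U : set (lattice d)) :
  measurable_fun [set: environment R d] (fun w => w z m U).
Proof.
have mf : measurable_fun [set: environment R d]
    (fun w => w z m : pprobability (lattice d) R).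
  apply: (measurableT_comp (measurable_coord m) (measurable_coord z)).
exact: (@measurable_kernel _ _ _ _ _ (kprobability mf)).
Qed.

Lemma walk_law_next s U : walk_law (next_in s U) =
  (\int[PP]_w (Q w (follow s) * w (pos s (size s)) (visits s) U))%E.
Proof.
by rewrite walk_lawE; apply: eq_integral => w _; rewrite (quenched_next Q_quenched).
Qed.

(** Each marginal of the environment is the common law of the cookies. *)
Lemma site_ae (P : cookies R d -> Prop) z :
  {ae mu, forall e, P e} -> {ae PP, forall w : environment R d, P (w z)}.
Proof.
move=> [N [mN N0 PN]]; exists ((fun w : environment R d => w z) @^-1` N); split.
- by rewrite -[X in measurable X]setTI; exact: measurable_coord.
- have := PP_iid [fset z]%fset (fun _ => mN).
  rewrite big_seq_fset1 N0/= => PN0; apply: etrans PN0; congr (PP _).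
  apply/seteqP; split => w /= wN; first by move=> i; rewrite inE => /eqP->.
  by apply: wN; rewrite inE.
- by move=> w /= nP; apply: PN.
Qed.

Definition path_weight s : R := fine (walk_law (follow s)).

Lemma path_weightE s : (path_weight s)%:E = walk_law (follow s).
Proof. by rewrite fineK// walk_law_fin//; exact: measurable_follow. Qed.

Lemma path_weight_nil : path_weight [::] = 1.
Proof.
apply: EFin_inj; rewrite path_weightE walk_lawE (eq_integral (cst 1%E)).
  by rewrite integral_cst// mul1e; exact: probability_setT.
by move=> w _; rewrite -/(quenched_weight Q w _) (quenched_nil Q_quenched).
Qed.

(** Assemble the environment from two independent copies, the first one used at
the departure sites of [s] and the second one elsewhere: then [s] and [t] depend
on different copies, and the shift to the end of [s] preserves the law. *)
Lemma path_weight_cat s t :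
  (forall i j, (i < size s)%N -> (j < size t)%N ->
     pos s i <> pos s (size s) + pos t j) ->
  path_weight (s ++ t) = path_weight s * path_weight t.
Proof.
move=> disj; apply: EFin_inj; rewrite EFinM !path_weightE !walk_lawE.
set z := pos s (size s) in disj *.
pose D : pred (lattice d) := fun x => x \in [seq pos s i | i <- iota 0 (size s)].
have mqs : measurable_fun [set: environment R d] (fun w => Q w (follow s)).
  by apply: measurable_quenched; exact: measurable_follow.
have mqt : measurable_fun [set: environment R d] (fun w => Q w (follow t)).
  by apply: measurable_quenched; exact: measurable_follow.
have mshift : measurable_fun [set: environment R d] (shift_env z : environment R d -> environment R d).
  exact: (measurable_reindex (fun x => z + x)).
have mqst : measurable_fun [set: environment R d] (fun w => Q (shift_env z w) (follow t)).
  exact: (measurableT_comp mqt mshift).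
have q0 w A : (0 <= Q w A)%E by exact: measure_ge0.
pose F w := (Q w (follow s) * Q (shift_env z w) (follow t))%E.
have mF : measurable_fun [set: environment R d] F by exact: emeasurable_funM.
have F0 w : (0 <= F w)%E by rewrite mule_ge0.
transitivity (\int[PP]_w F w)%E.
  by apply: eq_integral => w _; rewrite -/(quenched_weight Q w _) (quenched_cat Q_quenched).
transitivity (\int[image_measure (PP \x PP)%E (measurable_mix D)]_w F w)%E.
  apply: eq_measure_integral => A mA _.
  exact: (esym (product_measure_mix D PP_iid mA)).
rewrite integral_image_measure//.
transitivity (\int[(PP \x PP)%E]_ww (Q ww.1 (follow s) * Q (shift_env z ww.2) (follow t)))%E.
  apply: eq_integral => -[w w'] _; rewrite /F; congr (_ * _)%E.
    apply: (quenched_local Q_quenched) => k ks.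
    rewrite /mix /D ifT//; apply/mapP; exists k => //.
    by rewrite mem_iota.
  apply: (quenched_local Q_quenched) => k kt.
  rewrite /shift_env /mix /D ifF//; apply/negbTE/negP => /mapP[i].
  by rewrite mem_iota/= => si /esym; exact: disj.
rewrite fubini_tonelli1/=; last 2 first.
- apply: emeasurable_funM.
    exact: (measurableT_comp mqs measurable_fst).
  exact: (measurableT_comp mqst measurable_snd).
- by move=> ww; rewrite mule_ge0.
rewrite /fubini_F/=.
have qsfin w : Q w (follow s) = (fine (Q w (follow s)))%:E.
  by rewrite fineK// (quenched_fin Q w s).
transitivity (\int[PP]_w (Q w (follow s) * \int[PP]_w' Q (shift_env z w') (follow t)))%E.
  apply: eq_integral => w _; rewrite qsfin ge0_integralZl_EFin//.
have tE : (\int[PP]_w' Q (shift_env z w') (follow t) = walk_law (follow t))%E.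
  rewrite walk_lawE.
  rewrite -(integral_image_measure PP mshift (g := fun w => Q w (follow t)))//.
  apply: eq_measure_integral => A mA _; rewrite image_measureE.
  apply: (product_measure_reindex (t := fun x => - z + x) _ PP_iid) => // x.
  by rewrite addrA addNr add0r.
by rewrite tE ge0_integralZr.
Qed.

End annealed.

Section lazy_projection.
Context {R : realType} {d0 d1 : nat}.
Local Notation d := (d0 + d1)%N.
Variables (mu : probability (cookies R d) R) (PP : probability (environment R d) R).
Hypothesis PP_iid : is_product_measure mu PP.
Variable Q : R.-pker environment R d ~> trajectory d.
Hypothesis Q_quenched : forall w, is_quenched_law (0 : lattice d) w (Q w).
Variable delta : R.
Hypothesis delta_gt0 : 0 < delta.
Variable q : probability (lattice d1) R.
Hypothesis q0 : q [set 0] = 0%E.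
Hypothesis projection_lazy : forall m : nat, {ae mu, forall e : cookies R d,
  exists2 alpha : R, delta <= alpha &
    forall A : set (lattice d1),
      pushforward (e m) (@last_coords d0 d1) A
      = (alpha%:E * q A + (1 - alpha)%:E * \d_(0%R : lattice d1) A)%E}.

Local Notation lc := (@last_coords d0 d1).
Local Notation law := (walk_law PP Q).

Definition jump_law (v : lattice d1) : R := fine (q [set v]).

Lemma jump_lawE v : (jump_law v)%:E = q [set v].
Proof. by rewrite fineK// fin_num_measure. Qed.

(** The minimum keeps the rate in [0, 1[ for every [delta]. *)
Definition hold_rate : R := 1 - Num.min delta 2^-1.

Lemma hold_rate01 : 0 <= hold_rate < 1.
Proof.
rewrite /hold_rate subr_ge0 gtrBl lt_min delta_gt0 invr_gt0 ltr0n/= andbT.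
by rewrite ge_min invf_le1// ler1n orbT.
Qed.

(** As [q] does not charge the origin, [1 - alpha] is the probability of holding;
this eliminates [alpha], which need not be measurable in the cookie. *)
Lemma lazy_cookie m : {ae mu, forall e : cookies R d,
  (e m [set u | lc u = 0%R] <= hold_rate%:E)%E /\
  forall v, v != 0 ->
    (e m [set u | lc u = v] + q [set v] * e m [set u | lc u = 0%R] = q [set v])%E}.
Proof.
have := projection_lazy m; apply: filterS => e [alpha dalpha He].
have e0 : e m [set u | lc u = 0] = (1 - alpha)%:E.
  have := He [set 0]; rewrite /pushforward q0 mule0 add0e diracE mem_set// mule1.
  by [].
split.
  rewrite e0 lee_fin /hold_rate lerB//.
  by rewrite (le_trans _ dalpha)// ge_min lexx.
move=> v v0; rewrite e0.
have -> : e m [set u | lc u = v] = (alpha%:E * q [set v])%E.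
  have := He [set v]; rewrite /pushforward diracE memNset; last first.
    by move=> /= v0'; rewrite v0' eqxx in v0.
  by rewrite mule0 adde0.
by rewrite -!jump_lawE -!EFinM -EFinD; congr EFin; ring.
Qed.

Definition hold_path_weight (s : seq (lattice d)) : R :=
  fine (law (next_in s [set u | lc u = 0])).

Lemma walk_law_next_fin s U : law (next_in s U) \is a fin_num.
Proof. by apply: walk_law_fin; exact: measurable_next_in. Qed.

Lemma hold_path_weightE s :
  (hold_path_weight s)%:E = law (next_in s [set u | lc u = 0]).
Proof. by rewrite fineK// walk_law_next_fin. Qed.

Lemma hold_path_weight_le s : hold_path_weight s <= hold_rate * path_weight PP Q s.
Proof.
rewrite -lee_fin /hold_path_weight fineK ?walk_law_next_fin//.
rewrite EFinM path_weightE (walk_law_next _ Q_quenched) walk_lawE.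
have mq : measurable_fun [set: environment R d] (fun w => Q w (follow s)).
  by apply: measurable_quenched; exact: measurable_follow.
rewrite -ge0_integralZl_EFin//; last by case/andP: hold_rate01.
apply: ae_ge0_le_integral => //.
- by move=> w _; rewrite mule_ge0.
- by apply: emeasurable_funM => //; exact: measurable_cookie.
- by move=> w _; rewrite mule_ge0// lee_fin; case/andP: hold_rate01.
- exact: measurable_funeM.
- have := site_ae PP_iid (pos s (size s)) (lazy_cookie (visits s)).
  apply: filterS => w [wle _] _.
  by rewrite muleC lee_wpmul2r.
Qed.

Lemma jump_path_weight s v : v != 0 ->
  law (next_in s [set u | lc u = v])
  = (jump_law v * (path_weight PP Q s - hold_path_weight s))%:E.
Proof.
move=> v0; rewrite mulrBr EFinB; apply/eqP.
rewrite eq_sym sube_eq//; last by rewrite fin_num_adde_defl.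
rewrite !EFinM path_weightE hold_path_weightE.
rewrite !(walk_law_next _ Q_quenched) walk_lawE.
have mq : measurable_fun [set: environment R d] (fun w => Q w (follow s)).
  by apply: measurable_quenched; exact: measurable_follow.
have mc U : measurable_fun [set: environment R d]
   (fun w => Q w (follow s) * w (pos s (size s)) (visits s) U)%E.
  by apply: emeasurable_funM => //; exact: measurable_cookie.
have jl0 : 0 <= jump_law v by rewrite fine_ge0.
rewrite -!ge0_integralZl_EFin//; last by move=> w _; rewrite mule_ge0.
rewrite -ge0_integralD//; last 3 first.
- by move=> w _; rewrite mule_ge0.
- by move=> w _; rewrite mule_ge0// mule_ge0.
- exact: measurable_funeM.
apply/eqP/ge0_ae_eq_integral => //.
- exact: measurable_funeM.
- by apply: emeasurable_funD => //; exact: measurable_funeM.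
- by move=> w _; rewrite mule_ge0.
- by move=> w _; rewrite adde_ge0// mule_ge0// mule_ge0.
have := site_ae PP_iid (pos s (size s)) (lazy_cookie (visits s)).
apply: filterS => w [_ /(_ v v0)]; rewrite -jump_lawE => wE _.
by rewrite muleCA -ge0_muleDr// ?mule_ge0// wE muleC.
Qed.

Lemma jump_law_sum1 : \esum_(v in [set: lattice d1]) (jump_law v)%:E = 1%E.
Proof.
under eq_esum do rewrite jump_lawE.
rewrite -(@measure_esum R _ _ q 'rV[int]_d1 setT (fun v => [set v]))//.
  rewrite bigcup_imset1 image_id; exact: probability_setT.
by move=> u v _ _ [x [/= -> ->]].
Qed.

Local Notation exc := (is_excursion lc).

Lemma last_coordsD u v : lc (u + v) = lc u + lc v.
Proof. by rewrite /last_coords raddfD. Qed.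

Lemma last_coords_pos s k : lc (pos s k) = pos (map lc s) k.
Proof.
rewrite /pos -map_take; elim: (take k s) => [|u t IHt].
  by rewrite !big_nil /last_coords raddf0.
by rewrite /= !big_cons last_coordsD IHt.
Qed.

Lemma last_coords_hold (h : seq (lattice d)) u j : is_hold lc h -> (j <= size h)%N ->
  lc (pos (rcons h u) j) = 0.
Proof.
move=> hh jh; rewrite pos_rcons// last_coords_pos /pos big1_seq// => v /andP[_].
move=> /mem_take /mapP[x xh ->].
by apply/eqP; move/allP: hh; apply.
Qed.

Lemma last_coords_excursion (e : excursion (V := lattice d)) : exc e ->
  lc (pos (excursion_steps e) (size (excursion_steps e))) = lc e.2.
Proof.
case: e => h u /andP[/= hh _]; rewrite /excursion_steps/= size_rcons.
rewrite pos_rcons_end last_coordsD -(pos_rcons u (leqnn _)).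
by rewrite last_coords_hold// add0r.
Qed.

Lemma pos_catr (T : zmodType) (s t : seq T) j :
  pos (s ++ t) (size s + j) = pos s (size s) + pos t j.
Proof.
by rewrite /pos take_cat ltnNge leq_addr/= addKn big_cat/= take_size.
Qed.

Lemma last_coords_end (g : seq (excursion (V := lattice d))) : all exc g ->
  lc (pos (steps g) (size (steps g))) = pos (jumps lc g) (size g).
Proof.
elim: g => [_|e g IHg /= /andP[ve vg]].
  by rewrite /pos !big_nil /last_coords raddf0.
rewrite (_ : steps (e :: g) = excursion_steps e ++ steps g)// size_cat pos_catr.
by rewrite last_coordsD last_coords_excursion// IHg// [in RHS]/pos/= big_cons.
Qed.

(** Holding steps do not move the projection. Thus a cut time of the jumps
separates the sites read by the walk before it from those read after it. *)
Lemma departure_sites (g : seq (excursion (V := lattice d))) k :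
  all exc g -> (k < size (steps g))%N ->
  exists2 i, (i < size g)%N & lc (pos (steps g) k) = pos (jumps lc g) i.
Proof.
elim: g k => [|e g IHg] k //= /andP[ve vg].
rewrite (_ : steps (e :: g) = excursion_steps e ++ steps g)// size_cat => ks.
have [ek|ke] := leqP (size (excursion_steps e)) k.
  have [i ig posi] : exists2 i, (i < size g)%N &
      lc (pos (steps g) (k - size (excursion_steps e))) = pos (jumps lc g) i.
    by apply: IHg => //; rewrite ltn_subLR.
  exists i.+1 => //; rewrite -(subnKC ek) pos_catr last_coordsD posi.
  by rewrite last_coords_excursion// [in RHS]/pos/= big_cons.
exists 0%N => //; rewrite [RHS]/pos take0 big_nil.
have -> : pos (excursion_steps e ++ steps g) k = pos (excursion_steps e) k.
  by rewrite /pos takel_cat// ltnW.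
case: e ve ks ke => h u /andP[/= hh _] _; rewrite /excursion_steps/= size_rcons ltnS.
exact: last_coords_hold.
Qed.

Theorem walk_excursion_weights :
  excursion_weights lc (path_weight PP Q) hold_path_weight jump_law hold_rate.
Proof.
split.
- by move=> s; rewrite fine_ge0.
- exact: path_weight_nil.
- exact: hold_rate01.
- move=> s; under eq_esum do rewrite path_weightE.
  by rewrite esum_follow_rcons fineK// walk_law_next_fin.
- exact: hold_path_weight_le.
- move=> s v v0; under eq_esum do rewrite path_weightE.
  by rewrite esum_follow_rcons jump_path_weight.
- by move=> v; rewrite fine_ge0.
- by rewrite /jump_law q0.
- exact: jump_law_sum1.
- move=> g1 g2 v1 v2 gcut; rewrite steps_cat (path_weight_cat PP_iid)// => i j i1 j2.
  have [i' i'1 pi] := departure_sites v1 i1.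
  have [j' j'2 pj] := departure_sites v2 j2.
  move=> /(congr1 lc); rewrite last_coordsD pi pj.
  have jE : pos (jumps lc (g1 ++ g2)) (size g1 + j') =
      lc (pos (steps g1) (size (steps g1))) + pos (jumps lc g2) j'.
    by rewrite last_coords_end// /jumps map_cat -(size_map (fun e => lc e.2)) pos_catr.
  rewrite -jE.
  have -> : pos (jumps lc g1) i' = pos (jumps lc (g1 ++ g2)) i'.
    by rewrite /jumps map_cat /pos takel_cat// size_map ltnW.
  apply: gcut => //; rewrite leq_addr/= size_map size_cat leq_add2l.
  exact: ltnW.
Qed.

End lazy_projection.

(** * Cut times of the two-sided walk *)

(** If the density of [b] to the right of [j] exceeds [lam] on some
window of length at most [T], jump over that window; the windows chosen greedily
are disjoint and cover all such [j]. *)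
Lemma covering_count {R : realType} (b : nat -> bool) (lam : R) (T N j : nat) : 0 <= lam ->
  lam * (count (fun i => `[< exists n, (0 < n <= T)%N /\
           lam * n%:R < (count b (iota i n))%:R :> R >]) (iota j N))%:R
  <= (count b (iota j (N + T)))%:R.
Proof.
move=> lam0; set E := (fun i : nat => _).
have [m] := ubnP N; elim: m => // m IHm in N j *; rewrite ltnS => Nm.
case: N => [|N] in Nm *; first by rewrite mulr0.
have [Ej|nEj] := boolP (E j); last first.
  rewrite /= (negbTE nEj) add0n; apply: le_trans (IHm N j.+1 _) _ => //.
  by rewrite ler_nat /= leq_addl.
have [n [/andP[n0 nT] nb]] := asboolP _ Ej.
have [Nn|nN] := leqP N.+1 n.
  apply: (@le_trans _ _ (lam * n%:R)).
    rewrite ler_wpM2l// ler_nat (leq_trans (count_size _ _))// size_iota//.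
  apply: le_trans (ltW nb) _; rewrite ler_nat.
  have -> : (N.+1 + T = n + (N.+1 + T - n))%N by lia.
  by rewrite iotaD count_cat leq_addr.
have -> : (N.+1 = n + (N.+1 - n))%N by lia.
rewrite -addnA !(iotaD _ n) !count_cat !natrD mulrDr lerD//.
  apply: le_trans (ltW nb); rewrite ler_wpM2l// ler_nat.
  by rewrite (leq_trans (count_size _ _))// size_iota.
apply: IHm; lia.
Qed.

Section finite_observations.
Context {d : measure_display} {S : measurableType d} {T : countType}.

Lemma measurable_observations (f : nat -> S -> T) (n : nat) (A : set (seq T)) :
  (forall k t, measurable [set x | f k x = t]) ->
  measurable [set x | A [seq f k x | k <- iota 0 n]].
Proof.
move=> mf.
rewrite (_ : mkset _ = \bigcup_(y in A) [set x | [seq f k x | k <- iota 0 n] = y]); last first.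
  apply/seteqP; split => [x Ax|x [y Ay /= ->]//].
  by exists [seq f k x | k <- iota 0 n].
apply: countable_bigcup_measurable => y _.
elim: n y => [|n IHn] y.
  case: y => [|t y]; last first.
    rewrite (_ : mkset _ = set0)//; apply/seteqP; split => x //=.
  rewrite (_ : mkset _ = setT)//; apply/seteqP; split => x //=.
have E x : [seq f k x | k <- iota 0 n.+1] = rcons [seq f k x | k <- iota 0 n] (f n x).
  by rewrite -addn1 iotaD map_cat cats1 add0n.
case/lastP: y => [|y t].
  by rewrite (_ : mkset _ = set0)//; apply/seteqP; split => x.
rewrite (_ : mkset _ = [set x | [seq f k x | k <- iota 0 n] = y] `&` [set x | f n x = t]).
  exact: measurableI.
apply/seteqP; split => x; rewrite /mkset E; first by move=> /rcons_inj[].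
by move=> [/= -> ->].
Qed.

End finite_observations.

Section two_sided.
Context {R : realType} {d1 : nat}.
Local Notation G := (lattice d1).
Local Notation Xi := (product_space int G).
Implicit Types (xi : Xi) (c i : int).
Variable q : probability G R.
Variable nu : {measure set Xi -> \bar R}.
Hypothesis nu_iid : is_product_measure q nu.
Local Notation jl := (jump_law q).

Definition int_word xi i (n : nat) : seq G := [seq xi (i + k%:Z) | k <- iota 0 n].

(** Cut times are expressed through increments, whose law is stationary: the
positions at the two ends of a block of increments agree exactly when the block
sums to zero. *)
Definition int_cut xi c : Prop :=
  forall a b : nat, \sum_(v <- int_word xi (c - 1 - a%:Z) (a + b).+1) v <> 0.

Lemma measurable_int_word i n (A : set (seq G)) :
  measurable [set xi : Xi | A (int_word xi i n)].
Proof.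
apply: (@measurable_observations _ _ 'rV[int]_d1 (fun k (xi : Xi) => xi (i + k%:Z)) n A).
move=> k t; rewrite -[X in measurable X]setTI.
exact: (@measurable_coord int _ G (i + k%:Z) measurableT [set t]).
Qed.

Lemma nu_word_eq n (y : seq G) : size y = n ->
  nu [set xi : Xi | int_word xi 0 n = y] = (word_weight jl y)%:E.
Proof.
move=> yn.
pose r := [seq k%:Z | k <- iota 0 n].
pose S := [fset j in r]%fset.
have memS j : (j \in S) = (j \in r) by rewrite !inE.
have -> : [set xi : Xi | int_word xi 0 n = y] =
    [set xi : Xi | forall j, j \in S -> [set nth 0 y `|j|%N] (xi j)].
  apply/seteqP; split => xi /=.
    move=> <- j; rewrite memS => /mapP[k]; rewrite mem_iota/= => kn ->.
    by rewrite (nth_map 0%N) ?size_iota// nth_iota// add0r.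
  move=> H; apply: (@eq_from_nth _ 0); first by rewrite size_map size_iota.
  move=> k; rewrite size_map size_iota => kn.
  rewrite (nth_map 0%N) ?size_iota// nth_iota// add0r add0n H//.
  by rewrite memS; apply/mapP; exists k => //; rewrite mem_iota.
rewrite (nu_iid S (A := fun j => [set nth 0 y `|j|%N]) (fun _ => I)).
congr EFin; rewrite (perm_big r)/=; last first.
  apply: uniq_perm; rewrite ?fset_uniq// ?map_inj_uniq ?iota_uniq//.
  by move=> k j [].
by rewrite big_map /word_weight [RHS](big_nth 0) /index_iota subn0 yn.
Qed.

Lemma nu_word n (A : set (seq G)) :
  nu [set xi : Xi | A (int_word xi 0 n)] =
  \esum_(y in words G n `&` A) (word_weight jl y)%:E.
Proof.
rewrite (_ : mkset _ = \bigcup_(y in words G n `&` A) [set xi : Xi | int_word xi 0 n = y]).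
  rewrite (@measure_esum R _ _ nu (seq 'rV[int]_d1)).
  - by apply: eq_esum => y [yn _]; exact: nu_word_eq.
  - by move=> y _; exact: (measurable_int_word 0 n [set y]).
  - by move=> y y' _ _ [xi [/= -> ->]].
apply/seteqP; split => [xi /= Axi|xi [y [_ Ay] /= ->]//].
by exists (int_word xi 0 n) => //; split=> //; rewrite /words/= size_map size_iota.
Qed.

Definition shift_int (k : int) xi : Xi := fun n => xi (k + n).

Lemma nu_shift k A : measurable A -> nu (shift_int k @^-1` A) = nu A.
Proof.
move=> mA; apply: (product_measure_reindex (t := fun n => - k + n) _ nu_iid) => // n.
by rewrite addrA addNr add0r.
Qed.

Lemma int_cut_shift k xi c : int_cut (shift_int k xi) c <-> int_cut xi (k + c).
Proof.
suff E a b : int_word (shift_int k xi) (c - 1 - a%:Z) (a + b).+1 =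
    int_word xi (k + c - 1 - a%:Z) (a + b).+1.
  by split => H a b; [rewrite -E|rewrite E].
by apply: eq_map => l; rewrite /shift_int !addrA.
Qed.

Lemma measurable_int_cut c : measurable [set xi | int_cut xi c].
Proof.
rewrite (_ : mkset _ = \bigcap_a \bigcap_b
  [set xi : Xi | [set y | \sum_(v <- y) v <> 0] (int_word xi (c - 1 - a%:Z) (a + b).+1)]).
  by apply: bigcapT_measurable => a; apply: bigcapT_measurable => b; exact: measurable_int_word.
apply/seteqP; split => [xi H a _ b _|xi H a b]; first exact: H.
exact: (H a I b I).
Qed.

Definition no_cut xi c (n : nat) : Prop :=
  forall j : nat, (j <= n)%N -> ~ int_cut xi (c + j%:Z).

Lemma measurable_no_cut c n : measurable [set xi | no_cut xi c n].
Proof.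
rewrite (_ : mkset _ = \bigcap_(j in [set j : nat | (j <= n)%N])
   ~` [set xi | int_cut xi (c + j%:Z)]).
  apply: bigcap_measurable; first by exists 0%N.
  by move=> j _; apply: measurableC; exact: measurable_int_cut.
by apply/seteqP; split => xi H j jn; exact: (H j jn).
Qed.

Lemma nu_no_cut c n : nu [set xi | no_cut xi c n] = nu [set xi | no_cut xi 0 n].
Proof.
rewrite -(nu_shift c (measurable_no_cut 0 n)); congr (nu _).
apply/seteqP; split => xi H j jn; first by rewrite int_cut_shift add0r; exact: H.
by have := H j jn; rewrite int_cut_shift add0r.
Qed.

Hypothesis nu_cut : nu [set xi | forall c, ~ int_cut xi c] = 0%E.

(** By stationarity, windows without cut time are as rare as windows centred at
the origin without cut time, and these shrink to a null event. *)
Lemma no_cut_small (eta : R) : 0 < eta -> exists L, (nu [set xi | no_cut xi 0 L] <= eta%:E)%E.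
Proof.
move=> eta0.
pose F n := [set xi : Xi | no_cut xi (- n%:Z) n.*2].
have mF n : measurable (F n) by exact: measurable_no_cut.
have F0 : \bigcap_n F n = [set xi | forall c, ~ int_cut xi c].
  apply/seteqP; split => xi H; last by move=> n _ j _; exact: H.
  move=> c; have := H (absz c) I (absz (c + (absz c)%:Z)).
  have -> : - (absz c)%:Z + (absz (c + (absz c)%:Z))%:Z = c by lia.
  by apply; lia.
have nu_fin n : (nu (F n) < +oo)%E.
  apply: (@le_lt_trans _ _ (nu setT)); first by rewrite le_measure ?inE.
  by rewrite (product_measure_setT nu_iid) ltry.
have ndF : nonincreasing_seq F.
  move=> n m nm; apply/subsetPset => xi H j jn.
  have -> : - n%:Z + j%:Z = - m%:Z + (m - n + j)%N%:Z by lia.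
  by apply: H; lia.
have := nonincreasing_cvg_mu (nu_fin 0%N) mF _ ndF.
rewrite F0 nu_cut => /(_ _)/fine_cvgP[].
  by rewrite -F0; exact: bigcapT_measurable.
move=> _ /cvgrPdist_le/(_ eta eta0)[n _ /(_ n (leqnn n))] /=.
rewrite sub0r normrN ger0_norm ?fine_ge0// => nle.
exists n.*2; rewrite -(nu_no_cut (- n%:Z)) -[X in (X <= _)%E]fineK ?lee_fin//.
by rewrite ge0_fin_numE//; exact: nu_fin.
Qed.

Definition bad xi (L : nat) (k : int) : Prop :=
  no_cut xi (k - L%:Z) L \/ no_cut xi (k + 1) L.

Lemma measurable_bad L k : measurable [set xi | bad xi L k].
Proof. by apply: measurableU; exact: measurable_no_cut. Qed.

Lemma nu_bad L k : (nu [set xi | bad xi L k] <=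
  nu [set xi | no_cut xi 0 L] + nu [set xi | no_cut xi 0 L])%E.
Proof.
rewrite -{1}(nu_no_cut (k - L%:Z) L) -(nu_no_cut (k + 1) L).
by apply: measureU2; exact: measurable_no_cut.
Qed.

Lemma bad_shift j xi L k : bad (shift_int j xi) L k <-> bad xi L (j + k).
Proof.
have E c n : no_cut (shift_int j xi) c n <-> no_cut xi (j + c) n.
  by split => H m mn; have := H m mn; rewrite int_cut_shift addrA.
by rewrite /bad !E !addrA.
Qed.

Definition bad_bit xi L (k : nat) : bool := `[< bad xi L k%:Z >].

Definition dense_bad xi L (lam : R) (T j : nat) : Prop :=
  exists n, (0 < n <= T)%N /\
    lam * n%:R < (count (bad_bit xi L) (iota j n))%:R.

Lemma measurable_dense_bad L lam T j : measurable [set xi | dense_bad xi L lam T j].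
Proof.
pose A := [set s : seq bool | exists n, (0 < n <= T)%N /\
    lam * n%:R < (count id (take n s))%:R].
rewrite (_ : mkset _ = [set xi | A [seq bad_bit xi L (j + k)%N | k <- iota 0 T]]).
  apply: (@measurable_observations _ _ bool (fun k (xi : Xi) => bad_bit xi L (j + k)%N) T A) => k t.
  have mb := measurable_bad L (j + k)%N%:Z.
  case: t.
    rewrite (_ : mkset _ = [set xi | bad xi L (j + k)%N%:Z])//.
    by apply/seteqP; split => xi /asboolP.
  rewrite (_ : mkset _ = ~` [set xi | bad xi L (j + k)%N%:Z]); first exact: measurableC.
  apply/seteqP; split => xi /=; first by move=> /negbT/asboolPn.
  by move=> nb; exact: asboolF.
have E xi n : (n <= T)%N ->
    count id (take n [seq bad_bit xi L (j + k)%N | k <- iota 0 T])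
    = count (bad_bit xi L) (iota j n).
  move=> nT; rewrite -map_take take_iota (minn_idPl nT) count_map.
  by rewrite -[in RHS](addn0 j) iotaDl count_map.
by apply/seteqP; split => xi [n [/andP[n0 nT] H]]; exists n; rewrite n0 nT ?E// -?E.
Qed.

Lemma nu_dense_bad L lam T j :
  nu [set xi | dense_bad xi L lam T j] = nu [set xi | dense_bad xi L lam T 0].
Proof.
rewrite -(nu_shift j%:Z (measurable_dense_bad L lam T 0)); congr (nu _).
have E xi n : count (bad_bit (shift_int j%:Z xi) L) (iota 0 n) =
    count (bad_bit xi L) (iota j n).
  rewrite -[in RHS](addn0 j) iotaDl count_map; apply: eq_count => k.
  by apply/asbool_equiv_eq; rewrite bad_shift.
by apply/seteqP; split => xi [n [nT H]]; exists n; rewrite E in H *.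
Qed.

(** Integrating the covering bound over [N] starting points, stationarity makes
both sides multiples of one probability; divide by [N] and let it grow. *)
Lemma maximal_ineq L (lam : R) T : 0 <= lam ->
  (lam%:E * nu [set xi | dense_bad xi L lam T 0] <= nu [set xi | bad xi L 0])%E.
Proof.
move=> lam0.
pose E j := [set xi | dense_bad xi L lam T j].
pose B k := [set xi | bad xi L k%:Z].
have mE j : measurable (E j) by exact: measurable_dense_bad.
have mB k : measurable (B k) by exact: measurable_bad.
have nuB k : nu (B k) = nu (B 0%N).
  rewrite -(nu_shift k%:Z (mB 0%N)); congr (nu _).
  by apply/seteqP; split => xi; rewrite /B /= bad_shift addr0.
have fin A : measurable A -> nu A \is a fin_num.
  move=> mA; rewrite ge0_fin_numE// (@le_lt_trans _ _ (nu setT))//.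
    by rewrite le_measure ?inE.
  by rewrite (product_measure_setT nu_iid) ltry.
have m_count N (F : nat -> set Xi) (f : Xi -> nat -> bool) :
    (forall k, measurable (F k)) -> (forall xi k, f xi k <-> F k xi) ->
    measurable_fun [set: Xi] (fun xi => (count (f xi) (iota 0 N))%:R%:E : \bar R).
  move=> mF fF.
  apply: (eq_measurable_fun (fun xi => \sum_(k <- iota 0 N) (\1_(F k) xi)%:E)%E).
    move=> xi _; rewrite sumEFin; congr EFin.
    rewrite -sum1_count natr_sum [RHS]big_mkcond.
    apply: eq_bigr => k _; rewrite indicE.
    case: ifPn => [/fF Fk|/negP fk]; first by rewrite mem_set.
    by rewrite memNset// => /fF.
  apply: emeasurable_sum => k.
  by apply/measurable_EFinP; exact: measurable_indic.
have int_count N (F : nat -> set Xi) (f : Xi -> nat -> bool) :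
    (forall k, measurable (F k)) -> (forall xi k, f xi k <-> F k xi) ->
    (\int[nu]_xi (count (f xi) (iota 0 N))%:R%:E = \sum_(0 <= k < N) nu (F k))%E.
  move=> mF fF.
  transitivity (\int[nu]_xi \sum_(0 <= k < N) (\1_(F k) xi)%:E)%E.
    apply: eq_integral => xi _; rewrite sumEFin; congr EFin.
    rewrite -sum1_count natr_sum big_mkcond /index_iota subn0.
    apply: eq_bigr => k _; rewrite indicE.
    case: ifPn => [/fF Fk|/negP fk]; first by rewrite mem_set.
    by rewrite memNset// => /fF.
  rewrite ge0_integral_sum//; last first.
    by move=> k; apply/measurable_EFinP; exact: measurable_indic.
  by apply: eq_bigr => k _; rewrite integral_indic// setIT.
have key N : lam * (N%:R * fine (nu (E 0%N))) <= (N + T)%:R * fine (nu (B 0%N)).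
  rewrite -lee_fin !EFinM !fineK ?fin//.
  have -> : (lam%:E * (N%:R%:E * nu (E 0%N)) = lam%:E *
      \int[nu]_xi (count (fun j => `[< dense_bad xi L lam T j >]) (iota 0 N))%:R%:E)%E.
    congr (_ * _)%E; rewrite (int_count N E)//; last by move=> xi k; split => /asboolP.
    under eq_bigr do rewrite nu_dense_bad.
    by rewrite sumr_const_nat subn0 mule_natl.
  have -> : ((N + T)%:R%:E * nu (B 0%N) =
      \int[nu]_xi (count (bad_bit xi L) (iota 0 (N + T)))%:R%:E)%E.
    rewrite (int_count _ B)//; last by move=> xi k; split => /asboolP.
    under eq_bigr do rewrite nuB.
    by rewrite sumr_const_nat subn0 mule_natl.
  have EE xi k : `[< dense_bad xi L lam T k >] <-> E k xi by split => /asboolP.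
  have BB xi k : bad_bit xi L k <-> B k xi by split => /asboolP.
  rewrite -ge0_integralZl_EFin//; last exact: (m_count N E).
  apply: ge0_le_integral => //.
  - by move=> xi _; rewrite lee_fin mulr_ge0.
  - by apply: measurable_funeM; exact: (m_count N E).
  - exact: (m_count _ B).
  - by move=> xi _; rewrite -EFinM lee_fin; exact: covering_count.
rewrite -(fineK (fin _ (mE 0%N))) -[leRHS](fineK (fin _ (mB 0%N))) -EFinM lee_fin.
set e := fine _ in key *; set b := fine _ in key *.
rewrite leNgt; apply/negP => be.
have eb0 : 0 < lam * e - b by rewrite subr_gt0.
have := key (Num.truncn (T%:R * b / (lam * e - b))).+1.
have := truncnS_gt (T%:R * b / (lam * e - b)).
rewrite ltr_pdivrMr//; set N := _.+1 => TN; rewrite natrD mulrDl => NT.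
have : N%:R * (lam * e - b) <= T%:R * b.
  by rewrite mulrBr lerBlDl; apply: le_trans NT; rewrite mulrCA.
by rewrite leNgt TN.
Qed.

(** Cut times of the two-sided sequence are cut times of its finite factors, so
an index is good for the factor unless it is bad for the sequence or closer than
[L] to one of the two ends. *)
Lemma bad_count_word xi L n :
  (bad_count L (int_word xi 0 n) <= count (bad_bit xi L) (iota 0 n) + L.*2)%N.
Proof.
have sw : size (int_word xi 0 n) = n by rewrite size_map size_iota.
have posE (i j : nat) : (i <= j <= n)%N -> pos (int_word xi 0 n) j - pos (int_word xi 0 n) i =
    \sum_(v <- int_word xi i%:Z (j - i)) v.
  move=> /andP[ij jn].
  have tk (k : nat) : (k <= n)%N -> take k (int_word xi 0 n) = int_word xi 0 k.
    by move=> kn; rewrite /int_word -map_take take_iota (minn_idPl kn).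
  rewrite /pos !tk//; last exact: leq_trans jn.
  rewrite -{1}(subnKC ij) /int_word iotaD map_cat big_cat/= addrC addrK.
  congr bigop; rewrite add0n (_ : iota i _ = map (addn i) (iota 0 (j - i))).
    rewrite -map_comp; apply: eq_map => k /=; by rewrite add0r PoszD.
  by rewrite -iotaDl addn0.
have cutE (c : nat) : int_cut xi c%:Z -> (c <= n)%N -> cut (int_word xi 0 n) c.
  move=> xc cn i j ic; rewrite sw => /andP[cj jn] pij.
  apply: (xc (c - 1 - i)%N (j - c)%N).
  have -> : (c%:Z - 1 - (c - 1 - i)%N%:Z = i%:Z) by lia.
  have -> : (c - 1 - i + (j - c)).+1 = (j - i)%N by lia.
  by rewrite -posE ?pij ?subrr//; lia.
have goodE k : (L <= k < n - L)%N -> ~~ bad_bit xi L k -> good L (int_word xi 0 n) k.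
  move=> /andP[Lk kn] /asboolPn /not_orP[nc1 nc2].
  rewrite /good sw Lk kn/=; apply/asboolP; split.
    move/existsNP: nc1 => [j /not_implyP[jL /contrapT xj]].
    exists (k - L + j)%N; first by lia.
    apply: cutE; last by lia.
    by have -> : (k - L + j)%N%:Z = k%:Z - L%:Z + j%:Z :> int by lia.
  move/existsNP: nc2 => [j /not_implyP[jL /contrapT xj]].
  exists (k.+1 + j)%N; first by lia.
  apply: cutE; last by lia.
  by have -> : (k.+1 + j)%N%:Z = k%:Z + 1 + j%:Z :> int by lia.
rewrite /bad_count sw.
apply: (@leq_trans (count (predU (bad_bit xi L) (predC (fun k => L <= k < n - L)%N)) (iota 0 n))).
  apply: sub_count => k /= ng; apply/norP => -[nb]; rewrite negbK => Lkn.
  by move/negP: ng; apply; exact: goodE.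
apply: leq_trans (leq_addr (count (predI (bad_bit xi L)
  (predC (fun k => L <= k < n - L)%N)) (iota 0 n)) _) _.
rewrite count_predUI leq_add2l.
rewrite -(leq_add2l (count (fun k => L <= k < n - L)%N (iota 0 n))) count_predC size_iota.
have [nL|nL] := leqP n L.*2; first by rewrite (leq_trans nL)// leq_addl.
rewrite addnC -leq_subLR -(size_iota L (n - L.*2)) -size_filter.
apply: uniq_leq_size; first exact: iota_uniq.
by move=> k; rewrite mem_filter !mem_iota; lia.
Qed.

(** Uniformity in [T] is what turns this bound into one on all lengths [n] at
once along the walk. *)
Theorem bad_words_small (lam eta : R) : 0 < lam -> 0 < eta ->
  exists L n0 : nat, forall T,
  (\esum_(y in words G T `&` [set y | exists n, (n0 <= n <= T)%N /\
      (lam * n%:R < (bad_count L (take n y))%:R)%R]) (word_weight jl y)%:E <= eta%:E)%E.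
Proof.
move=> lam0 eta0.
have le0 : 0 < lam * eta / 4 by rewrite divr_gt0// mulr_gt0.
have [L HL] := no_cut_small le0.
exists L, (Num.truncn ((L.*2)%:R / (lam / 2))).+1 => T.
rewrite -nu_word.
apply: (@le_trans _ _ (nu [set xi | dense_bad xi L (lam / 2) T 0])).
  apply: le_measure.
  - by rewrite inE; exact: measurable_int_word.
  - by rewrite inE; exact: measurable_dense_bad.
  move=> xi [n [/andP[n0 nT] nbad]]; exists n; split; first by rewrite nT (leq_ltn_trans _ n0).
  have tk : take n (int_word xi 0 T) = int_word xi 0 n.
    by rewrite /int_word -map_take take_iota (minn_idPl nT).
  rewrite tk in nbad.
  have := bad_count_word xi L n; rewrite -(ler_nat R) natrD.
  have : (L.*2)%:R <= lam / 2 * n%:R.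
    rewrite mulrC -ler_pdivrMr ?divr_gt0// (le_trans (ltW (truncnS_gt _)))//.
    by rewrite ler_nat.
  lra.
have lam20 : 0 < lam / 2 by rewrite divr_gt0.
have := maximal_ineq L T (ltW lam20).
move=> /le_trans/(_ (nu_bad L 0))/le_trans/(_ (leeD HL HL)).
set P := nu _; have P0 : (0 <= P)%E by exact: measure_ge0.
have Pfin : P \is a fin_num.
  rewrite ge0_fin_numE// (@le_lt_trans _ _ (nu setT))//.
    by apply: le_measure; rewrite ?inE//; exact: measurable_dense_bad.
  by rewrite (product_measure_setT nu_iid) ltry.
rewrite -(fineK Pfin) -EFinM -EFinD !lee_fin => H.
rewrite -(ler_pM2l lam20) (le_trans H)//; lra.
Qed.

End two_sided.

(** * From excursions to trajectories *)

Section parsing.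
Context {V : choiceType} {G : zmodType}.
Variable p : V -> G.
Implicit Types g : seq (excursion (V := V)).

(** An excursion ends at the first jump, so a sequence of steps is cut into
excursions in one way only. *)
Lemma steps_inj g g' (r r' : seq V) : all (is_excursion p) g -> all (is_excursion p) g' ->
  size g = size g' -> steps g ++ r = steps g' ++ r' -> g = g'.
Proof.
elim: g g' => [|[h u] g IHg] [|[h' u'] g'] //= /andP[/andP[/= hh ju] vg].
move=> /andP[/andP[/= hh' ju'] vg'] [sz].
rewrite (_ : steps ((h, u) :: g) = rcons h u ++ steps g)//.
rewrite (_ : steps ((h', u') :: g') = rcons h' u' ++ steps g')//.
rewrite -!catA !cat_rcons => E.
have aux (k k' : seq V) v v' s s' : is_hold p k' -> p v != 0 ->
    k ++ v :: s = k' ++ v' :: s' -> (size k' <= size k)%N.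
  move=> hk' jv Ek; rewrite leqNgt; apply/negP => lt.
  have := congr1 (fun s => nth v s (size k)) Ek.
  rewrite nth_cat ltnn subnn/= nth_cat lt => vE.
  by move/(all_nthP v): hk' => /(_ _ lt); rewrite -vE (negbTE jv).
have szh : size h = size h'.
  apply/eqP; rewrite eqn_leq (aux _ _ _ _ _ _ hh ju' (esym E)).
  by rewrite (aux _ _ _ _ _ _ hh' ju E).
move/eqP: E; rewrite eqseq_cat// => /andP[/eqP <- /=].
rewrite eqseq_cons => /andP[/eqP <- /eqP E].
by rewrite (IHg g' vg vg' sz E).
Qed.

End parsing.

Section trajectories.
Context {R : realType} {d : nat} {G : zmodType}.
Variable p : lattice d -> G.
Local Notation V := (lattice d).
Implicit Types (X : trajectory d) (g : seq (excursion (V := lattice d))).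

Definition reach X (n : nat) g : Prop :=
  excursions_size p n g /\ follow (steps g) X.

Lemma follow_steps (s : seq V) X : follow s X ->
  s = [seq X k.+1 - X k | k <- iota 0 (size s)].
Proof.
move=> Xs; apply: (@eq_from_nth _ 0); first by rewrite size_map size_iota.
move=> k ks; rewrite (nth_map 0%N) ?size_iota// nth_iota// add0n.
rewrite !Xs ?(ltnW ks)// /pos (take_nth 0 ks) -cats1 big_cat big_seq1/=.
by rewrite addrAC subrr add0r.
Qed.

Lemma reach_uniq X n g g' : reach X n g -> reach X n g' -> g = g'.
Proof.
move=> [[vg gn] Xg] [[vg' gn'] Xg'].
have sz : size g = size g' by rewrite gn gn'.
have ext s m : follow s X -> exists r, [seq X k.+1 - X k | k <- iota 0 (size s + m)] = s ++ r.
  move=> /follow_steps Xs; rewrite iotaD map_cat -Xs; by eexists.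
have [r E] := ext _ (size (steps g')) Xg.
have [r' E'] := ext _ (size (steps g)) Xg'.
by apply: (steps_inj vg vg' sz (r := r) (r' := r')); rewrite -E -E' addnC.
Qed.

Lemma follow_catl (s t : seq V) X : follow (s ++ t) X -> follow s X.
Proof.
move=> Xst k ks; rewrite Xst ?size_cat ?(leq_trans ks) ?leq_addr//.
by rewrite /pos takel_cat.
Qed.

Lemma reach_take X n m g : (m <= n)%N -> reach X n g -> reach X m (take m g).
Proof.
move=> mn [[vg gn] Xg]; split.
  split; last by rewrite size_takel// gn.
  by move: vg; rewrite -{1}(cat_take_drop m g) all_cat => /andP[].
by move: Xg; rewrite -{1}(cat_take_drop m g) steps_cat; exact: follow_catl.
Qed.

Lemma measurable_reach n (A : set (seq (excursion (V := lattice d)))) :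
  measurable [set X | exists2 g, A g & reach X n g].
Proof.
rewrite (_ : mkset _ = \bigcup_(g in excursions_size p n `&` A) follow (steps g)).
  apply: (@countable_bigcup_measurable _ _ (seq (seq 'rV[int]_d * 'rV[int]_d))) => g _.
  exact: measurable_follow.
by apply/seteqP; split => [X [g Ag [vg Xg]]|X [g [vg Ag] Xg]]; exists g.
Qed.

Variables (m : {measure set (trajectory d) -> \bar R}) (W : seq V -> R).
Hypothesis mW : forall s, m (follow s) = (W s)%:E.

Lemma measure_reach n (A : set (seq (excursion (V := lattice d)))) :
  m [set X | exists2 g, A g & reach X n g] =
  \esum_(g in excursions_size p n `&` A) (W (steps g))%:E.
Proof.
rewrite (_ : mkset _ = \bigcup_(g in excursions_size p n `&` A) follow (steps g)); last first.
  by apply/seteqP; split => [X [g Ag [vg Xg]]|X [g [vg Ag] Xg]]; exists g.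
rewrite (@measure_esum R _ _ m (seq (seq 'rV[int]_d * 'rV[int]_d))).
- by apply: eq_esum => g _; rewrite mW.
- by move=> g _; exact: measurable_follow.
- move=> g g' [vg _] [vg' _] [X [Xg Xg']].
  exact: (@reach_uniq X n).
Qed.

End trajectories.

Lemma measure_nd_bigcup_le {d : measure_display} {S : measurableType d} {R : realType}
    (m : {measure set S -> \bar R}) (F : nat -> set S) (b : \bar R) :
  (forall n, measurable (F n)) -> nondecreasing_seq F ->
  (forall n, m (F n) <= b)%E -> (m (\bigcup_n F n) <= b)%E.
Proof.
move=> mF ndF Fb.
have cF := @nondecreasing_cvg_mu _ _ _ m F mF (bigcupT_measurable F mF) ndF.
rewrite -(cvg_lim _ cF)//; apply: lime_le; last by apply: nearW.
by apply/cvg_ex; eexists; exact: cF.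
Qed.

Section concentration.
Context {R : realType} {d d1 : nat}.
Variable p : lattice d -> lattice d1.
Local Notation V := (lattice d).
Implicit Types (X : trajectory d) (g : seq (excursion (V := lattice d))).
Variable m : {measure set (trajectory d) -> \bar R}.
Hypothesis m1 : m setT = 1%E.
Variables (W Wh : seq V -> R) (q : lattice d1 -> R) (rho : R).
Hypothesis mW : forall s, m (follow s) = (W s)%:E.
Hypothesis HW : excursion_weights p W Wh q rho.
Hypothesis bad_small : forall lam eta : R, 0 < lam -> 0 < eta ->
  exists L n0 : nat, forall T,
  (\esum_(y in words (lattice d1) T `&` [set y | exists n, (n0 <= n <= T)%N /\
      (lam * n%:R < (bad_count L (take n y))%:R)%R]) (word_weight q y)%:E <= eta%:E)%E.
Variables (f : excursion (V := V) -> R) (D : R).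
Hypothesis f_ge0 : forall e, 0 <= f e.
Hypothesis f_le : forall e, f e <= D * (excursion_length e)%:R.

Let mU2 A B : measurable A -> measurable B -> (m (A `|` B) <= m A + m B)%E.
Proof. exact: measureU2. Qed.

Definition no_parse : set (trajectory d) :=
  \bigcup_n ~` [set X | exists2 g, setT g & reach p X n g].

(** The first [n] excursions exist almost surely because their weights sum to
one. *)
Lemma no_parse_null : m no_parse = 0%E.
Proof.
have mR n : measurable [set X | exists2 g, setT g & reach p X n g] by exact: measurable_reach.
apply: measure_negligible.
  by apply: bigcupT_measurable => n; exact: measurableC.
apply: negligible_bigcup => n; apply/negligibleP; first exact: measurableC.
have mR1 : m [set X | exists2 g, setT g & reach p X n g] = 1%E.
  rewrite (measure_reach p mW n setT) setIT esum_excursions_size; last first.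
    by move=> g; rewrite lee_fin (weight_ge0 HW).
  under eq_esum do rewrite (excursions_mass HW).
  exact: words_weight1 (jump_ge0 HW) (jump_sum1 HW) _.
transitivity (m setT - m (setT `&` [set X | exists2 g, setT g & reach p X n g]))%E.
  have mT : (m setT < +oo)%E by rewrite m1 ltry.
  by rewrite -setTD; apply: measureD.
by rewrite setTI m1 mR1 subee.
Qed.

Definition deviation (c eps : R) (n : nat) : set (seq (excursion (V := lattice d))) :=
  [set g | eps * n%:R < `|\sum_(e <- g) f e - c * n%:R|].

Definition late_deviation (c eps : R) (j0 : nat) : set (trajectory d) :=
  \bigcup_(j in [set j | (j0 <= j)%N])
    [set X | exists2 g, deviation c eps (j ^ 2) g & reach p X (j ^ 2) g].

Lemma measurable_late_deviation c eps j0 : measurable (late_deviation c eps j0).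
Proof. by apply: bigcup_measurable => j _; exact: measurable_reach. Qed.

Lemma inv_squares_tail (C : R) (j0 n : nat) : 0 <= C -> (0 < j0)%N ->
  \sum_(j0 <= j < n) C / (j ^ 2)%:R <= 2 * C / j0%:R.
Proof.
move=> C0 j0_gt0.
have [nj|jn] := leqP n j0; first by rewrite big_geq// !mulr_ge0.
apply: (@le_trans _ _ (2 * C * (j0%:R^-1 - n%:R^-1))); last first.
  by rewrite ler_wpM2l ?mulr_ge0// gerBl.
rewrite -opprB -(telescope_sumr (fun j : nat => j%:R^-1 : R) (ltnW jn)) -sumrN mulr_sumr.
rewrite big_nat [leRHS]big_nat; apply: ler_sum => j /andP[j0j _].
have j1 : 0 < j%:R :> R by rewrite ltr0n (leq_trans j0_gt0).
rewrite opprB -[2 * C]mulrC -mulrA ler_wpM2l// natrX -natr1.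
have j2 : j%:R + 1 != 0 :> R by rewrite gt_eqF// ltr_wpDr.
rewrite (_ : 2 * _ = 2 / (j%:R * (j%:R + 1))); last by field; rewrite j2 gt_eqF.
rewrite -[leLHS]mul1r ler_pdivrMr ?exprn_gt0// mulrAC ler_pdivlMr ?mulr_gt0// ?ltr_wpDr//.
have : 1 <= j%:R :> R by rewrite ler1n (leq_trans j0_gt0).
by move=> j_1; rewrite mul1r expr2 mulrCA ler_wpM2l ?(ltW j1)//; lra.
Qed.

(** Along the squares the error probabilities [C / j ^ 2] of the concentration
bound are summable, and the proportion of bad indices is controlled at all times
simultaneously. *)
Lemma late_deviation_small (eps eta : R) : 0 < eps -> 0 < eta ->
  exists c, exists j0, (m (late_deviation c eps j0) <= eta%:E)%E.
Proof.
move=> eps0 eta0.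
have W0 := weight_ge0 HW.
have [lam lam0 conc] := excursions_concentration HW ([::], 0) f_ge0 f_le eps0.
have eta20 : 0 < eta / 2 by rewrite divr_gt0.
have [L [n1 bads]] := bad_small lam0 eta20.
have [c [C [n0 concL]]] := conc L.
pose C' := Num.max C 0.
have C'0 : 0 <= C' by rewrite le_max lexx orbT.
pose j0 := (n0 + n1 + (Num.truncn (2 * C' / (eta / 2))).+1)%N.
have j00 : (0 < j0)%N by rewrite /j0 addnS.
have sq j : (j0 <= j)%N -> (j <= j ^ 2)%N by move=> _; rewrite expnS expn1; case: j => // j; rewrite leq_pmulr.
exists c, j0.
pose E T := [set X | exists2 n, (n1 <= n <= T)%N &
  exists2 g, lam * n%:R < (bad_count L (jumps p g))%:R & reach p X n g].
pose A j := [set X | exists2 g, deviation c eps (j ^ 2) g /\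
   (bad_count L (jumps p g))%:R <= lam * (j ^ 2)%:R & reach p X (j ^ 2) g].
have mA j : measurable (A j) by exact: measurable_reach.
have mE T : measurable (E T).
  rewrite (_ : E T = \bigcup_(n in [set n | (n1 <= n <= T)%N])
     [set X | exists2 g, lam * n%:R < (bad_count L (jumps p g))%:R & reach p X n g]).
    by apply: bigcup_measurable => n _; exact: measurable_reach.
  by apply/seteqP; split => X [n nT [g Hg Xg]]; exists n => //; exists g.
have EP T : (m (E T) <= (eta / 2)%:E)%E.
  pose E' := [set X | exists2 g, [set g | exists n, (n1 <= n <= T)%N /\
      lam * n%:R < (bad_count L (take n (jumps p g)))%:R] g & reach p X T g].
  have mE' : measurable E' by exact: measurable_reach.
  have mN : measurable no_parse.
    by apply: bigcupT_measurable => n; apply: measurableC; exact: measurable_reach.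
  apply: (@le_trans _ _ (m (E' `|` no_parse))).
    apply: le_measure; rewrite ?inE//; first exact: measurableU.
    move=> X [n /andP[n1n nT] [g Hg Xg]].
    have [|/contrapT[g' _ Xg']] := pselect (~ exists2 g, setT g & reach p X T g).
      by move=> nX; right; exists T.
    left; exists g' => //; exists n; split; first by rewrite n1n nT.
    by rewrite /jumps -map_take -(reach_uniq Xg (reach_take nT Xg')).
  apply: (le_trans (mU2 mE' mN)).
  rewrite no_parse_null adde0 (measure_reach p mW) esum_mkcondr.
  rewrite esum_excursions_size; last by move=> g; case: ifP; rewrite ?lee_fin.
  apply: le_trans (bads T); rewrite [leRHS]esum_mkcondr.
  apply: le_esum => y yT; case: ifPn => [_|/negP ny].
    rewrite -(excursions_mass HW); apply: le_esum => g _.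
    by case: ifP; rewrite lee_fin.
  rewrite esum1// => g [_ gy]; rewrite ifF//; apply/negbTE/negP => /set_mem/= H.
  by apply: ny; rewrite inE /= -gy.
have ndE : nondecreasing_seq E.
  move=> T T' TT'; apply/subsetPset => X [n /andP[n1n nT] H]; exists n => //.
  by rewrite n1n (leq_trans nT).
have EU : (m (\bigcup_T E T) <= (eta / 2)%:E)%E by exact: measure_nd_bigcup_le.
pose AU M := \big[setU/set0]_(j0 <= j < M) A j.
have AUP M : (m (AU M) <= (eta / 2)%:E)%E.
  apply: (@le_trans _ _ (\sum_(j0 <= j < M) (C' / (j ^ 2)%:R)%:E)%E).
    rewrite /AU; elim: M => [|M IHM]; first by rewrite !big_geq// measure0.
    have [jM|Mj] := leqP j0 M; last by rewrite !big_geq// measure0.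
    rewrite !big_nat_recr//=.
    have mAU : measurable (\big[setU/set0]_(j0 <= j < M) A j) by exact: bigsetU_measurable.
    apply: (le_trans (mU2 mAU (mA M))).
    apply: leeD => //; rewrite /A (measure_reach p mW).
    have n0M : (n0 <= M ^ 2)%N.
      by apply: leq_trans (sq _ jM); apply: leq_trans jM; rewrite /j0 -addnA leq_addr.
    have M0 : 0 <= (M ^ 2)%:R^-1 :> R by rewrite invr_ge0.
    apply: (@le_trans _ _ (C / (M ^ 2)%:R)%:E); last first.
      by rewrite lee_fin ler_wpM2r// le_max lexx.
    apply: le_trans (concL _ n0M); apply: esum_subset => [g [vg [dg bg]]|g _] //.
    by rewrite lee_fin.
  rewrite sumEFin lee_fin (le_trans (inv_squares_tail M C'0 j00))//.
  have j0R : 0 < j0%:R :> R by rewrite ltr0n.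
  have j0_le : (Num.truncn (2 * C' / (eta / 2))).+1%:R <= j0%:R :> R.
    by rewrite ler_nat /j0 leq_addl.
  rewrite ler_pdivrMr// -ler_pdivrMl// mulrC.
  exact: le_trans (ltW (truncnS_gt _)) j0_le.
have mAU M : measurable (AU M) by exact: bigsetU_measurable.
have ndAU : nondecreasing_seq AU.
  move=> M M' MM'; apply/subsetPset; rewrite /AU.
  have [M'j|jM'] := leqP M' j0; first by rewrite !big_geq// (leq_trans MM').
  have [Mj|jM] := leqP M j0; first by rewrite big_geq// => X [].
  rewrite (big_cat_nat (ltnW jM) MM')/=; exact: subsetUl.
have AUU : (m (\bigcup_M AU M) <= (eta / 2)%:E)%E by exact: measure_nd_bigcup_le.
apply: (@le_trans _ _ (m ((\bigcup_T E T) `|` (\bigcup_M AU M)))).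
  apply: le_measure; rewrite ?inE; first exact: measurable_late_deviation.
    by apply: measurableU; exact: bigcupT_measurable.
  move=> X [j /= jj [g dg Xg]].
  have j_sq := sq _ jj.
  have [b_le|b_gt] := leP ((bad_count L (jumps p g))%:R : R) (lam * (j ^ 2)%:R).
    right; exists j.+1 => //; rewrite /AU big_nat_recr//=; right.
    by exists g.
  left; exists (j ^ 2)%N => //; exists (j ^ 2)%N; last by exists g.
  rewrite leqnn andbT (leq_trans _ j_sq)// (leq_trans _ jj)// /j0.
  by rewrite addnAC leq_addl.
have mU1 : measurable (\bigcup_T E T) by exact: bigcupT_measurable.
have mU1' : measurable (\bigcup_M AU M) by exact: bigcupT_measurable.
apply: le_trans (mU2 mU1 mU1') _; rewrite [eta]splitr EFinD.
exact: leeD.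
Qed.

(** Two centres that are both approached with positive probability are close, so
that they all determine one limit. *)
Theorem excursion_averages_cvg : exists c : R,
  m.-negligible [set X | ~ forall eps : R, 0 < eps -> exists j0, forall j g,
     (j0 <= j)%N -> reach p X (j ^ 2) g ->
     `|\sum_(e <- g) f e - c * (j ^ 2)%:R| <= eps * (j ^ 2)%:R].
Proof.
pose centre (c eps eta : R) := [/\ 0 < eps, 0 < eta, eta < 2^-1 &
  exists j0, (m (late_deviation c eps j0) <= eta%:E)%E].
have mN : measurable no_parse.
  by apply: bigcupT_measurable => n; apply: measurableC; exact: measurable_reach.
have close c eps eta c' eps' eta' : centre c eps eta -> centre c' eps' eta' ->
    c - eps <= c' + eps'.
  move=> [eps0 eta0 eta2 [j0 Hj]] [eps0' eta0' eta2' [j0' Hj']].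
  pose B := (late_deviation c eps j0 `|` late_deviation c' eps' j0') `|` no_parse.
  have mL := measurable_late_deviation c eps j0.
  have mL' := measurable_late_deviation c' eps' j0'.
  have mLL := measurableU _ _ mL mL'.
  have : (m B < 1)%E.
    apply: le_lt_trans (mU2 mLL mN) _; rewrite no_parse_null adde0.
    apply: le_lt_trans (mU2 mL mL') _; apply: le_lt_trans (leeD Hj Hj') _.
    by rewrite -EFinD lte_fin; lra.
  have [[X nBX]|allB] := pselect (exists X, ~ B X); last first.
    have -> : B = setT.
      by apply/seteqP; split => // X _; apply: contrapT => nBX; apply: allB; exists X.
    by rewrite m1 ltxx.
  move=> _; pose j := (j0 + j0').+1.
  have [g _ Xg] : exists2 g, setT g & reach p X (j ^ 2) g.
    by apply: contrapT => nX; apply: nBX; right; exists (j ^ 2)%N.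
  have close1 : `|\sum_(e <- g) f e - c * (j ^ 2)%:R| <= eps * (j ^ 2)%:R.
    rewrite leNgt; apply/negP => dev; apply: nBX; left; left.
    by exists j; [exact: leqW (leq_addr _ _)|exists g].
  have close2 : `|\sum_(e <- g) f e - c' * (j ^ 2)%:R| <= eps' * (j ^ 2)%:R.
    rewrite leNgt; apply/negP => dev; apply: nBX; left; right.
    by exists j; [exact: leqW (leq_addl _ _)|exists g].
  have J0 : 0 < (j ^ 2)%:R :> R by rewrite ltr0n expn_gt0.
  move: close1 close2; rewrite !ler_norml => /andP[h1 _] /andP[_ h2].
  rewrite -(ler_pM2r J0) mulrBl mulrDl; lra.
have exc eps eta : 0 < eps -> 0 < eta -> eta < 2^-1 -> exists c, centre c eps eta.
  by move=> eps0 eta0 eta2; have [c H] := late_deviation_small eps0 eta0; exists c.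
pose Lo := [set x : R | exists c eps eta, centre c eps eta /\ x = c - eps].
have q0 : 0 < 4^-1 :> R by rewrite invr_gt0.
have q2 : 4^-1 < 2^-1 :> R by rewrite ltf_pV2 ?posrE// ltr_nat.
have [c1 C1] := exc 1 4^-1 ltr01 q0 q2.
have Lo0 : Lo !=set0 by exists (c1 - 1), c1, 1, 4^-1.
have supLo : has_sup Lo.
  split=> //; exists (c1 + 1) => _ [c [eps [eta [H ->]]]]; exact: close H C1.
exists (sup Lo); set cc := sup Lo.
have near_cc c eps eta : centre c eps eta -> `|c - cc| <= eps.
  move=> H; rewrite ler_distl; apply/andP; split.
    rewrite lerBlDr; apply: ge_sup => // _ [c' [eps' [eta' [H' ->]]]].
    exact: close H' H.
  by rewrite -lerBlDr; apply: ub_le_sup; [case: supLo|exists c, eps, eta].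
pose eta k : R := k.+3%:R^-1.
have eta0 k : 0 < eta k by rewrite invr_gt0.
have eta2 k : eta k < 2^-1 by rewrite ltf_pV2 ?posrE// ltr_nat.
pose eps i : R := i.+1%:R^-1.
have eps0 i : 0 < eps i by rewrite invr_gt0.
have cP i k : exists cj : R * nat, (m (late_deviation cj.1 (eps i) cj.2) <= (eta k)%:E)%E.
  by have [c [j0 H]] := late_deviation_small (eps0 i) (eta0 k); exists (c, j0).
pose cj i k := sval (cid (cP i k)).
have cjP i k : (m (late_deviation (cj i k).1 (eps i) (cj i k).2) <= (eta k)%:E)%E.
  by rewrite /cj; case: cid.
pose N := \bigcup_i \bigcap_k late_deviation (cj i k).1 (eps i) (cj i k).2.
have mLk i k : measurable (late_deviation (cj i k).1 (eps i) (cj i k).2).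
  exact: measurable_late_deviation.
have mNi i : measurable (\bigcap_k late_deviation (cj i k).1 (eps i) (cj i k).2).
  exact: bigcapT_measurable.
have negN : m.-negligible N.
  apply: negligible_bigcup => i; apply/negligibleP => //.
  apply/eqP; rewrite eq_le measure_ge0 andbT; apply/lee_addgt0Pr => e e0.
  rewrite add0e; pose k := Num.truncn e^-1.
  apply: (@le_trans _ _ (m (late_deviation (cj i k).1 (eps i) (cj i k).2))).
    by apply: le_measure; rewrite ?inE//; exact: bigcap_inf.
  apply: le_trans (cjP i k) _; rewrite lee_fin /eta invf_ple ?posrE//.
  by rewrite (le_trans (ltW (truncnS_gt _)))// ler_nat leqW.
apply: negligibleS negN => X; apply: contra_notP => nN e e0.
pose i := Num.truncn (2 / e).
have ei : 2 * eps i <= e.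
  rewrite /eps ler_pdivrMr// -ler_pdivrMl// mulrC.
  by rewrite (le_trans (ltW (truncnS_gt _))).
have [k nk] : exists k, ~ late_deviation (cj i k).1 (eps i) (cj i k).2 X.
  apply: contrapT => nk; apply: nN; exists i => // k _.
  by apply: contrapT => nk'; apply: nk; exists k.
exists (cj i k).2 => j g jj Xg.
have close1 : `|\sum_(e <- g) f e - (cj i k).1 * (j ^ 2)%:R| <= eps i * (j ^ 2)%:R.
  by rewrite leNgt; apply/negP => dev; apply: nk; exists j => //; exists g.
have near := near_cc (cj i k).1 (eps i) (eta k).
have : `|(cj i k).1 - cc| <= eps i by apply: near; split=> //; exists (cj i k).2.
move=> {}near; set n2 := (j ^ 2)%:R in close1 *.
have n20 : 0 <= n2 by [].
have -> : \sum_(e <- g) f e - cc * n2 = (\sum_(e <- g) f e - (cj i k).1 * n2)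
   + ((cj i k).1 - cc) * n2 by ring.
apply: le_trans (ler_normD _ _) _; apply: (@le_trans _ _ (2 * eps i * n2)).
  have -> : 2 * eps i * n2 = eps i * n2 + eps i * n2 by ring.
  rewrite lerD// normrM (ger0_norm n20).
  by rewrite ler_wpM2r.
by rewrite ler_wpM2r.
Qed.

End concentration.

(** * The law of large numbers *)

(** Monotonicity fills the gaps between the times [t j]. *)
Lemma ratio_cvg {R : realType} (T : nat -> R) (t : nat -> nat) (tau c : R) :
  (forall n, 0 <= T n) -> {homo T : n m / (n <= m)%N >-> n <= m} ->
  {homo t : i j / (i <= j)%N >-> (i <= j)%N} -> (forall j, (j.+1 ^ 2 <= t j)%N) ->
  (t j)%:R / (j.+1 ^ 2)%:R @[j --> \oo] --> tau ->
  T (t j) / (j.+1 ^ 2)%:R @[j --> \oo] --> c ->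
  T n / n%:R @[n --> \oo] --> c / tau.
Proof.
move=> T0 ndT ndt t_ge ct cT.
have sq0 j : 0 < (j.+1 ^ 2)%:R :> R by rewrite ltr0n expn_gt0.
have t0 j : 0 < (t j)%:R :> R.
  by rewrite ltr0n (leq_trans _ (t_ge j))// expn_gt0.
have tau1 : 1 <= tau.
  rewrite -(cvg_lim _ ct)//; apply: limr_ge; first by apply/cvg_ex; exists tau.
  by apply: nearW => j; rewrite ler_pdivlMr// mul1r ler_nat.
have tauN0 : tau != 0 by rewrite gt_eqF// (lt_le_trans _ tau1).
have sh (u : nat -> R) (l : R) : u @ \oo --> l -> u j.+1 @[j --> \oo] --> l.
  by move=> ul; rewrite -cvg_shiftS in ul.
pose r j : R := (j.+1 ^ 2)%:R / (j.+2 ^ 2)%:R.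
have cr : r @ \oo --> (1 : R).
  have -> : r = (fun j => (1 - j.+2%:R^-1) * (1 - j.+2%:R^-1)).
    apply/funext => j; rewrite /r !natrX -expr_div_n -expr2; congr (_ ^+ 2).
    have jN0 : j.+1%:R + 1 != 0 :> R by rewrite natr1.
    by rewrite -[j.+2%:R]natr1; field.
  have ch : (fun j : nat => 1 - j.+2%:R^-1 : R) @ \oo --> (1 : R).
    suff : (fun j : nat => 1 - j.+2%:R^-1 : R) @ \oo --> (1 - 0 : R) by rewrite subr0.
    by apply: cvgB; [exact: cvg_cst|exact: (sh _ _ cvg_harmonic)].
  suff : (fun j : nat => (1 - j.+2%:R^-1) * (1 - j.+2%:R^-1) : R) @ \oo --> (1 * 1 : R).
    by rewrite mulr1.
  exact: cvgM.
have ca : T (t j) / (t j.+1)%:R @[j --> \oo] --> c / tau.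
  have -> : (fun j => T (t j) / (t j.+1)%:R) = (fun j =>
      (T (t j) / (j.+1 ^ 2)%:R) * r j * ((t j.+1)%:R / (j.+2 ^ 2)%:R)^-1).
    apply/funext => j; rewrite /r; field.
    by rewrite !gt_eqF.
  suff : (fun j => (T (t j) / (j.+1 ^ 2)%:R) * r j *
      ((t j.+1)%:R / (j.+2 ^ 2)%:R)^-1) @ \oo --> c * 1 * tau^-1 by rewrite mulr1.
  apply: cvgM; first exact: cvgM.
  apply: cvgV => //; exact: (sh (fun j => (t j)%:R / (j.+1 ^ 2)%:R)).
have cb : T (t j.+1) / (t j)%:R @[j --> \oo] --> c / tau.
  have -> : (fun j => T (t j.+1) / (t j)%:R) = (fun j =>
      (T (t j.+1) / (j.+2 ^ 2)%:R) * (r j)^-1 * ((t j)%:R / (j.+1 ^ 2)%:R)^-1).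
    apply/funext => j; rewrite /r; field.
    by rewrite !gt_eqF.
  suff : (fun j => (T (t j.+1) / (j.+2 ^ 2)%:R) * (r j)^-1 *
      ((t j)%:R / (j.+1 ^ 2)%:R)^-1) @ \oo --> c * 1^-1 * tau^-1 by rewrite invr1 mulr1.
  apply: cvgM; last exact: cvgV.
  apply: cvgM; last by apply: cvgV => //; exact: oner_neq0.
  exact: (sh (fun j => T (t j) / (j.+1 ^ 2)%:R)).
apply/cvgrPdist_le => e e0.
move/cvgrPdist_le: ca => /(_ e e0)[j1 _ H1]; move/cvgrPdist_le: cb => /(_ e e0)[j2 _ H2].
exists (t (maxn j1 j2)) => // n /= tn.
have ubt j : (t j <= n)%N -> (j <= n)%N.
  by move=> tjn; apply: leq_trans tjn; apply: leq_trans (t_ge j); rewrite expnS expn1 (leq_trans (leqnSn j))// leq_pmulr.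
have [j tj jmax] := ex_maxnP (ex_intro (fun j => (t j <= n)%N) _ tn) ubt.
have jj : (maxn j1 j2 <= j)%N by exact: jmax.
have tj' : (n < t j.+1)%N by rewrite ltnNge; apply/negP => /jmax; rewrite ltnn.
have n0 : 0 < n%:R :> R by apply: lt_le_trans (t0 j) _; rewrite ler_nat.
have := H1 j (leq_trans (leq_maxl _ _) jj); rewrite !ler_distl => /andP[_ h1].
have := H2 j (leq_trans (leq_maxr _ _) jj); rewrite !ler_distl => /andP[h2 _].
have lo : T (t j) / (t j.+1)%:R <= T n / n%:R.
  apply: (@le_trans _ _ (T n / (t j.+1)%:R)).
    by rewrite ler_wpM2r ?invr_ge0 ?(ltW (t0 _))// ndT.
  by rewrite ler_wpM2l// lef_pV2 ?posrE// ler_nat ltnW.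
have hi : T n / n%:R <= T (t j.+1) / (t j)%:R.
  apply: (@le_trans _ _ (T n / (t j)%:R)).
    by rewrite ler_wpM2l// lef_pV2 ?posrE// ler_nat.
  by rewrite ler_wpM2r ?invr_ge0 ?(ltW (t0 _))// ndT// ltnW.
apply/andP; split; lra.
Qed.

Section additive_functionals.
Context {R : realType} {d d1 : nat}.
Variable p : lattice d -> lattice d1.
Local Notation V := (lattice d).
Implicit Types (X : trajectory d) (g : seq (excursion (V := lattice d))).
Variable m : {measure set (trajectory d) -> \bar R}.
Hypothesis m1 : m setT = 1%E.
Variables (W Wh : seq V -> R) (q : lattice d1 -> R) (rho : R).
Hypothesis mW : forall s, m (follow s) = (W s)%:E.
Hypothesis HW : excursion_weights p W Wh q rho.
Hypothesis bad_small : forall lam eta : R, 0 < lam -> 0 < eta ->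
  exists L n0 : nat, forall T,
  (\esum_(y in words (lattice d1) T `&` [set y | exists n, (n0 <= n <= T)%N /\
      (lam * n%:R < (bad_count L (take n y))%:R)%R]) (word_weight q y)%:E <= eta%:E)%E.

Definition excursion_sum (h : V -> R) (e : excursion (V := V)) : R :=
  \sum_(u <- excursion_steps e) h u.

Lemma sum_excursions (h : V -> R) g :
  \sum_(e <- g) excursion_sum h e = \sum_(u <- steps g) h u.
Proof. by rewrite /steps big_flatten/= big_map. Qed.

Lemma sum_steps X (h : V -> R) s : follow s X ->
  \sum_(u <- s) h u = \sum_(0 <= k < size s) h (X k.+1 - X k).
Proof.
by move=> Xs; rewrite {1}(follow_steps Xs) big_map /index_iota subn0.
Qed.

Lemma excursion_sum_bounds (h : V -> R) (C : R) e : (forall u, 0 <= h u <= C) ->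
  0 <= excursion_sum h e <= C * (excursion_length e)%:R.
Proof.
move=> hC; apply/andP; split.
  by apply: sumr_ge0 => u _; case/andP: (hC u).
rewrite /excursion_sum; apply: (@le_trans _ _ (\sum_(u <- excursion_steps e) C)).
  by apply: ler_sum => u _; case/andP: (hC u).
by rewrite big_const_seq count_predT iter_addr_0 mulr_natr size_rcons.
Qed.

Lemma excursion_sum_averages (h : V -> R) (C : R) : (forall u, 0 <= h u <= C) ->
  exists c : R, m.-negligible [set X | ~ forall eps : R, 0 < eps ->
    exists j0, forall j g, (j0 <= j)%N -> reach p X (j ^ 2) g ->
     `|\sum_(u <- steps g) h u - c * (j ^ 2)%:R| <= eps * (j ^ 2)%:R].
Proof.
move=> hC.
have f0 e : 0 <= excursion_sum h e by case/andP: (excursion_sum_bounds e hC).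
have fC e : excursion_sum h e <= C * (excursion_length e)%:R.
  by case/andP: (excursion_sum_bounds e hC).
have [c Hc] := excursion_averages_cvg m1 mW HW bad_small f0 fC.
exists c; apply: negligibleS Hc => X; apply: contra_not => H eps eps0.
have [j0 Hj0] := H eps eps0; exists j0 => j g jj Xg.
by rewrite -sum_excursions; exact: Hj0.
Qed.

(** The averages per excursion of [h] and of the constant function [1], which
counts steps, both converge; their quotient is the average of [h] per step. *)
Theorem additive_functional_lln (h : V -> R) (C : R) : (forall u, 0 <= h u <= C) ->
  exists v : R, m.-negligible [set X | ~
    ((\sum_(0 <= k < n) h (X k.+1 - X k)) / n%:R @[n --> \oo] --> v)].
Proof.
move=> hC.
have [c Hc] := excursion_sum_averages hC.
have one u : 0 <= (fun _ : V => 1 : R) u <= 1 by rewrite ler01 lexx.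
have [tau Htau] := excursion_sum_averages one.
exists (c / tau).
have mN : measurable (@no_parse d d1 p).
  by apply: bigcupT_measurable => n; apply: measurableC; exact: measurable_reach.
have HN : m.-negligible (@no_parse d d1 p).
  have H0 := no_parse_null m1 mW HW.
  by apply/(negligibleP m mN).
apply: negligibleS (negligibleU (negligibleU Hc Htau) HN) => X nX.
apply: contrapT => /not_orP[/not_orP[/contrapT Xc /contrapT Xtau] XN].
apply: nX.
have Xr n : exists g, reach p X n g.
  by apply: contrapT => nr; apply: XN; exists n => // -[g _ Xg]; apply: nr; exists g.
pose g j := sval (cid (Xr (j.+1 ^ 2)%N)).
have gP j : reach p X (j.+1 ^ 2)%N (g j) by rewrite /g; case: cid.
pose t j := size (steps (g j)).
have size_steps g' : (size g' <= size (steps g'))%N.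
  elim: g' => //= e g' IH; rewrite (_ : steps (e :: g') = excursion_steps e ++ steps g')//.
  by rewrite size_cat size_rcons addSn ltnS (leq_trans IH)// leq_addl.
have avg (h' : V -> R) c' : (forall eps : R, 0 < eps ->
    exists j0, forall j g, (j0 <= j)%N -> reach p X (j ^ 2) g ->
     `|\sum_(u <- steps g) h' u - c' * (j ^ 2)%:R| <= eps * (j ^ 2)%:R) ->
    (\sum_(u <- steps (g j)) h' u) / (j.+1 ^ 2)%:R @[j --> \oo] --> c'.
  move=> H; apply/cvgrPdist_le => e e0; have [j0 Hj0] := H e e0.
  exists j0 => // j /= jj.
  have J0 : 0 < (j.+1 ^ 2)%:R :> R by rewrite ltr0n expn_gt0.
  rewrite distrC -(ler_pM2r J0) -[X in _ * X <= _](gtr0_norm J0) -normrM mulrBl.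
  rewrite divfK ?gt_eqF//; apply: Hj0 => //; exact: leqW.
apply: (@ratio_cvg R (fun n => \sum_(0 <= k < n) h (X k.+1 - X k)) t).
- by move=> n; apply: sumr_ge0 => k _; case/andP: (hC (X k.+1 - X k)).
- move=> n n' nn'; rewrite [leRHS](big_cat_nat (leq0n n) nn')/= lerDl.
  by apply: sumr_ge0 => k _; case/andP: (hC (X k.+1 - X k)).
- move=> i j ij; rewrite /t.
  have ij2 : (i.+1 ^ 2 <= j.+1 ^ 2)%N by rewrite leq_exp2r.
  rewrite (reach_uniq (gP i) (reach_take ij2 (gP j))).
  by rewrite -[in leqRHS](cat_take_drop (i.+1 ^ 2) (g j)) steps_cat size_cat leq_addr.
- move=> j; apply: leq_trans (size_steps (g j)).
  by case: (gP j) => -[_ ->].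
- have -> : (fun j => (t j)%:R / (j.+1 ^ 2)%:R) =
      (fun j => (\sum_(u <- steps (g j)) 1) / (j.+1 ^ 2)%:R : R).
    by apply/funext => j; rewrite big_const_seq count_predT iter_addr_0.
  exact: avg.
- have -> : (fun j => (\sum_(0 <= k < t j) h (X k.+1 - X k)) / (j.+1 ^ 2)%:R) =
      (fun j => (\sum_(u <- steps (g j)) h u) / (j.+1 ^ 2)%:R).
    by apply/funext => j; rewrite (sum_steps h (gP j).2).
  exact: avg.
Qed.

End additive_functionals.

Section cut_time_transfer.
Context {R : realType} {d1 : nat}.
Implicit Types Y : product_space int (lattice d1).
Variable PY : probability (product_space int (lattice d1)) R.
Hypothesis cut_times_nonempty :
  {ae PY, forall Y : product_space int (lattice d1), cut_times Y !=set0}.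

Lemma measurable_increments :
  measurable_fun [set: product_space int (lattice d1)] (@increments d1).
Proof.
apply: measurable_to_product => n _ B _; rewrite setTI.
rewrite (_ : _ @^-1` B = \bigcup_(u in [set: 'rV[int]_d1])
    ([set Y | [set u] (Y (n - 1))] `&` [set Y | [set v | B (v - u)] (Y n)])).
  apply: (@countable_bigcup_measurable _ _ 'rV[int]_d1) => u _.
  apply: measurableI; rewrite -[X in measurable X]setTI.
    exact: (@measurable_coord int _ (lattice d1) (n - 1) measurableT).
  exact: (@measurable_coord int _ (lattice d1) n measurableT).
apply/seteqP; split => Y /=; first by move=> BY; exists (Y (n - 1)).
by move=> [u _ [/= <-]].
Qed.

(** The increment with index [n] leads into the position [n], the first one after
the cut. *)
Lemma cut_time_int_cut Y n : cut_times Y n -> int_cut (increments Y : product_space int (lattice d1)) (n + 1).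
Proof.
move=> nY a b.
have telesc i k : \sum_(v <- int_word (increments Y : product_space int (lattice d1)) i k) v =
    Y (i + k%:Z - 1) - Y (i - 1).
  rewrite /int_word big_map; elim: k => [|k IHk].
    by rewrite big_nil addr0 subrr.
  rewrite -addn1 iotaD big_cat/= IHk big_seq1 add0n /increments.
  have -> : i + (k + 1)%N%:Z - 1 = i + k%:Z by lia.
  by rewrite addrC addrA subrK.
rewrite telesc => /eqP; rewrite subr_eq0 => /eqP E.
have : ([set Y k | k in [set k | k <= n - 1]] `&`
        [set Y k | k in [set k | n <= k]]) (Y (n + b%:Z)).
  split; last by exists (n + b%:Z) => //=; lia.
  exists (n + 1 - 1 - a%:Z - 1); first by rewrite /=; lia.
  rewrite -E; congr (Y _); lia.
by rewrite nY.
Qed.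

Lemma no_int_cut_null : image_measure PY measurable_increments
  [set xi : product_space int (lattice d1) | forall c, ~ int_cut xi c] = 0%E.
Proof.
rewrite image_measureE; set N := _ @^-1` _.
have mN : measurable N.
  rewrite -[N]setTI; apply: measurable_increments => //.
  rewrite (_ : mkset _ = ~` \bigcup_(c in [set: int])
      [set xi : product_space int (lattice d1) | int_cut xi c]).
    apply: measurableC; apply: (@countable_bigcup_measurable _ _ int) => c _.
    exact: measurable_int_cut.
  apply/seteqP; split => xi /= H; first by move=> [c _ xc]; exact: (H c).
  by move=> c xc; apply: H; exists c.
apply/negligibleP => //.
apply: negligibleS cut_times_nonempty => Y /= H [n nY].
exact: H (cut_time_int_cut nY).
Qed.

End cut_time_transfer.

Lemma countable_negligible {d : measure_display} {S : measurableType d} {R : realType}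
    (m : {measure set S -> \bar R}) (T : countType) (F : T -> set S) :
  (forall i, m.-negligible (F i)) -> m.-negligible (\bigcup_i F i).
Proof.
move=> F0; pose F' n := oapp F set0 (choice.unpickle n).
have : m.-negligible (\bigcup_n F' n).
  apply: negligible_bigcup => n; rewrite /F'.
  by case: (choice.unpickle n) => [i|] /=; [exact: F0|exact: negligible_set0].
apply: negligibleS => x [i _ Fx]; exists (choice.pickle i) => //.
by rewrite /F' choice.pickleK.
Qed.

Section bounded_walk.
Context {R : realType} {d : nat}.
Variables (mu : probability (cookies R d) R) (PP : probability (environment R d) R).
Hypothesis PP_iid : is_product_measure mu PP.
Variable Q : R.-pker environment R d ~> trajectory d.
Hypothesis Q_quenched : forall w, is_quenched_law (0 : lattice d) w (Q w).
Variable K : R.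
Hypothesis support_bounded : {ae mu, forall e : cookies R d,
  forall m : nat, supported_in_box K (e m)}.

Definition in_box : set (lattice d) := [set z | forall i, `|z 0 i|%:~R <= K].

Lemma next_out_of_box s : walk_law PP Q (next_in s (~` in_box)) = 0%E.
Proof.
rewrite (walk_law_next _ Q_quenched) -(integral0 PP setT).
have mq : measurable_fun [set: environment R d] (fun w => Q w (follow s)).
  by apply: measurable_quenched; exact: measurable_follow.
apply: ge0_ae_eq_integral => //.
- by apply: emeasurable_funM => //; exact: measurable_cookie.
- by move=> w _; rewrite mule_ge0.
have := site_ae PP_iid (pos s (size s)) support_bounded.
apply: filterS => w /(_ (visits s)) wbox _ /=.
have -> : w (pos s (size s)) (visits s) (~` in_box) = 0%E.
  have := @probability_setC _ _ _ (w (pos s (size s)) (visits s)) in_box I.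
  by rewrite [X in (1 - X)%E]wbox subee.
by rewrite mule0.
Qed.

Lemma bounded_steps : (walk_law PP Q).-negligible
  [set X : trajectory d | ~ (X 0%N = 0 /\ forall k, in_box (X k.+1 - X k))].
Proof.
pose N0 : set (trajectory d) := ~` follow [::].
pose N1 : set (trajectory d) := \bigcup_(s in [set: seq 'rV[int]_d]) next_in (s : seq (lattice d)) (~` in_box).
have mN0 : measurable N0 by apply: measurableC; exact: measurable_follow.
have mnext s : measurable (next_in s (~` in_box)) by exact: measurable_next_in.
have mN1 : measurable N1 by apply: countable_bigcup_measurable => s _.
have N0_null : walk_law PP Q N0 = 0%E.
  have W1 : walk_law PP Q (follow [::]) = 1%E.
    by rewrite -(path_weightE PP Q) (path_weight_nil PP Q_quenched).
  transitivity (walk_law PP Q setT - walk_law PP Q (setT `&` follow [::]))%E.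
    have WT : (walk_law PP Q setT < +oo)%E by rewrite walk_law_setT ltry.
    by rewrite /N0 -setTD; apply: measureD => //; exact: measurable_follow.
  by rewrite setTI W1 walk_law_setT subee.
have N1_null : walk_law PP Q N1 = 0%E.
  apply: measure_negligible => //; apply: countable_negligible => s.
  by apply/negligibleP => //; exact: next_out_of_box.
have : (walk_law PP Q).-negligible (N0 `|` N1).
  by apply: negligibleU; apply/negligibleP.
apply: negligibleS => X nX.
have [X0|] := pselect (follow [::] X); last by left.
right; apply: contrapT => nN1; apply: nX; split.
  by have := X0 0%N (leqnn _); rewrite /pos big_nil.
have X00 : X 0%N = 0 by have := X0 0%N (leqnn _); rewrite /pos big_nil.
move=> k; apply: contrapT => nbox; apply: nN1.
exists [seq X i.+1 - X i | i <- iota 0 k] => //.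
have Xpos j : (j <= k)%N -> X j = pos [seq X i.+1 - X i | i <- iota 0 k] j.
  move=> jk; rewrite /pos -map_take take_iota (minn_idPl jk) big_map.
  have := telescope_sumr X (leq0n j); rewrite /index_iota subn0 => ->.
  by rewrite X00 subr0.
split; first by move=> j; rewrite size_map size_iota => /Xpos.
by rewrite /= size_map size_iota.
Qed.

End bounded_walk.

Theorem theorem1p1 (R : realType) (d0 d1 : nat)
  (d0_ge1 : (1 <= d0)%N) (d1_ge1 : (1 <= d1)%N)
  (mu : probability (cookies R (d0 + d1)) R)
  (PP : probability (environment R (d0 + d1)) R)
  (PP_iid : is_product_measure mu PP)
  (Q : R.-pker environment R (d0 + d1) ~> trajectory (d0 + d1))
  (Q_quenched : forall w : environment R (d0 + d1),
     is_quenched_law (0 : lattice (d0 + d1)) w (Q w))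
  (K : R) (K_gt0 : 0 < K)
  (support_bounded : {ae mu, forall e : cookies R (d0 + d1),
     forall m : nat, supported_in_box K (e m)})
  (delta : R) (delta_gt0 : 0 < delta)
  (q : probability (lattice d1) R) (q0 : q [set 0] = 0%E)
  (projection_lazy : forall m : nat, {ae mu, forall e : cookies R (d0 + d1),
     exists2 alpha : R, delta <= alpha &
       forall A : set (lattice d1),
         pushforward (e m) (@last_coords d0 d1) A
         = (alpha%:E * q A + (1 - alpha)%:E * \d_(0%R : lattice d1) A)%E})
  (PY : probability (product_space int (lattice d1)) R)
  (PY_walk : is_two_sided_walk q PY)
  (cut_times_nonempty : {ae PY, forall Y : product_space int (lattice d1),
     cut_times Y !=set0}) :
  exists v : 'rV[R]_(d0 + d1),
    {ae annealed_law PP Q,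
      forall wX : environment R (d0 + d1) * trajectory (d0 + d1),
        scaled_position R wX.2 n @[n --> \oo] --> v}.
Proof.
pose law := walk_law PP Q.
have HW := walk_excursion_weights PP_iid Q_quenched delta_gt0 q0 projection_lazy.
have bad_small := @bad_words_small R d1 q (image_measure PY (@measurable_increments d1))
  PY_walk.2 (no_int_cut_null cut_times_nonempty).
have lawW s : law (follow s) = (path_weight PP Q s)%:E by rewrite path_weightE.
(* On bounded steps, [h i] is the [i]-th coordinate made nonnegative by a shift. *)
pose h (i : 'I_(d0 + d1)) (u : lattice (d0 + d1)) : R :=
  Num.min (Num.max ((u 0 i)%:~R + K) 0) (2 * K).
have K2 : 0 <= 2 * K by rewrite mulr_ge0// ltW.
have h_bounds i u : 0 <= h i u <= 2 * K.
  by rewrite /h le_min K2 le_max lexx orbT/= ge_min lexx orbT.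
have hE i u : in_box K u -> h i u = (u 0 i)%:~R + K.
  move=> /(_ i); rewrite intr_norm ler_norml => /andP[lo hi].
  rewrite /h (max_idPl _); last by rewrite -lerBlDr sub0r.
  by rewrite (min_idPl _)// mulr2n mulrDl mul1r lerD2r.
have lln i := additive_functional_lln (walk_law_setT PP Q) lawW HW bad_small (h_bounds i).
pose c i := sval (cid (lln i)).
have cP i : law.-negligible [set X | ~ ((\sum_(0 <= k < n) h i (X k.+1 - X k)) / n%:R
    @[n --> \oo] --> c i)] by rewrite /c; case: cid.
exists (\row_i (c i - K)).
have neg : law.-negligible [set X | ~ (scaled_position R X n @[n --> \oo] --> \row_i (c i - K))].
  have cN : law.-negligible (\bigcup_i [set X | ~ ((\sum_(0 <= k < n) h i (X k.+1 - X k)) / n%:R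
      @[n --> \oo] --> c i)]) by exact: countable_negligible.
  apply: negligibleS (negligibleU (bounded_steps PP_iid Q_quenched support_bounded) cN) => X nX.
  apply: contrapT => /not_orP[/contrapT[X0 Xbox] Xc]; apply: nX.
  have {}Xc i : (\sum_(0 <= k < n) h i (X k.+1 - X k)) / n%:R @[n --> \oo] --> c i.
    by apply: contrapT => nc; apply: Xc; exists i.
  have coord i : scaled_position R X n 0 i @[n --> \oo] --> c i - K.
    have : (\sum_(0 <= k < n) h i (X k.+1 - X k)) / n%:R - K @[n --> \oo] --> c i - K.
      by apply: cvgB; [exact: Xc|exact: cvg_cst].
    rewrite -cvg_shiftS -[X in _ -> X]cvg_shiftS.
    apply: cvg_trans; apply: near_eq_cvg; near=> n => /=.
    rewrite /scaled_position !mxE.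
    under eq_bigr do rewrite hE//.
    rewrite big_split/= sumr_const_nat subn0 mulrDl -[K *+ n.+1]mulr_natr mulfK//.
    rewrite addrK mulrC; congr (_ * _).
    have -> : X n.+1 0 i = \sum_(0 <= k < n.+1) (X k.+1 - X k) 0 i.
      by rewrite -summxE telescope_sumr// X0 subr0.
    by rewrite rmorph_sum.
  apply/cvg_ballP => e e0.
  have : \forall n \near \oo, forall (i0 : 'I_1) i,
      ball ((\row_i (c i - K)) i0 i) e (scaled_position R X n i0 i).
    apply: filter_forall => i0; apply: filter_forall => i.
    by rewrite (ord1 i0) mxE; have /cvg_ballP/(_ e e0) := coord i.
  by apply: filterS => n.
have [A [mA A0 sA]] := neg.
exists (snd @^-1` A); split.
- by rewrite -[X in measurable X]setTI; exact: measurable_snd.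
- by rewrite annealed_law_snd.
- by move=> wX /sA.
Unshelve. all: by end_near.
Qed.
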